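(* Let $K$ be a continuous, everywhere strictly positive function on $E_*$ which depends only on the radius, i.e. $K(\xi)=K(\Vert\xi\Vert)$ for all $\xi\in E_*$. Then there exists a radial graph $\mathcal{Y}$ over $\Sigma$, of class $C^\infty$, whose mean curvature is equal to $K$ (that is, $\mathcal{M}_{\mathcal{Y}}(p)=K(p)$ for every $p\in\mathcal{Y}$) if and only if there exists a real number $r>0$ such that $$K(r\xi)=(m-1)\,r^{-1}\quad\text{for all }\xi\in\Sigma.$$
   Context: Setting. $(M,g)$ is a compact Riemannian manifold without boundary, of dimension $n\ge 1$, with Levi-Civita connection $\nabla$. $(E,\tilde g)$ is a Riemannian vector bundle over $M$ of rank $m\ge 2$, with projection $\pi:E\to M$, equipped with a fixed metric connection $\tilde\nabla$. $\Vert\xi\Vert$ is the norm of $\xi\in E$ for $\tilde g$; $E_*$ is $E$ minus the zero section; $\Sigma=\{\xi\in E:\Vert\xi\Vert=1\}$ is the unit sphere bundle. Metric and connection on $E$. The connection $\tilde\nabla$ gives a splitting $TE=HE\oplus VE$ into horizontal and vertical subbundles; $X^H$ denotes the horizontal lift of a vector field $X$ on $M$, and $s^V$ the vertical lift of a section $s$ of $E$. The Riemannian metric $G$ on the manifold $E$ is defined by $G(X^H,Y^H)=g(X,Y)$, $G(s^V,t^V)=\tilde g(s,t)$, $G(X^H,s^V)=0$. The Sasaki connection $D$ on $E$ is the ($G$-metric, in general not torsion-free) linear connection defined by $D_{X^H}Y^H=(\nabla_XY)^H$, $D_{X^H}s^V=(\tilde\nabla_Xs)^V$, $D_{s^V}Y^H=0$,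 $D_{s^V}t^V=0$. $\nu$ denotes the radial (vertical) unit vector field on $E_*$. Radial graphs and mean curvature. A radial graph over $\Sigma$ of class $C^\infty$ is the hypersurface $\mathcal{Y}=\{e^{u(\xi)}\xi:\xi\in\Sigma\}\subset E_*$ given by the embedding $\xi\mapsto e^{u(\xi)}\xi$ for some $u\in C^\infty(\Sigma)$. Let $\tilde\nu$ be the $G$-unit normal of $\mathcal{Y}$ with $G(\tilde\nu,\nu)>0$, and let $H$ be the metric induced by $G$ on $\mathcal{Y}$. The mean curvature of $\mathcal{Y}$ is the trace $\mathcal{M}_{\mathcal{Y}}=H^{ab}\,G(D_{E_a}\tilde\nu,E_b)$, where $(E_a)_{1\le a\le n+m-1}$ is any local frame tangent to $\mathcal{Y}$ and $(H^{ab})$ is the inverse of $(H(E_a,E_b))$. *)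

(* Defs.v *)
From HB Require Import structures.
From mathcomp Require Export all_boot all_order all_algebra.
From mathcomp Require Export all_classical all_reals all_analysis.
Set Implicit Arguments.
Unset Strict Implicit.
Unset Printing Implicit Defensive.
Export Order.TTheory GRing.Theory Num.Theory.
Export numFieldNormedType.Exports.
Local Open Scope classical_set_scope.
Local Open Scope ring_scope.

Section Smoothness.
Variables (R : realType) (V W : normedModType R).

(* For finite-dimensional [V], the [C^k] regularity of all the directional
   derivatives is that of the partial derivatives. *)
Fixpoint Ck (k : nat) (O : set V) (f : V -> W) : Prop :=
  match k with
  | 0%N => forall x, O x -> {for x, continuous f}
  | k'.+1 => (forall x, O x -> differentiable f x) /\
             (forall v, Ck k' O (fun x => 'D_v f x))
  end.

Definition smooth (O : set V) (f : V -> W) := forall k, Ck k O f.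

Definition smooth_at (f : V -> W) (x : V) :=
  exists2 O, open_nbhs x O & smooth O f.

End Smoothness.

(* A smooth structure is given by one chart around each point; every atlas can
   be reindexed in this way.  The record is only data: the axioms of a smooth
   manifold are [smooth_manifold] below. *)
Record atlas (R : realType) (T : Type) (V : normedModType R) := Atlas {
  dom : T -> set T;           (* [dom p] is the domain of the chart around p *)
  chart : T -> T -> V;
  unchart : T -> V -> T }.

Definition smooth_manifold (R : realType) (M : topologicalType)
    (V : normedModType R) (A : atlas M V) : Prop :=
  [/\ hausdorff_space M, @second_countable M,
      (forall p, [/\ dom A p p, open (dom A p),
                     open (chart A p @` dom A p) &
                     {in dom A p, cancel (chart A p) (unchart A p)}]),
      (forall p q, dom A p q ->
         {for q, continuous (chart A p)} /\
         {for chart A p q, continuous (unchart A p)}) &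
      (forall p p', smooth (chart A p @` (dom A p `&` dom A p'))
                           (chart A p' \o unchart A p))].

Section Germs.
Variables (R : realType) (T : Type) (V : normedModType R) (A : atlas T V).

Definition near_point (p : T) (P : T -> Prop) :=
  \forall z \near chart A p p, P (unchart A p z).

Definition smooth_near (W : normedModType R) (f : T -> W) (p : T) :=
  smooth_at (f \o unchart A p) (chart A p p).

(* The tangent space at [p] is the model space [V], through the chart around
   [p]; [dif f p v] is the differential of [f] at [p] applied to [v]. *)
Definition dif (W : normedModType R) (f : T -> W) (p : T) (v : V) : W :=
  'D_v (f \o unchart A p) (chart A p p).

(* Smoothness on an embedded submanifold [S]. *)
Definition smooth_on_subset (S : set T) (f : T -> R) :=
  forall p, S p -> exists2 f' : T -> R^o, smooth_near f' p &
    near_point p (fun q => S q -> f' q = f q).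

End Germs.

(* [coord p q] gives the coordinates in the fibre over [q] for the
   trivialization around [p], whose domain is [tdom p]. *)
Record bundle (R : realType) (T : Type) (W : normedModType R) := Bundle {
  fib :> T -> lmodType R;
  tdom : T -> set T;
  coord : forall p q : T, fib q -> W;
  frame : forall p q : T, W -> fib q }.
Arguments coord {R T W} b p q _ : rename.
Arguments frame {R T W} b p q _ : rename.
Arguments tdom {R T W} b p : rename.

Definition vector_bundle (R : realType) (M : topologicalType)
    (V W : normedModType R) (A : atlas M V) (B : bundle M W) : Prop :=
  [/\ (forall p, tdom B p p /\ open (tdom B p)),
      (forall p q, tdom B p q ->
         [/\ (forall a x y, coord B p q (a *: x + y) =
                            a *: coord B p q x + coord B p q y),
             cancel (coord B p q) (frame B p q) &
             cancel (frame B p q) (coord B p q)]) &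
      (forall p p' q w, tdom B p q -> tdom B p' q ->
         smooth_near A (fun q' => coord B p' q' (frame B p q' w)) q)].

(* The coordinate change from the chart around [q] to the chart around [p]
   induces the trivialization of the tangent bundle around [p]. *)
Definition tangent_bundle (R : realType) (T : Type) (V : normedModType R)
    (A : atlas T V) : bundle T V :=
  @Bundle R T V (fun _ => V) (dom A)
    (fun p q v => 'D_v (chart A p \o unchart A q) (chart A q q))
    (fun p q w => 'D_w (chart A q \o unchart A p) (chart A p q)).

Section MetricsConnections.
Variables (R : realType) (T : Type) (V W : normedModType R).
Variables (A : atlas T V) (B : bundle T W).

Definition section_smooth_near (s : forall q, B q) (p : T) :=
  smooth_near A (fun q => coord B p q (s q)) p.

Definition vfield_smooth_near (X : T -> V) (p : T) :=
  smooth_near A (fun q => coord (tangent_bundle A) p q (X q)) p.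

Definition bundle_metric (h : forall p, B p -> B p -> R) : Prop :=
  [/\ (forall p a x y z, h p (a *: x + y) z = a * h p x z + h p y z),
      (forall p x y, h p x y = h p y x),
      (forall p x, x != 0 -> 0 < h p x x) &
      (forall p (s t : forall q, B q),
         section_smooth_near s p -> section_smooth_near t p ->
         smooth_near A (fun q => h q (s q) (t q) : R^o) p)].

(* [cov p v s] is the covariant derivative at [p] of [s] along [v]; it is
   meaningful only for sections [s] which are smooth near [p]. As the Leibniz
   rule is required for all [f] and [s] smooth near [p], it depends only on the
   germ of [s] at [p]. *)
Definition connection (cov : forall p, V -> (forall q, B q) -> B p) : Prop :=
  [/\ (forall p a v w s, section_smooth_near s p ->
         cov p (a *: v + w) s = a *: cov p v s + cov p w s),
      (forall p v s t, section_smooth_near s p -> section_smooth_near t p ->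
         cov p v (fun q => s q + t q) = cov p v s + cov p v t),
      (forall p v (f : T -> R^o) s,
         smooth_near A f p -> section_smooth_near s p ->
         cov p v (fun q => f q *: s q) =
           (dif A f p v : R) *: s p + (f p : R) *: cov p v s) &
      (forall p X s, vfield_smooth_near X p -> section_smooth_near s p ->
         section_smooth_near (fun q => cov q (X q) s) p)].

Definition metric_compatible (h : forall p, B p -> B p -> R)
    (cov : forall p, V -> (forall q, B q) -> B p) : Prop :=
  forall p v s t, section_smooth_near s p -> section_smooth_near t p ->
    dif A (fun q => h q (s q) (t q) : R^o) p v =
      h p (cov p v s) (t p) + h p (s p) (cov p v t).

End MetricsConnections.

Section LeviCivita.
Variables (R : realType) (T : Type) (V : normedModType R) (A : atlas T V).

(* Lie bracket, computed in the chart around [p]. *)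
Definition bracket (X Y : T -> V) (p : T) : V :=
  dif A (fun q => coord (tangent_bundle A) p q (Y q)) p (X p) -
  dif A (fun q => coord (tangent_bundle A) p q (X q)) p (Y p).

Definition torsion_free (cov : T -> V -> (T -> V) -> V) : Prop :=
  forall p X Y, vfield_smooth_near A X p -> vfield_smooth_near A Y p ->
    cov p (X p) Y - cov p (Y p) X = bracket X Y p.

Definition Levi_Civita (g : T -> V -> V -> R) (cov : T -> V -> (T -> V) -> V) :=
  [/\ connection (B := tangent_bundle A) A cov,
      metric_compatible (B := tangent_bundle A) A g cov &
      torsion_free cov].

End LeviCivita.

Section TotalSpace.
Variables (R : realType) (M : Type) (V W : normedModType R).
Variables (A : atlas M V) (B : bundle M W).

Definition total := {p : M & B p}.

Definition base (xi : total) : M := projT1 xi.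
Definition vec (xi : total) : B (base xi) := projT2 xi.

(* The total space carries the topology defined by this atlas: a function is
   continuous at [xi] if it is so in the chart around [xi]. *)
Definition total_atlas : atlas total (V * W)%type :=
  @Atlas R total (V * W)%type
    (fun xi eta => dom A (base xi) (base eta) /\
                   tdom B (base xi) (base eta))
    (fun xi eta => (chart A (base xi) (base eta),
                    coord B (base xi) (base eta) (vec eta)))
    (fun xi z => let q := unchart A (base xi) z.1 in
                 existT _ q (frame B (base xi) q z.2)).

Definition bscale (r : R) (xi : total) : total :=
  existT _ (base xi) (r *: vec xi).

Definition vertical_lift (xi : total) (t : B (base xi)) : V * W :=
  (0, coord B (base xi) (base xi) t).
Arguments vertical_lift xi t : clear implicits.

(* The horizontal lift of [v] at [xi] is [ds(v) - (cov_v s)^V] for any local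
   section [s] through [xi]; here [s] has constant coordinates in the
   trivialization around the base point of [xi], so that [ds(v) = (v, 0)]. *)
Definition horizontal_lift (cov : forall p, V -> (forall q, B q) -> B p)
    (xi : total) (v : V) : V * W :=
  let p := base xi in
  (v, 0) - vertical_lift xi
    (cov p v (fun q => frame B p q (coord B p p (vec xi)))).

Definition Sasaki_metric (cov : forall p, V -> (forall q, B q) -> B p)
    (g : M -> V -> V -> R) (h : forall p, B p -> B p -> R)
    (G : total -> V * W -> V * W -> R) : Prop :=
  bundle_metric (B := tangent_bundle total_atlas) total_atlas G /\
  forall xi : total,
  [/\ (forall v w : V, G xi (horizontal_lift cov xi v)
                            (horizontal_lift cov xi w) = g (base xi) v w),
      (forall s t : B (base xi),
         G xi (vertical_lift xi s) (vertical_lift xi t) = h (base xi) s t) &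
      (forall (v : V) (s : B (base xi)),
         G xi (horizontal_lift cov xi v) (vertical_lift xi s) = 0)].

Definition Sasaki_connection (cov : forall p, V -> (forall q, B q) -> B p)
    (nabla : M -> V -> (M -> V) -> V)
    (D : total -> V * W -> (total -> V * W) -> V * W) : Prop :=
  connection (B := tangent_bundle total_atlas) total_atlas D /\
  forall (xi : total) (X Y : M -> V) (s t : forall q, B q),
  let p := base xi in
  let H (Z : M -> V) (eta : total) :=
    horizontal_lift cov eta (Z (base eta)) in
  let U (r : forall q, B q) (eta : total) :=
    vertical_lift eta (r (base eta)) in
  vfield_smooth_near A X p -> vfield_smooth_near A Y p ->
  section_smooth_near A s p -> section_smooth_near A t p ->
  [/\ D xi (H X xi) (H Y) = horizontal_lift cov xi (nabla p (X p) Y),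
      D xi (H X xi) (U s) = vertical_lift xi (cov p (X p) s),
      D xi (U s xi) (H Y) = 0 &
      D xi (U s xi) (U t) = 0].

Variable h : forall p, B p -> B p -> R.

Definition bnorm (xi : total) : R :=
  Num.sqrt (@h (base xi) (vec xi) (vec xi)).

Definition punctured : set total := [set xi : total | vec xi != 0].

Definition unit_sphere_bundle : set total := [set xi : total | bnorm xi = 1].

Definition radial_field (xi : total) : V * W :=
  vertical_lift xi ((bnorm xi)^-1 *: vec xi).

Definition radial_graph (u : total -> R) : set total :=
  [set bscale (expR (u xi)) xi | xi in unit_sphere_bundle].

End TotalSpace.
Arguments vertical_lift {R M V W B} xi t.
Arguments radial_field {R M V W B} h xi.
Arguments radial_graph {R M W B} h u.
Arguments bnorm {R M W B} h xi.
Arguments unit_sphere_bundle {R M W B} h.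
Arguments punctured {R M W B}.
Arguments bscale {R M W B} r xi.

Section Hypersurfaces.
Variables (R : realType) (T : Type) (V : normedModType R) (A : atlas T V).

(* The tangent space of [Y] at [p] consists of the velocities of the smooth
   curves in [Y] through [p]. *)
Definition tangent_vector (Y : set T) (p : T) (w : V) : Prop :=
  exists c : R -> T,
  [/\ c 0 = p,
      \forall t \near (0 : R), Y (c t) /\ dom A p (c t),
      smooth_at (chart A p \o c : R^o -> V) 0 &
      'D_1 (chart A p \o c : R^o -> V) 0 = w].

Definition tangent_frame (k : nat) (Y : set T) (p : T) (F : 'I_k -> V) : Prop :=
  (forall w, tangent_vector Y p w <->
     exists c : 'I_k -> R, w = \sum_a c a *: F a) /\
  (forall c : 'I_k -> R, \sum_a c a *: F a = 0 -> forall a, c a = 0).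

Definition oriented_unit_normal (G : T -> V -> V -> R) (nu : T -> V)
    (Y : set T) (p : T) (v : V) : Prop :=
  [/\ forall w, tangent_vector Y p w -> G p v w = 0,
      G p v v = 1 & 0 < G p v (nu p)].

(* [h] is the mean curvature at [p] of the hypersurface [Y] of dimension [k],
   whose unit normal is oriented by [nu].  To be differentiated by [D], the
   unit normal of [Y] is extended to a vector field [N] which is smooth near
   [p] in the ambient manifold; derivatives along [Y] do not depend on the
   extension. *)
Definition mean_curvature (k : nat) (G : T -> V -> V -> R)
    (D : T -> V -> (T -> V) -> V) (nu : T -> V)
    (Y : set T) (p : T) (h : R) : Prop :=
  exists N : T -> V,
  [/\ vfield_smooth_near A N p,
      near_point A p
        (fun q => Y q -> oriented_unit_normal G nu Y q (N q)) &
      forall F : 'I_k -> V, tangent_frame Y p F ->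
        let H := \matrix_(a < k, b < k) G p (F a) (F b) in
        h = \sum_a \sum_b invmx H a b * G p (D p (F a) N) (F b)].

End Hypersurfaces.

(* Main.v *)
From HB Require Import structures.
Require Import Defs.
From mathcomp Require Import ring lra.
Local Open Scope classical_set_scope.
Local Open Scope ring_scope.
Set Implicit Arguments.
Unset Strict Implicit.
Unset Printing Implicit Defensive.

(** The idea is to compare a radial graph with the sphere bundles that it
    touches.  By compactness, [u] has a maximum and a minimum on the unit sphere
    bundle; let [r1] and [r2] be the radii of the corresponding points of the
    graph.  The farthest point is a point of contact with the sphere bundle of
    radius [r1], which encloses the graph, so the mean curvature of the graph
    there is at least that of the sphere bundle, [(rank - 1) / r1]; at the
    nearest point it is at most [(rank - 1) / r2].  As the curvature of the graph
    is [K], which depends on the radius only, the intermediate value theorem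
    applied to [t * K(t)] between [r2] and [r1] gives a radius [r] with
    [r * K(r) = rank - 1] ([graph_radius]).  Conversely, the sphere bundle of
    radius [r] has mean curvature [(rank - 1) / r] everywhere
    ([sphere_curvature]).

    Both directions rest on one formula ([mean_curvature_critical]).  Let
    [radial_ext] be the extension of [u] to the punctured total space that is
    constant along rays.  The graph is the zero set of
    [F = radial_ext - log_norm], and at a point of radius [r] of the graph where
    the differential of [radial_ext] vanishes, the mean curvature is
    [(rank - 1) / r - r * S], where [S] is the sum of the second derivatives of
    [radial_ext] along an orthonormal frame.  At a maximum [S] is nonpositive,
    at a minimum nonnegative ([local_maximum], [local_minimum]); for constant
    [u] it is zero and every point is critical.

    The formula is obtained as follows.  The frame consists of horizontal lifts
    and of vertical lifts orthogonal to the radial direction ([adapted_frame]);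
    the trace does not depend on the frame ([trace_orthonormal]).  Let [W] be a
    lift extending a vector [w] of the frame, and [N] an extension of the unit
    normal.  The Sasaki connection obeys the Leibniz rule for the Sasaki metric,
    and the covariant derivative of [W] along [w] is horizontal or zero, hence
    orthogonal to [N]; so [G (D w N) w] is the derivative along [w] of [G N W]
    ([weingarten_horizontal], [weingarten_vertical]).  On the graph,
    [W + dF(W) euler] is tangent, where [euler] is the position vector, so
    [G N W = - dF(W) * G N euler] ([normal_defining]).  At the critical point
    [dF(W)] vanishes and [G N euler] is the radius; it remains to differentiate
    [dF(W)].  Its [radial_ext] part gives the second derivative of [radial_ext]
    along [w] ([hessian_field]); the differential of [log_norm] vanishes on
    horizontal lifts, because the connection of the bundle is metric, and on
    vertical lifts it is computed along straight lines of the fibre. *)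

(** * Directional derivatives and functions of class C^k *)

Section DifferentiableLinear.
Variable R : realType.
Implicit Types V W : normedModType R.

Lemma is_diff_linear V W (f : V -> W) (x : V) :
  linear f -> continuous f -> is_diff x f f.
Proof.
move=> lf cf.
pose dlM := GRing.isLinear.Build _ _ _ _ _ lf.
pose dL : {linear V -> W} := HB.pack f dlM.
apply: DiffDef; first exact: (@linear_differentiable R V W dL x cf).
exact: (@diff_lin R V W dL x cf).
Qed.

Lemma scale_is_bilinear W :
  bilinear_for
    (GRing.Scale.Law.clone _ _ *:%R _) (GRing.Scale.Law.clone _ _ *:%R _)
    (fun (a : R^o) (w : W) => a *: w).
Proof.
split=> [u'|u] a x y /=; first by rewrite scalerDl scalerA.
by rewrite scalerDr !scalerA mulrC.
Qed.

Lemma is_diff_scale V W (f : V -> R^o) (g : V -> W) x :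
  differentiable f x -> differentiable g x ->
  is_diff x (fun y => f y *: g y)
            (fun v => f x *: 'd g x v + 'd f x v *: g x).
Proof.
move=> df dg.
pose bM := bilinear_isBilinear.Build R R^o W W _ _ _ (@scale_is_bilinear W).
pose B : {bilinear R^o -> W -> W} := HB.pack (fun (a : R^o) (w : W) => a *: w) bM.
have cB : continuous (fun p : R^o * W => B p.1 p.2).
  by move=> p; apply: cvgZ; [exact: cvg_fst|exact: cvg_snd].
have dB := differentiable_bilin (f x, g x) cB.
have dp := differentiable_pair df dg.
apply: DiffDef; first exact: (differentiable_comp dp dB).
rewrite (_ : (fun y => f y *: g y) =
   (fun p : R^o * W => B p.1 p.2) \o (fun y => (f y, g y))) //.
rewrite (diff_comp dp dB) /= (diff_bilin _ cB) /=.
by rewrite (diff_pair df dg).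
Qed.

End DifferentiableLinear.

Section CkCalculus.
Variable R : realType.
Implicit Types U V W : normedModType R.

Lemma differentiable_near_eq V W (f g : V -> W) x :
  (\near x, f x = g x) -> differentiable f x -> differentiable g x.
Proof.
move=> fg df.
have dk : differentiable (g - f) x.
  have o0 : (g - f) \o shift x = cst ((g - f) x) + \0 +o_ 0 id.
    apply/eqaddoP => _/posnumP[e].
    have : \forall h \near (0 : V), f (h + x) = g (h + x).
      by have := fg; rewrite (near_shift 0) subr0.
    apply: filterS => h fgh; rewrite /= -[leLHS]/(`|(g (h + x) - f (h + x)) - ((g x - f x) + 0)|) -fgh subrr.
    by rewrite (nbhs_singleton fg) subrr addr0 subr0 normr0 mulr_ge0.
  have c0 : continuous (\0 : {linear V -> W}) by move=> ?; exact: cvg_cst.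
  apply/diff_locallyP; rewrite (diff_unique c0 o0); split => //.
have -> : g = f + (g - f) by apply/funext => y; rewrite !fctE addrC subrK.
exact: differentiableD.
Qed.

Lemma CkSP k V W (O : set V) (f : V -> W) :
  Ck k.+1 O f <->
  (forall x, O x -> differentiable f x) /\ (forall v, Ck k O ('D_v f)).
Proof. by []. Qed.

Lemma Ck_eq k V W (O : set V) (f g : V -> W) : open O ->
  (forall x, O x -> f x = g x) -> Ck k O f -> Ck k O g.
Proof.
move=> oO; elim: k f g => [|k IH] f g fg /=.
  move=> Cf x Ox.
  have nfg : \forall y \near x, f y = g y.
    by near=> y; apply: fg; near: y; exact: open_nbhs_nbhs.
  suff: g y @[y --> x] --> g x by [].
  rewrite -(fg x Ox); apply: cvg_trans (Cf x Ox).
  exact: near_eq_cvg.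
move=> [df Cf].
have nfg x : O x -> \forall y \near x, f y = g y.
  by move=> Ox; near=> y; apply: fg; near: y; exact: open_nbhs_nbhs.
split=> [x Ox|v].
  by apply: differentiable_near_eq (df x Ox); exact: nfg.
by apply: IH (Cf v) => x Ox; apply: near_eq_derive; exact: nfg.
Unshelve. all: by end_near. Qed.

Lemma CkW k V W (O : set V) (f : V -> W) : Ck k.+1 O f -> Ck k O f.
Proof.
elim: k f => [|k IH] f [df Cf] //=.
  by move=> x Ox; apply: differentiable_continuous; exact: df.
by split=> // v; apply: IH.
Qed.

Lemma Ck_cst k V W (O : set V) (c : W) : open O -> Ck k O (fun=> c).
Proof.
move=> oO; elim: k c => [|k IH] c /=; first by move=> x _; exact: cvg_cst.
split=> [x _|v]; first exact: differentiable_cst.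
apply: (@Ck_eq k _ _ O (fun=> 0)) => // x _.
by rewrite (_ : (fun=> c) = cst c) // derive_cst.
Qed.

Lemma Ck_linear k V W (O : set V) (f : V -> W) :
  open O -> linear f -> continuous f -> Ck k O f.
Proof.
move=> oO lf cf; case: k => [|k] /=; first by move=> x _; exact: cf.
split=> [x _|v]; first by case: (is_diff_linear x lf cf).
apply: (@Ck_eq k _ _ O (fun=> f v)) => //; last exact: Ck_cst.
by move=> x _; case: (is_diff_linear x lf cf) => d e; rewrite deriveE // e.
Qed.

Lemma CkD k V W (O : set V) (f g : V -> W) : open O ->
  Ck k O f -> Ck k O g -> Ck k O (fun x => f x + g x).
Proof.
move=> oO; elim: k f g => [|k IH] f g.
  by move=> Cf Cg x Ox; apply: cvgD; [exact: Cf|exact: Cg].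
move=> /CkSP[df Cf] /CkSP[dg Cg]; apply/CkSP; split=> [x Ox|v].
  by apply: differentiableD; [exact: df|exact: dg].
apply: (@Ck_eq k _ _ O (fun x => 'D_v f x + 'D_v g x)) => //; last exact: IH.
move=> x Ox; rewrite (_ : (fun x => _) = f + g) // deriveD //.
  exact/diff_derivable/df.
exact/diff_derivable/dg.
Qed.

Lemma CkZ k V W (O : set V) (f : V -> R^o) (g : V -> W) : open O ->
  Ck k O f -> Ck k O g -> Ck k O (fun x => f x *: g x).
Proof.
move=> oO; elim: k f g => [|k IH] f g.
  by move=> Cf Cg x Ox; apply: cvgZ; [exact: Cf|exact: Cg].
move=> Cf Cg; have Cf' := CkW Cf; have Cg' := CkW Cg.
move: Cf Cg => /CkSP[df Cf] /CkSP[dg Cg].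
apply/CkSP.
split=> [x Ox|v]; first by case: (is_diff_scale (df x Ox) (dg x Ox)).
apply: (@Ck_eq k _ _ O (fun x => f x *: 'D_v g x + 'D_v f x *: g x)) => //.
  move=> x Ox; have [d e] := is_diff_scale (df x Ox) (dg x Ox).
  by rewrite (deriveE _ d) e !deriveE //; [exact: df|exact: dg].
by apply: CkD => //; apply: IH.
Qed.

Lemma Ck_pair k V W U (O : set V) (f : V -> W) (g : V -> U) : open O ->
  Ck k O f -> Ck k O g -> Ck k O (fun x => (f x, g x)).
Proof.
move=> oO; elim: k f g => [|k IH] f g.
  by move=> Cf Cg x Ox; apply: cvg_pair; [exact: Cf|exact: Cg].
move=> /CkSP[df Cf] /CkSP[dg Cg]; apply/CkSP; split=> [x Ox|v].
  by apply: differentiable_pair; [exact: df|exact: dg].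
apply: (@Ck_eq k _ _ O (fun x => ('D_v f x, 'D_v g x))) => //; last exact: IH.
move=> x Ox; have dfx := df x Ox; have dgx := dg x Ox.
by rewrite !deriveE ?diff_pair //; exact: differentiable_pair.
Qed.

Lemma Ck_sum k V W (O : set V) n (f : 'I_n -> V -> W) : open O ->
  (forall i, Ck k O (f i)) -> Ck k O (fun x => \sum_i f i x).
Proof.
move=> oO; elim: n f => [|n IH] f Cf.
  apply: (@Ck_eq k _ _ O (fun=> 0)) => //; last exact: Ck_cst.
  by move=> x _; rewrite big_ord0.
apply: (@Ck_eq k _ _ O
  (fun x => f ord0 x + \sum_i f (lift ord0 i) x)) => //.
  by move=> x _; rewrite big_ord_recl.
by apply: CkD => //; apply: IH.
Qed.

(** The coordinates are required to be continuous, because linear maps between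
    arbitrary normed modules need not be continuous. *)
Definition finite_dim V := exists (d : nat) (b : 'I_d -> V) (c : 'I_d -> V -> R^o),
  [/\ forall i, linear (c i), forall i, continuous (c i) &
     forall v, v = \sum_i c i v *: b i].

Lemma derive_sum_dir V W (f : V -> W) x d (b : 'I_d -> V) (c : 'I_d -> R) :
  differentiable f x -> 'D_(\sum_i c i *: b i) f x = \sum_i c i *: 'D_(b i) f x.
Proof.
move=> df; rewrite deriveE // linear_sum.
by apply: eq_bigr => i _; rewrite linearZ deriveE.
Qed.

Lemma derive_comp V W U (f : V -> W) (g : W -> U) x v :
  differentiable f x -> differentiable g (f x) ->
  'D_v (g \o f) x = 'D_('D_v f x) g (f x).
Proof.
move=> df dg; rewrite (deriveE _ (differentiable_comp df dg)) (diff_comp df dg).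
by rewrite /= (deriveE _ df) (deriveE _ dg).
Qed.

Lemma Ck_linear_comp k V W U (O : set V) (f : V -> W) (L : W -> U) :
  open O -> linear L -> continuous L -> Ck k O f -> Ck k O (L \o f).
Proof.
move=> oO lL cL; elim: k f => [|k IH] f.
  by move=> Cf x Ox; apply: continuous_comp; [exact: Cf|exact: cL].
move=> /CkSP[df Cf]; apply/CkSP; split=> [x Ox|v].
  apply: differentiable_comp; first exact: df.
  by case: (is_diff_linear (f x) lL cL).
apply: (@Ck_eq k _ _ O (L \o 'D_v f)) => //; last exact: IH.
move=> x Ox; have [d1 e1] := is_diff_linear (f x) lL cL.
by rewrite derive_comp //; [rewrite (deriveE _ d1) e1|exact: df].
Qed.

(** The derivative of the composite along [v] is a derivative of [g] in the
    moving direction ['D_v f x].  Expanding this direction on a basis of [W]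
    gives a sum of products of functions covered by the induction. *)
Lemma Ck_comp k V W U (O : set V) (O' : set W) (f : V -> W) (g : W -> U) :
  finite_dim W -> open O -> open O' -> (forall x, O x -> O' (f x)) ->
  Ck k O f -> Ck k O' g -> Ck k O (g \o f).
Proof.
move=> [d [b [c [lc cc bE]]]] oO oO' fO.
elim: k g => [|k IH] g.
  move=> Cf Cg x Ox; apply: continuous_comp; first exact: Cf.
  by apply: Cg; exact: fO.
move=> Cf Cg; have Cf' := CkW Cf; have Cg' := CkW Cg.
move: Cf Cg => /CkSP[df Cf] /CkSP[dg Cg].
apply/CkSP.
split=> [x Ox|v].
  by apply: differentiable_comp; [exact: df|apply: dg; exact: fO].
apply: (@Ck_eq k _ _ O
  (fun x => \sum_i c i ('D_v f x) *: (('D_(b i) g) \o f) x)) => //.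
  move=> x Ox; rewrite derive_comp; [|exact: df|by apply: dg; exact: fO].
  rewrite [in RHS](bE ('D_v f x)) derive_sum_dir //; apply: dg; exact: fO.
apply: Ck_sum => // i; apply: CkZ => //; last exact: IH.
exact: (Ck_linear_comp oO (lc i) (cc i)).
Qed.

End CkCalculus.

(** * Germs of smooth functions *)

Section SmoothGerms.
Variable R : realType.
Implicit Types U V W : normedModType R.

Lemma Ck_sub k V W (A A' : set V) (f : V -> W) :
  A' `<=` A -> Ck k A f -> Ck k A' f.
Proof.
move=> sA; elim: k f => [|k IH] f; first by move=> Cf x /sA; exact: Cf.
by move=> /CkSP[df Cf]; apply/CkSP; split=> [x /sA|v]; [exact: df|exact: IH].
Qed.

Lemma smooth_at_eq V W (f g : V -> W) x :
  (\forall y \near x, f y = g y) -> smooth_at f x -> smooth_at g x.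
Proof.
move=> fg [A [oA Ax] Cf].
move: fg; rewrite /prop_near1 nbhsE => -[A' [oA' A'x] fg].
exists (A `&` A'); first by split; [exact: openI|].
move=> k; apply: (@Ck_eq _ k _ _ _ f); first exact: openI.
  by move=> y [_ /fg].
by apply: (Ck_sub _ (Cf k)) => y [].
Qed.

Lemma smooth_at_near V W (f : V -> W) x :
  smooth_at f x -> \forall y \near x, smooth_at f y.
Proof.
move=> [A oA Cf]; have := open_nbhs_nbhs oA; apply: filterS => y Ay.
by exists A => //; split=> //; case: oA.
Qed.

Lemma smooth_at_diff V W (f : V -> W) x : smooth_at f x -> differentiable f x.
Proof. by move=> [A [_ Ax] /(_ 1%N) /CkSP[df _]]; exact: df. Qed.

Lemma smooth_at_cont V W (f : V -> W) x : smooth_at f x -> {for x, continuous f}.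
Proof. by move=> /smooth_at_diff/differentiable_continuous. Qed.

Lemma smooth_at_derive V W (f : V -> W) x v :
  smooth_at f x -> smooth_at ('D_v f) x.
Proof.
by move=> [A oA Cf]; exists A => // k; have /CkSP[_] := Cf k.+1; exact.
Qed.

Lemma smooth_at_cst V W (c : W) (x : V) : smooth_at (fun=> c) x.
Proof. by exists setT => [|k]; [split=> //; exact: openT|apply: Ck_cst; exact: openT]. Qed.

Lemma smooth_at_linear V W (f : V -> W) x :
  linear f -> continuous f -> smooth_at f x.
Proof.
move=> lf cf; exists setT => [|k]; first by split=> //; exact: openT.
by apply: Ck_linear => //; exact: openT.
Qed.

Lemma smooth_atD V W (f g : V -> W) x :
  smooth_at f x -> smooth_at g x -> smooth_at (fun y => f y + g y) x.
Proof.
move=> [A [oA Ax] Cf] [A' [oA' A'x] Cg].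
exists (A `&` A') => [|k]; first by split; [exact: openI|].
apply: CkD; first exact: openI.
  by apply: Ck_sub (Cf k) => y [].
by apply: Ck_sub (Cg k) => y [].
Qed.

Lemma smooth_atZ V W (f : V -> R^o) (g : V -> W) x :
  smooth_at f x -> smooth_at g x -> smooth_at (fun y => f y *: g y) x.
Proof.
move=> [A [oA Ax] Cf] [A' [oA' A'x] Cg].
exists (A `&` A') => [|k]; first by split; [exact: openI|].
apply: CkZ; first exact: openI.
  by apply: Ck_sub (Cf k) => y [].
by apply: Ck_sub (Cg k) => y [].
Qed.

Lemma smooth_atN V W (f : V -> W) x :
  smooth_at f x -> smooth_at (fun y => - f y) x.
Proof.
move=> sf; apply: (@smooth_at_eq _ _ (fun y => (-1 : R^o) *: f y)).
  by apply: nearW => y; rewrite scaleN1r.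
by apply: smooth_atZ => //; exact: smooth_at_cst.
Qed.

Lemma smooth_atB V W (f g : V -> W) x :
  smooth_at f x -> smooth_at g x -> smooth_at (fun y => f y - g y) x.
Proof. by move=> sf sg; apply: smooth_atD => //; exact: smooth_atN. Qed.

Lemma smooth_at_pair V W U (f : V -> W) (g : V -> U) x :
  smooth_at f x -> smooth_at g x -> smooth_at (fun y => (f y, g y)) x.
Proof.
move=> [A [oA Ax] Cf] [A' [oA' A'x] Cg].
exists (A `&` A') => [|k]; first by split; [exact: openI|].
apply: Ck_pair; first exact: openI.
  by apply: Ck_sub (Cf k) => y [].
by apply: Ck_sub (Cg k) => y [].
Qed.

Lemma smooth_at_sum V W n (f : 'I_n -> V -> W) x :
  (forall i, smooth_at (f i) x) -> smooth_at (fun y => \sum_i f i y) x.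
Proof.
elim: n f => [|n IH] f sf.
  apply: (@smooth_at_eq _ _ (fun=> 0)); last exact: smooth_at_cst.
  by apply: nearW => y; rewrite big_ord0.
apply: (@smooth_at_eq _ _ (fun y => f ord0 y + \sum_i f (lift ord0 i) y)).
  by apply: nearW => y; rewrite big_ord_recl.
by apply: smooth_atD => //; exact: IH.
Qed.

Lemma smooth_at_comp V W U (f : V -> W) (g : W -> U) x :
  finite_dim W -> smooth_at f x -> smooth_at g (f x) -> smooth_at (g \o f) x.
Proof.
move=> fW sf; have cf := smooth_at_cont sf.
case: sf => A [oA Ax] Cf [A' [oA' A'x] Cg].
have : nbhs x (f @^-1` A').
  by apply: cf; apply: open_nbhs_nbhs; split.
rewrite nbhsE => -[Q [oQ Qx] fQ].
exists (A `&` Q) => [|k]; first by split; [exact: openI|].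
apply: (@Ck_comp _ k _ _ _ _ A') => //; first exact: openI.
  by move=> y [_ /fQ].
by apply: Ck_sub (Cf k) => y [].
Qed.

Lemma smooth_at_fst V W (x : V * W) : smooth_at (@fst V W) x.
Proof. by apply: smooth_at_linear => // y; exact: cvg_fst. Qed.

Lemma smooth_at_snd V W (x : V * W) : smooth_at (@snd V W) x.
Proof. by apply: smooth_at_linear => // y; exact: cvg_snd. Qed.

Lemma smooth_at_id V (x : V) : smooth_at id x.
Proof. by apply: smooth_at_linear => // y; exact: cvg_id. Qed.

Lemma finite_dim_rV n : finite_dim 'rV[R]_n.
Proof.
exists n, (fun i => delta_mx 0 i), (fun i (v : 'rV[R]_n) => v 0 i); split.
- by move=> i a u v; rewrite !mxE.
- by move=> i v; exact: coord_continuous.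
- by move=> v; exact: row_sum_delta.
Qed.

Lemma finite_dim_R : finite_dim R^o.
Proof.
exists 1%N, (fun=> 1), (fun _ v => v); split => //.
  by move=> _ v; exact: cvg_id.
by move=> v; rewrite big_ord1; exact/esym/mulr1.
Qed.

Lemma finite_dim_prod V W :
  finite_dim V -> finite_dim W -> finite_dim (V * W)%type.
Proof.
move=> [d [b [c [lc cc bE]]]] [d' [b' [c' [lc' cc' bE']]]].
exists (d + d')%N,
 (fun i : 'I_(d + d') => match fintype.split i with inl j => (b j, 0) | inr j => (0, b' j) end),
 (fun (i : 'I_(d + d')) (z : V * W) => match fintype.split i with inl j => c j z.1 | inr j => c' j z.2 end).
split.
- by move=> i; case: fintype.split => j a u v /=; [exact: lc|exact: lc'].
- move=> i; case: fintype.split => j z.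
    by apply: (@continuous_comp _ _ _ fst (c j)); [exact: cvg_fst|exact: cc].
  by apply: (@continuous_comp _ _ _ snd (c' j)); [exact: cvg_snd|exact: cc'].
- move=> [v w]; rewrite big_split_ord /=.
  rewrite (eq_bigr (fun i => (c i v *: b i, 0))); last first.
    by move=> i _; case: fintype.splitP => [j /= ij|k /= ik];
      [rewrite (_ : j = i); [congr pair; exact: scaler0|exact/val_inj]
      |have := ltn_ord i; rewrite ik ltnNge leq_addr].
  rewrite [X in _ + X](eq_bigr (fun i => (0, c' i w *: b' i))); last first.
    move=> i _; case: fintype.splitP => [j /= ij|k /= ik].
      by have := ltn_ord j; rewrite -ij ltnNge leq_addr.
    rewrite (_ : k = i); [congr pair; exact: scaler0|].
    by apply/val_inj => /=; apply/eqP; rewrite -(eqn_add2l d) -ik.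
  have pairsum k (f : 'I_k -> V) (g : 'I_k -> W) :
      \sum_i (f i, g i) = (\sum_i f i, \sum_i g i).
    by elim/big_rec3: _ => // i y1 y2 y3 _ ->.
  by rewrite !pairsum !big1_eq -bE -bE'; congr pair; rewrite ?addr0 ?add0r.
Qed.

Lemma Ck_expR k (A : set R^o) : open A -> Ck k A (expR : R^o -> R^o).
Proof.
move=> oA; elim: k => [|k IH].
  by move=> x _; exact: continuous_expR.
have dexp (x : R^o) : differentiable (expR : R^o -> R^o) x.
  exact/derivable1_diffP/derivable_expR.
apply/CkSP; split=> [x _|v]; first exact: dexp.
apply: (@Ck_eq _ k _ _ A (fun x : R^o => (v : R^o) *: (expR x : R^o))) => //.
  move=> x _; rewrite deriveE // -[v]mulr1 -[v * 1]/(v *: (1 : R^o)) linearZ /=.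
  by rewrite -deriveE // derive_val; congr (_ *: _); exact: mulr1.
by apply: CkZ => //; exact: Ck_cst.
Qed.

(** The derivative of [ln] at [x] is [expR (- ln x)], so that the induction only
    needs compositions. *)
Lemma Ck_ln k : Ck k [set x : R^o | 0 < x] (@ln R : R^o -> R^o).
Proof.
have oP : open [set x : R^o | 0 < x] by exact: open_gt.
have dln (x : R^o) : 0 < x -> differentiable (@ln R : R^o -> R^o) x.
  by move=> x0; apply/derivable1_diffP; have [] := is_derive1_ln x0.
elim: k => [|k IH].
  by move=> x /= x0; exact: continuous_ln.
apply/CkSP; split=> [x /= x0|v]; first exact: dln.
apply: (@Ck_eq _ k _ _ _
  (fun x : R^o => (v : R^o) *: ((expR \o -%R) \o @ln R) x)) => //.
  move=> x /= x0; have dx := dln x x0.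
  rewrite (deriveE _ dx) -[v]mulr1 -[v * 1]/(v *: (1 : R^o)) linearZ /=.
  rewrite -deriveE // expRN lnK //.
  by have := is_derive1_ln x0 => /@derive_val ->; congr (_ *: _); exact: mulr1.
apply: CkZ => //; first exact: Ck_cst.
apply: (@Ck_comp _ k _ _ _ _ setT) => //; first exact: finite_dim_R.
  exact: openT.
apply: (@Ck_comp _ k _ _ _ _ setT) => //; first exact: finite_dim_R.
- exact: openT.
- exact: openT.
- apply: Ck_linear => //; first exact: openT.
    by move=> a x y /=; rewrite opprD scalerN.
  exact: opp_continuous.
- by apply: Ck_expR; exact: openT.
Qed.

Lemma smooth_at_expR (x : R^o) : smooth_at (expR : R^o -> R^o) x.
Proof.
by exists setT => [|k]; [split=> //; exact: openT|apply: Ck_expR; exact: openT].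
Qed.

Lemma smooth_at_ln (x : R^o) : 0 < x -> smooth_at (@ln R : R^o -> R^o) x.
Proof.
move=> x0; exists [set x : R^o | 0 < x] => [|k]; last exact: Ck_ln.
by split=> //; exact: open_gt.
Qed.

(** Serves to differentiate a function along a vector field; as in [Ck_comp], the
    direction is expanded on a basis. *)
Lemma smooth_at_dir V W (f : V -> W) (w : V -> V) x :
  finite_dim V -> smooth_at f x -> smooth_at w x ->
  smooth_at (fun z => 'D_(w z) f z) x.
Proof.
move=> [d [b [c [lc cc bE]]]] sf sw.
apply: (@smooth_at_eq _ _ (fun z => \sum_i c i (w z) *: 'D_(b i) f z)).
  have := smooth_at_near sf; apply: filterS => z /smooth_at_diff dfz.
  by rewrite [in RHS](bE (w z)) derive_sum_dir.
apply: smooth_at_sum => i; apply: smooth_atZ; last exact: smooth_at_derive.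
apply: (@smooth_at_comp _ _ _ w (c i)) => //.
  by exists d, b, c.
exact: smooth_at_linear.
Qed.

End SmoothGerms.

(** * Inner products and orthonormal families *)

Section InnerProducts.
Variable R : realType.

Definition inner_product (U : lmodType R) (b : U -> U -> R) :=
  [/\ forall a x y z, b (a *: x + y) z = a * b x z + b y z,
      forall x y, b x y = b y x &
      forall x, x != 0 -> 0 < b x x].

Section Theory.
Variables (U : lmodType R) (b : U -> U -> R).
Hypothesis hb : inner_product b.

Lemma ipC x y : b x y = b y x. Proof. by case: hb. Qed.
Lemma ipPl a x y z : b (a *: x + y) z = a * b x z + b y z.
Proof. by case: hb. Qed.
Lemma ip0l z : b 0 z = 0.
Proof. by have := ipPl (-1) 0 0 z; rewrite scaler0 addr0; lra. Qed.
Lemma ipDl x y z : b (x + y) z = b x z + b y z.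
Proof. by rewrite -[x]scale1r ipPl mul1r scale1r. Qed.
Lemma ipZl a x z : b (a *: x) z = a * b x z.
Proof. by rewrite -[a *: x]addr0 ipPl ip0l addr0. Qed.
Lemma ipNl x z : b (- x) z = - b x z.
Proof. by rewrite -scaleN1r ipZl mulN1r. Qed.
Lemma ipBl x y z : b (x - y) z = b x z - b y z.
Proof. by rewrite ipDl ipNl. Qed.
Lemma ip0r z : b z 0 = 0. Proof. by rewrite ipC ip0l. Qed.
Lemma ipDr x y z : b z (x + y) = b z x + b z y.
Proof. by rewrite ipC ipDl !(ipC z). Qed.
Lemma ipZr a x z : b z (a *: x) = a * b z x.
Proof. by rewrite ipC ipZl (ipC z). Qed.
Lemma ip_suml I r (P : pred I) (f : I -> U) z :
  b (\sum_(i <- r | P i) f i) z = \sum_(i <- r | P i) b (f i) z.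
Proof. by elim/big_rec2: _ => [|i y1 y2 _ <-]; rewrite ?ip0l ?ipDl. Qed.
Lemma ip_sumr I r (P : pred I) (f : I -> U) z :
  b z (\sum_(i <- r | P i) f i) = \sum_(i <- r | P i) b z (f i).
Proof. by rewrite ipC ip_suml; apply: eq_bigr => i _; exact: ipC. Qed.
Lemma ip_gt0 x : x != 0 -> 0 < b x x. Proof. by case: hb => _ _; exact. Qed.
Lemma ip_ge0 x : 0 <= b x x.
Proof. by have [->|/ip_gt0/ltW //] := eqVneq x 0; rewrite ip0l. Qed.

(** For a change of frame [F = C F0] with [F0] orthonormal, the Gram matrix is
    [C C^T] and the matrix of [B] is [C B0 C^T]; [C] cancels under the trace. *)
Lemma trace_orthonormal (B : U -> U -> R) k (F F0 : 'I_k -> U) :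
  (forall a x y z, B (a *: x + y) z = a * B x z + B y z) ->
  (forall a x y z, B z (a *: x + y) = a * B z x + B z y) ->
  (forall i j, b (F0 i) (F0 j) = (i == j)%:R) ->
  (forall a, exists c : 'I_k -> R, F a = \sum_i c i *: F0 i) ->
  (forall c : 'I_k -> R, \sum_a c a *: F a = 0 -> forall a, c a = 0) ->
  \sum_a \sum_c invmx (\matrix_(a < k, c < k) b (F a) (F c)) a c * B (F a) (F c)
  = \sum_a B (F0 a) (F0 a).
Proof.
move=> Bl Br on sp fr.
have B0l z : B 0 z = 0.
  by have := Bl (-1) 0 0 z; rewrite scaler0 addr0; lra.
have B0r z : B z 0 = 0.
  by have := Br (-1) 0 0 z; rewrite scaler0 addr0; lra.
have Bsl (c : 'I_k -> R) (f : 'I_k -> U) z :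
    B (\sum_i c i *: f i) z = \sum_i c i * B (f i) z.
  by elim/big_rec2: _ => [|i y1 y2 _ <-]; rewrite ?B0l ?Bl.
have Bsr (c : 'I_k -> R) (f : 'I_k -> U) z :
    B z (\sum_i c i *: f i) = \sum_i c i * B z (f i).
  by elim/big_rec2: _ => [|i y1 y2 _ <-]; rewrite ?B0r ?Br.
have [c Fc] : exists c : 'I_k -> 'I_k -> R, forall a, F a = \sum_i c a i *: F0 i.
  exists (fun a => sval (cid (sp a))) => a; exact: svalP (cid (sp a)).
pose C := \matrix_(a < k, i < k) c a i.
pose B0 := \matrix_(i < k, j < k) B (F0 i) (F0 j).
have HE : \matrix_(a < k, d < k) b (F a) (F d) = C *m C^T.
  apply/matrixP => a d; rewrite !mxE (Fc a) ip_suml; apply: eq_bigr => i _.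
  rewrite ipZl !mxE (Fc d) ip_sumr (bigD1 i) //= ipZr on eqxx mulr1 big1 ?addr0 //.
  by move=> j /negPf ji; rewrite ipZr on eq_sym ji mulr0.
have BE : \matrix_(a < k, d < k) B (F a) (F d) = C *m B0 *m C^T.
  apply/matrixP => a d; rewrite !mxE (Fc d) Bsr; apply: eq_bigr => j _.
  rewrite (Fc a) Bsl !mxE mulrC; congr (_ * _); apply: eq_bigr => i _.
  by rewrite !mxE.
have Cu : C \in unitmx.
  rewrite -row_free_unit; apply/inj_row_free => v vC.
  have /fr v0 : \sum_a v 0 a *: F a = 0.
    under eq_bigr => a _ do rewrite Fc scaler_sumr.
    rewrite exchange_big big1 // => i _ /=.
    under eq_bigr => a _ do rewrite scalerA.
    rewrite -scaler_suml; have := congr1 (fun m : 'rV_k => m 0 i) vC.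
    rewrite !mxE => e; rewrite (_ : \sum_i0 _ = 0) ?scale0r // -[RHS]e.
    by apply: eq_bigr => a _; rewrite mxE.
  by apply/rowP => a; rewrite v0 mxE.
have Ctu : C^T \in unitmx by rewrite unitmx_tr.
have invE : invmx (C *m C^T) = invmx C^T *m invmx C.
  have u : C *m C^T \in unitmx by rewrite unitmx_mul Cu.
  apply: (can_inj (mulKmx u)); rewrite mulmxV //.
  by rewrite -mulmxA (mulmxA C^T) mulmxV // mul1mx mulmxV.
transitivity (\tr (invmx (C *m C^T) *m (C *m B0 *m C^T)^T)).
  rewrite /mxtrace; apply: eq_bigr => a _; rewrite mxE -HE -BE.
  by apply: eq_bigr => d _; rewrite !mxE.
rewrite invE !trmx_mul trmxK mxtrace_mulC !mulmxA mulmxK //.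
rewrite mxtrace_mulC !mulmxA mulVmx // mul1mx mxtrace_tr.
by apply: eq_bigr => i _; rewrite mxE.
Qed.

End Theory.

Section GramSchmidt.
Variables (k : nat) (b : 'rV[R]_k -> 'rV[R]_k -> R).
Hypothesis hb : inner_product b.

Definition orthonormal_upto j (e : nat -> 'rV[R]_k) :=
  forall i i', (i < j)%N -> (i' < j)%N -> b (e i) (e i') = (i == i')%:R.

Lemma orthonormal_row_free j e : orthonormal_upto j e ->
  row_free (\matrix_(i < j) e i).
Proof.
move=> on; apply/inj_row_free => v; rewrite mulmx_sum_row => v0.
apply/rowP => i; have := congr1 (fun u => b u (e i)) v0.
rewrite (ip0l hb) (ip_suml hb) (bigD1 i) //= big1 => [|i' /negPf ii'].
  by rewrite rowK (ipZl hb) on // eqxx mulr1 addr0 mxE.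
by rewrite rowK (ipZl hb) on // (_ : (_ == _) = false) ?mulr0.
Qed.

(** One step of the Gram-Schmidt process, applied to a row of the identity
    matrix that is outside the span of the family. *)
Lemma orthonormal_extend j e : (j < k)%N -> orthonormal_upto j e ->
  exists2 e', (forall i, (i < j)%N -> e' i = e i) & orthonormal_upto j.+1 e'.
Proof.
move=> jk on; have fr := orthonormal_row_free on.
pose M := \matrix_(i < j) e i.
have : ~~ (1%:M <= M)%MS.
  by rewrite sub1mx /row_full (eqP fr) neq_ltn jk.
move=> /row_subPn [i0 uM]; set u := row i0 _ in uM.
pose u' := u - \sum_(i < j) b u (e i) *: e i.
have u'0 : u' != 0.
  apply: contra uM => /eqP/subr0_eq ->; apply: summx_sub => i _.
  by rewrite scalemx_sub // -(rowK e i) row_sub.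
have u'e i : (i < j)%N -> b u' (e i) = 0.
  move=> ij; rewrite (ipBl hb) (ip_suml hb) (bigD1 (Ordinal ij)) //= big1.
    by rewrite (ipZl hb) on // eqxx mulr1 addr0 subrr.
  move=> i' ii'; rewrite (ipZl hb) on // (_ : (_ == _) = false) ?mulr0 //.
  by apply: contraNF ii' => /eqP ii'; apply/eqP/val_inj.
have b0 := ip_gt0 hb u'0.
pose w := (Num.sqrt (b u' u'))^-1 *: u'.
exists (fun i => if i == j then w else e i) => [i ij|i i'].
  by rewrite ltn_eqF.
rewrite !ltnS (leq_eqVlt i) (leq_eqVlt i').
have w1 : b w w = 1.
  rewrite /w (ipZl hb) (ipZr hb) mulrA -expr2 exprVn sqr_sqrtr ?(ltW b0) //.
  by rewrite mulVf // gt_eqF.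
have we x : (x < j)%N -> b w (e x) = 0 by move=> xj; rewrite /w (ipZl hb) u'e ?mulr0.
have [->|ij] := eqVneq i j; have [->|i'j] := eqVneq i' j => //= ij' ij''.
- by rewrite we.
- by rewrite (ipC hb) we // (negPf ij).
- exact: on.
Qed.

Lemma orthonormal_complete j e : (j <= k)%N -> orthonormal_upto j e ->
  exists2 e', (forall i, (i < j)%N -> e' i = e i) & orthonormal_upto k e'.
Proof.
move=> jk; move: {2}(k - j)%N (erefl (k - j)%N) => d.
elim: d j e jk => [|d IH] j e jk dE on.
  by exists e => //; have -> : k = j by apply/eqP; rewrite eqn_leq jk -subn_eq0 dE.
have ltjk : (j < k)%N by rewrite -subn_gt0 dE.
have [e1 e1e on1] := orthonormal_extend ltjk on.
have [|e2 e2e on2] := IH j.+1 e1 ltjk _ on1; first by rewrite subnS dE.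
by exists e2 => // i ij; rewrite e2e ?e1e // ltnS ltnW.
Qed.

Lemma orthonormal_span e v : orthonormal_upto k e ->
  v = \sum_(i < k) b v (e i) *: e i.
Proof.
move=> on; have fr := orthonormal_row_free on.
have : (v <= \matrix_(i < k) e i)%MS.
  by apply: submx_full; rewrite row_full_unit -row_free_unit.
move=> /submxP [c]; rewrite mulmx_sum_row => vE; rewrite {1}vE.
apply: eq_bigr => i _; rewrite rowK; congr (_ *: _).
rewrite {1}vE (ip_suml hb) (bigD1 i) //= big1 => [|i' /negPf ii'].
  by rewrite rowK (ipZl hb) on // eqxx mulr1 addr0.
by rewrite rowK (ipZl hb) on // (_ : (_ == _) = false) ?mulr0.
Qed.

End GramSchmidt.
End InnerProducts.

(** * Charts *)

Section Charts.
Variables (R : realType) (T : Type) (V : normedModType R) (A : atlas T V).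
Hypothesis fV : finite_dim V.

(** The consequences of [smooth_manifold] that do not mention a topology on [T];
    they make sense for the total space of a bundle, whose topology is only
    given by its atlas. *)
Definition smooth_atlas : Prop :=
  [/\ forall p, dom A p p,
      forall p q, dom A p q -> unchart A p (chart A p q) = q,
      forall p q, dom A p q ->
        \forall z \near chart A p q, chart A p (unchart A p z) = z &
      forall p p' q, dom A p q -> dom A p' q ->
        (\forall z \near chart A p q, dom A p' (unchart A p z)) /\
        smooth_at (chart A p' \o unchart A p) (chart A p q)].

Hypothesis hA : smooth_atlas.

Lemma dom_refl p : dom A p p. Proof. by case: hA. Qed.
Lemma chartK p q : dom A p q -> unchart A p (chart A p q) = q.
Proof. by case: hA => _ h _ _; exact: h. Qed.
Lemma unchartK p q : dom A p q ->
  \forall z \near chart A p q, chart A p (unchart A p z) = z.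
Proof. by case: hA => _ _ h _; exact: h. Qed.
Lemma near_dom p p' q : dom A p q -> dom A p' q ->
  \forall z \near chart A p q, dom A p' (unchart A p z).
Proof. by case: hA => _ _ _ h dp dp'; case: (h _ _ _ dp dp'). Qed.
Lemma smooth_transition p p' q : dom A p q -> dom A p' q ->
  smooth_at (chart A p' \o unchart A p) (chart A p q).
Proof. by case: hA => _ _ _ h dp dp'; case: (h _ _ _ dp dp'). Qed.

Section Functions.
Variable W : normedModType R.

Lemma smooth_chart_change (f : T -> W) p p' q : dom A p q -> dom A p' q ->
  smooth_at (f \o unchart A p) (chart A p q) ->
  smooth_at (f \o unchart A p') (chart A p' q).
Proof.
move=> dp dp' sf.
apply: (@smooth_at_eq _ _ _ ((f \o unchart A p) \o (chart A p \o unchart A p'))).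
  have := near_dom dp' dp; apply: filterS => z dz /=.
  by rewrite chartK.
apply: smooth_at_comp => //; first exact: smooth_transition.
by rewrite /= chartK.
Qed.

Lemma smooth_near_chart (f : T -> W) p q : dom A p q ->
  smooth_near A f q -> smooth_at (f \o unchart A p) (chart A p q).
Proof. by move=> dp; apply: smooth_chart_change => //; exact: dom_refl. Qed.

Lemma smooth_chart_near (f : T -> W) p q : dom A p q ->
  smooth_at (f \o unchart A p) (chart A p q) -> smooth_near A f q.
Proof. by move=> dp; apply: smooth_chart_change => //; exact: dom_refl. Qed.

Lemma smooth_near_near (f : T -> W) p :
  smooth_near A f p -> near_point A p (smooth_near A f).
Proof.
move=> sf; have dp := dom_refl p.
have nd := near_dom dp dp; have nK := unchartK dp; have ns := smooth_at_near sf.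
rewrite /near_point; near=> z.
apply: (@smooth_chart_near f p); first by near: z.
rewrite (_ : chart A p (unchart A p z) = z); by near: z.
Unshelve. all: by end_near. Qed.

Lemma near_self p P : near_point A p P -> P p.
Proof. by move=> /nbhs_singleton; rewrite chartK //; exact: dom_refl. Qed.

Lemma smooth_near_eq (f g : T -> W) p :
  near_point A p (fun q => f q = g q) -> smooth_near A f p -> smooth_near A g p.
Proof. by move=> fg; apply: smooth_at_eq. Qed.

Lemma dif_eq (f g : T -> W) p v :
  near_point A p (fun q => f q = g q) -> dif A f p v = dif A g p v.
Proof. by move=> fg; apply: near_eq_derive. Qed.

(** The chain rule for the coordinate change from the chart around [q] to the one
    around [p]. *)
Lemma dif_chart (f : T -> W) p q v : dom A p q -> smooth_near A f q ->
  dif A f q v = 'D_(coord (tangent_bundle A) p q v) (f \o unchart A p) (chart A p q).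
Proof.
move=> dp sf; have dq := dom_refl q.
rewrite /dif /=.
transitivity ('D_v ((f \o unchart A p) \o (chart A p \o unchart A q)) (chart A q q)).
  apply: near_eq_derive; have := near_dom dq dp; apply: filterS => z dz /=.
  by rewrite chartK.
have e : (chart A p \o unchart A q) (chart A q q) = chart A p q by rewrite /= chartK.
rewrite derive_comp ?e //; apply: smooth_at_diff; first exact: smooth_transition.
exact: smooth_near_chart.
Qed.

End Functions.

(** The counterpart of [smooth_atlas] for [vector_bundle]; it holds for tangent
    bundles too. *)
Definition smooth_bundle (W : normedModType R) (B : bundle T W) : Prop :=
  [/\ forall p, tdom B p p,
      forall p q p', dom A p q -> tdom B p' q ->
        \forall z \near chart A p q, tdom B p' (unchart A p z),
      forall p q, tdom B p q ->
         [/\ (forall a x y, coord B p q (a *: x + y) =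
                            a *: coord B p q x + coord B p q y),
             cancel (coord B p q) (frame B p q) &
             cancel (frame B p q) (coord B p q)] &
      forall p p' q w, tdom B p q -> tdom B p' q ->
        smooth_near A (fun q' => coord B p' q' (frame B p q' w)) q].

Lemma transition_inverse p p' q v : dom A p q -> dom A p' q ->
  'D_('D_v (chart A p' \o unchart A p) (chart A p q))
      (chart A p \o unchart A p') (chart A p' q) = v.
Proof.
move=> dp dp'.
have e : (chart A p' \o unchart A p) (chart A p q) = chart A p' q by rewrite /= chartK.
rewrite -e -derive_comp; last 2 first.
- exact/smooth_at_diff/smooth_transition.
- by rewrite e; exact/smooth_at_diff/smooth_transition.
transitivity ('D_v id (chart A p q)); last exact: derive_id.
apply: near_eq_derive.
have nK := unchartK dp; have nd := near_dom dp dp'.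
by near=> z; rewrite /= chartK //; near: z.
Unshelve. all: by end_near. Qed.

(** Vector fields are sections of the tangent bundle, so that connections on the
    base, on the bundle and on the total space fall under the same lemmas. *)
Lemma tangent_smooth_bundle : smooth_bundle (tangent_bundle A).
Proof.
split => /=.
- exact: dom_refl.
- by move=> p q p'; exact: near_dom.
- move=> p q dp; have dq := dom_refl q; split.
  + move=> a x y; have d := smooth_at_diff (smooth_transition dq dp).
    by rewrite !(deriveE _ d) linearPZ.
  + by move=> v; exact: transition_inverse.
  + by move=> v; exact: transition_inverse.
- move=> p p' q w dp dp'; have dq := dom_refl q.
  apply: (@smooth_chart_near _ _ p) => //.
  apply: (@smooth_at_eq _ _ _ ('D_w (chart A p' \o unchart A p))); last first.
    exact/smooth_at_derive/smooth_transition.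
  have n1 := near_dom dp dp'; have n2 := unchartK dp; have n3 := near_dom dp dp.
  suff key z : dom A p (unchart A p z) -> dom A p' (unchart A p z) ->
      chart A p (unchart A p z) = z ->
      'D_w (chart A p' \o unchart A p) z =
      coord (tangent_bundle A) p' (unchart A p z)
        (frame (tangent_bundle A) p (unchart A p z) w).
    by near=> z; apply: key; near: z.
  rewrite /=; set y := unchart A p z => dpy dpy' /esym zE.
  have dyy := dom_refl y.
  have e : (chart A y \o unchart A p) (chart A p y) = chart A y y by rewrite /= chartK.
  rewrite -e -derive_comp; last 2 first.
  + exact/smooth_at_diff/smooth_transition.
  + by rewrite e; exact/smooth_at_diff/smooth_transition.
  rewrite -zE; apply: near_eq_derive; rewrite zE.
  by have := near_dom dpy dyy; apply: filterS => x dx /=; rewrite chartK.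
Unshelve. all: by end_near. Qed.

End Charts.

(** * Vector bundles, connections and metrics *)

Section Bundles.
Variables (R : realType) (T : Type) (V W : normedModType R) (A : atlas T V).
Variable B : bundle T W.
Hypotheses (fV : finite_dim V) (fW : finite_dim W).
Hypotheses (hA : smooth_atlas A) (hB : smooth_bundle A B).

Lemma tdom_refl p : tdom B p p. Proof. by case: hB. Qed.

Lemma near_tdom p q p' : dom A p q -> tdom B p' q ->
  \forall z \near chart A p q, tdom B p' (unchart A p z).
Proof. by case: hB => _ h _ _; exact: h. Qed.

Lemma coordK p q : tdom B p q -> cancel (coord B p q) (frame B p q).
Proof. by case: hB => _ _ h _ /h[]. Qed.
Lemma frameK p q : tdom B p q -> cancel (frame B p q) (coord B p q).
Proof. by case: hB => _ _ h _ /h[]. Qed.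
Lemma coordP p q : tdom B p q -> linear (coord B p q).
Proof. by case: hB => _ _ h _ /h[]. Qed.
Lemma frameP p q : tdom B p q -> linear (frame B p q).
Proof.
move=> d a x y; apply: (can_inj (coordK d)).
by rewrite (coordP d) !frameK.
Qed.

Lemma linear_sum_scale (U U' : lmodType R) (f : U -> U') k (c : 'I_k -> R) u :
  linear f -> f (\sum_i c i *: u i) = \sum_i c i *: f (u i).
Proof.
move=> lf; have f0 : f 0 = 0.
  by have := lf (-1) 0 0; rewrite scaler0 addr0 scaleN1r addNr.
by elim/big_rec2: _ => [|i y1 y2 _ <-]; rewrite ?f0 ?lf.
Qed.

Lemma linear0P (U U' : lmodType R) (f : U -> U') : linear f -> f 0 = 0.
Proof. by move=> lf; have := lf (-1) 0 0; rewrite scaler0 addr0 scaleN1r addNr. Qed.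

Lemma linearDP (U U' : lmodType R) (f : U -> U') x y :
  linear f -> f (x + y) = f x + f y.
Proof. by move=> lf; rewrite -[x]scale1r lf !scale1r. Qed.

Lemma linearNP (U U' : lmodType R) (f : U -> U') x : linear f -> f (- x) = - f x.
Proof. by move=> lf; rewrite -scaleN1r -[_ *: x]addr0 lf linear0P // addr0 scaleN1r. Qed.

Lemma linearZP (U U' : lmodType R) (f : U -> U') a x :
  linear f -> f (a *: x) = a *: f x.
Proof. by move=> lf; rewrite -[a *: x]addr0 lf linear0P // addr0. Qed.

(** The two systems of coordinates differ by a matrix of smooth functions. *)
Lemma section_smooth_change (s : forall q, B q) p p' q :
  tdom B p q -> tdom B p' q ->
  smooth_near A (fun q' => coord B p q' (s q')) q ->
  smooth_near A (fun q' => coord B p' q' (s q')) q.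
Proof.
move=> dp dp' ss; have [d [b [c [lc cc bE]]]] := fW.
have dq := dom_refl hA q.
apply: (@smooth_near_eq _ _ _ A W (fun q' => \sum_i
  c i (coord B p q' (s q')) *: coord B p' q' (frame B p q' (b i)))).
  have n1 := near_tdom dq dp; have n2 := near_tdom dq dp'.
  apply: filterS2 n1 n2 => z d1 d2.
  rewrite -(linear_sum_scale _ _ (coordP d2)) -(linear_sum_scale _ _ (frameP d1)).
  by rewrite -bE coordK.
apply: smooth_at_sum => i; apply: smooth_atZ.
  apply: (@smooth_at_comp _ _ _ _ _ (c i) _ fW ss).
  exact: smooth_at_linear.
by case: hB => _ _ _; exact.
Qed.

Lemma coord_section_smooth (s : forall q, B q) p q : tdom B p q ->
  smooth_near A (fun q' => coord B p q' (s q')) q -> section_smooth_near A s q.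
Proof. by move=> dp; apply: section_smooth_change => //; exact: tdom_refl. Qed.

Lemma section_smooth_eq (s t : forall q, B q) p :
  near_point A p (fun q => s q = t q) ->
  section_smooth_near A s p -> section_smooth_near A t p.
Proof.
by move=> st; apply: smooth_near_eq; move: st; apply: filterS => z ->.
Qed.

Lemma frame_section_smooth p q w : tdom B p q ->
  section_smooth_near A (fun q' => frame B p q' w) q.
Proof. by case: hB => dr _ _ h dp; exact: h. Qed.

Lemma section_smooth0 p : section_smooth_near A (fun q => 0 : B q) p.
Proof.
apply: (@smooth_near_eq _ _ _ A W (fun=> 0)); last exact: (smooth_at_cst (0 : W)).
have := near_tdom (dom_refl hA p) (tdom_refl p); apply: filterS => z dz.
by rewrite (linear0P (coordP dz)).
Qed.

Lemma section_smoothD (s t : forall q, B q) p :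
  section_smooth_near A s p -> section_smooth_near A t p ->
  section_smooth_near A (fun q => s q + t q) p.
Proof.
move=> ss st; apply: (@smooth_near_eq _ _ _ A W
  (fun q => coord B p q (s q) + coord B p q (t q))); last exact: (smooth_atD ss st).
have := near_tdom (dom_refl hA p) (tdom_refl p); apply: filterS => z dz.
by rewrite (linearDP _ _ (coordP dz)).
Qed.

Lemma section_smoothZ (f : T -> R^o) (s : forall q, B q) p :
  smooth_near A f p -> section_smooth_near A s p ->
  section_smooth_near A (fun q => (f q : R) *: s q) p.
Proof.
move=> sf ss; apply: (@smooth_near_eq _ _ _ A W
  (fun q => (f q : R) *: coord B p q (s q))); last exact: (smooth_atZ sf ss).
have := near_tdom (dom_refl hA p) (tdom_refl p); apply: filterS => z dz.
by rewrite (linearZP _ _ (coordP dz)).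
Qed.

Lemma section_smoothB (s t : forall q, B q) p :
  section_smooth_near A s p -> section_smooth_near A t p ->
  section_smooth_near A (fun q => s q - t q) p.
Proof.
move=> ss st; apply: section_smoothD => //.
apply: (@section_smooth_eq (fun q => (-1 : R) *: t q)).
  by apply: nearW => z; rewrite scaleN1r.
by apply: (section_smoothZ (f := fun=> -1)) => //; exact: (smooth_at_cst (-1 : R^o)).
Qed.

Lemma section_smooth_sum k (f : 'I_k -> T -> R^o) (s : 'I_k -> forall q, B q) p :
  (forall i, smooth_near A (f i) p) -> (forall i, section_smooth_near A (s i) p) ->
  section_smooth_near A (fun q => \sum_i (f i q : R) *: s i q) p.
Proof.
move=> sf ss; elim: k f s sf ss => [|k IH] f s sf ss.
  apply: section_smooth_eq (section_smooth0 p).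
  by apply: nearW => z; rewrite big_ord0.
apply: (@section_smooth_eq (fun q => (f ord0 q : R) *: s ord0 q +
   \sum_i (f (lift ord0 i) q : R) *: s (lift ord0 i) q)).
  by apply: nearW => z; rewrite big_ord_recl.
by apply: section_smoothD; [exact: section_smoothZ|exact: IH].
Qed.

Section Connections.
Variable cov : forall p, V -> (forall q, B q) -> B p.
Hypothesis hc : connection A cov.

Lemma covPl p a v w s : section_smooth_near A s p ->
  cov p (a *: v + w) s = a *: cov p v s + cov p w s.
Proof. by case: hc => h _ _ _; exact: h. Qed.
Lemma covD p v s t : section_smooth_near A s p -> section_smooth_near A t p ->
  cov p v (fun q => s q + t q) = cov p v s + cov p v t.
Proof. by case: hc => _ h _ _; exact: h. Qed.
Lemma covZ p v (f : T -> R^o) s : smooth_near A f p -> section_smooth_near A s p ->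
  cov p v (fun q => (f q : R) *: s q) =
  (dif A f p v : R) *: s p + (f p : R) *: cov p v s.
Proof. by case: hc => _ _ h _; exact: h. Qed.
Lemma cov_smooth p (X : T -> V) s : vfield_smooth_near A X p ->
  section_smooth_near A s p -> section_smooth_near A (fun q => cov q (X q) s) p.
Proof. by case: hc => _ _ _ h; exact: h. Qed.

(** A section vanishing near [p] equals its product with the indicator of its
    support, a function vanishing near [p]; hence the Leibniz rule makes
    covariant derivatives local. *)
Lemma cov_near0 p v s : section_smooth_near A s p ->
  near_point A p (fun q => s q = 0) -> cov p v s = 0.
Proof.
move=> ss s0; pose f q : R^o := if `[< s q = 0 >] then 0 else 1.
have f0 : near_point A p (fun q => f q = 0).
  by move: s0; apply: filterS => z e; rewrite /f asboolT.
have sf : smooth_near A f p.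
  apply: (@smooth_near_eq _ _ _ A R^o (fun=> 0)); last exact: (smooth_at_cst (0 : R^o)).
  by move: f0; apply: filterS => z ->.
have sE : s = (fun q => (f q : R) *: s q).
  apply: functional_extensionality_dep => q; rewrite /f.
  by case: asboolP => [->|_]; rewrite ?scaler0 ?scale1r.
rewrite sE covZ // (near_self hA s0) (near_self hA f0) scaler0 scale0r.
exact: addr0.
Qed.

Lemma cov_near_eq p v s t : section_smooth_near A s p ->
  near_point A p (fun q => s q = t q) -> cov p v s = cov p v t.
Proof.
move=> ss st; have stt := section_smooth_eq st ss.
have sd := section_smoothB stt ss.
have -> : t = (fun q => s q + (t q - s q)).
  by apply: functional_extensionality_dep => q; rewrite addrC subrK.
rewrite covD // (@cov_near0 p v (fun q => t q - s q)) ?addr0 //.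
by move: st; apply: filterS => z ->; rewrite subrr.
Qed.

Lemma cov_sum k p v (f : 'I_k -> T -> R^o) (s : 'I_k -> forall q, B q) :
  (forall i, smooth_near A (f i) p) -> (forall i, section_smooth_near A (s i) p) ->
  cov p v (fun q => \sum_i (f i q : R) *: s i q) =
  \sum_i ((dif A (f i) p v : R) *: s i p + (f i p : R) *: cov p v (s i)).
Proof.
elim: k f s => [|k IH] f s sf ss.
  rewrite big_ord0; apply: cov_near0.
    apply: section_smooth_eq (section_smooth0 p).
    by apply: nearW => z; rewrite big_ord0.
  by apply: nearW => z; rewrite big_ord0.
rewrite big_ord_recl -IH // -covZ // -covD //; last 2 first.
- exact: section_smoothZ.
- exact: section_smooth_sum.
congr cov; apply: functional_extensionality_dep => q.
by rewrite big_ord_recl.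
Qed.

End Connections.

Section Metrics.
Variable h : forall p, B p -> B p -> R.
Hypothesis hh : bundle_metric A h.

Lemma metric_inner p : inner_product (@h p).
Proof. by case: hh => h1 h2 h3 _; split; [exact: h1|exact: h2|exact: h3]. Qed.

Lemma metric_smooth p (s t : forall q, B q) :
  section_smooth_near A s p -> section_smooth_near A t p ->
  smooth_near A (fun q => h (s q) (t q) : R^o) p.
Proof. by case: hh => _ _ _; exact. Qed.

End Metrics.
End Bundles.

(** * The total space and lifts of tangent vectors *)

Section Lines.
Variable R : realType.
Implicit Types V W U : normedModType R.

Lemma derive_line V W (F : V -> W) z v :
  'D_v F z = 'D_1 (fun h : R^o => F (h *: v + z)) 0.
Proof.
rewrite /derive; set g1 := fun h => h^-1 *: _; set g2 := fun h => h^-1 *: _.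
suff -> : g1 = g2 by [].
by rewrite funeqE /g1 /g2 => h /=; rewrite addr0 scale0r add0r [_%:A]mulr1.
Qed.

(** A directional derivative only depends on the restriction to a line, so that
    functions on different spaces can be compared. *)
Lemma derive_line_ext V U W (F : V -> W) (G : U -> W) z v z' v' :
  (forall h : R, F (h *: v + z) = G (h *: v' + z')) -> 'D_v F z = 'D_v' G z'.
Proof.
by move=> FG; rewrite (derive_line F) (derive_line G); congr derive; apply/funext.
Qed.

Lemma near_fst V W (z : V * W) (P : V -> Prop) :
  (\forall x \near z.1, P x) -> \forall y \near z, P y.1.
Proof. by move=> nP; apply: (@cvg_fst _ _ (nbhs z.1) (nbhs z.2)). Qed.

Lemma derive_pair V W U (f : V -> W) (g : V -> U) x v :
  differentiable f x -> differentiable g x ->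
  'D_v (fun y => (f y, g y)) x = ('D_v f x, 'D_v g x).
Proof.
move=> df dg; rewrite (deriveE _ (differentiable_pair df dg)) diff_pair //.
by rewrite (deriveE _ df) (deriveE _ dg).
Qed.

End Lines.

Section TotalSpace.
Variables (R : realType) (M : Type) (V W : normedModType R).
Variables (A : atlas M V) (B : bundle M W).
Hypotheses (fV : finite_dim V) (fW : finite_dim W).
Hypotheses (hA : smooth_atlas A) (hB : smooth_bundle A B).

Local Notation TA := (total_atlas A B).
Local Notation TB := (tangent_bundle TA).

Lemma finite_dim_total : finite_dim (V * W)%type.
Proof. exact: finite_dim_prod. Qed.

(** The axioms of a bundle only give smoothness for a fixed vector of the model
    fibre; linearity along the fibre gives it jointly. *)
Lemma total_transition_smooth (p p' : M) (q : M) (w : W) :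
  dom A p q -> tdom B p q -> tdom B p' q ->
  smooth_at (fun z : V * W => coord B p' (unchart A p z.1)
               (frame B p (unchart A p z.1) z.2)) (chart A p q, w).
Proof.
move=> dp tp tp'; have [d [b [c [lc cc bE]]]] := fW.
have n1 := near_tdom hB dp tp; have n2 := near_tdom hB dp tp'.
apply: (@smooth_at_eq _ _ _ (fun z : V * W => \sum_i c i z.2 *:
   coord B p' (unchart A p z.1) (frame B p (unchart A p z.1) (b i)))).
  have n : \forall z \near chart A p q,
      tdom B p (unchart A p z) /\ tdom B p' (unchart A p z).
    by apply: filterS2 n1 n2 => z.
  have := @near_fst R _ _ (chart A p q, w) _ n.
  apply: filterS => z [t1 t2] /=.
  rewrite -(linear_sum_scale _ _ (coordP hB t2)).
  by rewrite -(linear_sum_scale _ _ (frameP hB t1)) -bE.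
apply: smooth_at_sum => i; apply: smooth_atZ.
  apply: (@smooth_at_comp _ _ _ _ snd (c i)) => //; first exact: smooth_at_snd.
  exact: smooth_at_linear.
apply: (@smooth_at_comp _ _ _ _ fst (fun x : V =>
   coord B p' (unchart A p x) (frame B p (unchart A p x) (b i)))) => //.
  exact: smooth_at_fst.
apply: (smooth_near_chart fV hA
  (f := fun q => coord B p' q (frame B p q (b i))) dp).
by case: hB => _ _ _; exact.
Qed.

Lemma existT_frame p b b' (y : B b) : b' = b -> tdom B p b ->
  existT (fun x => B x) b' (frame B p b' (coord B p b y)) = existT _ b y.
Proof. by move=> -> t; rewrite (coordK hB t). Qed.

Lemma total_smooth_atlas : smooth_atlas TA.
Proof.
split.
- by move=> p /=; split; [exact: dom_refl|exact: (tdom_refl hB)].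
- move=> p [b y] [/= dp tp]; apply: existT_frame => //; exact: chartK.
- move=> p q [/= dp tp].
  have n : \forall z \near chart A (base p) (base q),
     chart A (base p) (unchart A (base p) z) = z /\
     tdom B (base p) (unchart A (base p) z).
    by apply: filterS2 (unchartK hA dp) (near_tdom hB dp tp) => z.
  have := @near_fst R _ _
    (chart A (base p) (base q), coord B (base p) (base q) (vec q)) _ n.
  apply: filterS => -[x y] [/= e t]; congr pair => //.
  exact: (frameK hB t).
- move=> p p' q [/= dp tp] [/= dp' tp']; split.
    have n : \forall z \near chart A (base p) (base q),
       dom A (base p') (unchart A (base p) z) /\
       tdom B (base p') (unchart A (base p) z).
      by apply: filterS2 (near_dom hA dp dp') (near_tdom hB dp tp') => z.
    exact: (@near_fst R _ _
      (chart A (base p) (base q), coord B (base p) (base q) (vec q)) _ n).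
  apply: smooth_at_pair; last exact: total_transition_smooth.
  apply: (@smooth_at_comp _ _ _ _ fst (chart A (base p') \o unchart A (base p))) => //.
    exact: smooth_at_fst.
  exact: smooth_transition.
Qed.

Lemma smooth_near_base (U : normedModType R) (f : M -> U) (p : total B) :
  smooth_near A f (base p) -> smooth_near TA (f \o @base R M W B) p.
Proof.
move=> sf.
apply: (@smooth_at_comp _ _ _ _ fst (f \o unchart A (base p))) => //.
exact: smooth_at_fst.
Qed.

Lemma dif_base (U : normedModType R) (f : M -> U) (p : total B) w :
  dif TA (f \o @base R M W B) p w = dif A f (base p) w.1.
Proof. by apply: derive_line_ext => h. Qed.

(** The vertical part of a coordinate change on the total space combines the
    coordinate change of the fibre with the derivative of the transition
    function. *)
Lemma coord_total (p q : total B) v w : dom TA p q ->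
  coord TB p q (v, w) =
  (coord (tangent_bundle A) (base p) (base q) v,
   dif A (fun b => coord B (base p) b (frame B (base q) b
                     (coord B (base q) (base q) (vec q)))) (base q) v +
   coord B (base p) (base q) (frame B (base q) (base q) w)).
Proof.
move=> [/= dp tp].
have dq := dom_refl hA (base q); have tq := tdom_refl hB (base q).
set y := coord B (base q) (base q) (vec q).
have d2 := smooth_at_diff (total_transition_smooth y dq tq tp).
have d1 : differentiable (fun z : V * W => chart A (base p) (unchart A (base q) z.1))
    (chart A (base q) (base q), y).
  apply: smooth_at_diff.
  apply: (@smooth_at_comp _ _ _ _ fst (chart A (base p) \o unchart A (base q))) => //.
    exact: smooth_at_fst.
  exact: smooth_transition.
rewrite /= [LHS](derive_pair (v, w) d1 d2); congr pair.
rewrite (deriveE _ d2) (_ : (v, w) = (v, 0) + (0, w)); last first.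
  by congr pair; rewrite /= ?addr0 ?add0r.
rewrite linearD -!(deriveE _ d2); congr (_ + _).
  apply: derive_line_ext => h /=.
  by rewrite scaler0 add0r.
pose L w := coord B (base p) (base q) (frame B (base q) (base q) w).
rewrite -/(L w).
have lL : linear L.
  by move=> a x x'; rewrite /L (frameP hB tq) (coordP hB tp).
rewrite -[RHS](derive_id (L y) (L w)); apply: derive_line_ext => h /=.
by rewrite scaler0 add0r chartK //; exact: lL.
Qed.

Lemma coord_vertical (p q : total B) (t : B (base q)) : dom TA p q ->
  coord TB p q (vertical_lift q t) = (0, coord B (base p) (base q) t).
Proof.
move=> dpq; have [/= dp tp] := dpq.
rewrite /vertical_lift [LHS](coord_total _ _ dpq); congr pair; first exact: derive0.
by rewrite /dif derive0 add0r (coordK hB (tdom_refl hB _)).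
Qed.

Lemma vertical_liftP (q : total B) : linear (vertical_lift (V := V) q).
Proof.
move=> a x y; rewrite /vertical_lift (coordP hB (tdom_refl hB _)).
by congr pair; rewrite /= scaler0 addr0.
Qed.

Lemma vertical_smooth (s : forall b, B b) (p : total B) :
  section_smooth_near A s (base p) ->
  vfield_smooth_near TA (fun q => vertical_lift q (s (base q))) p.
Proof.
move=> ss.
have sz := smooth_at_pair (smooth_at_cst (0 : V) _) (smooth_near_base ss).
apply: smooth_at_eq sz.
have := near_dom total_smooth_atlas
  (dom_refl total_smooth_atlas p) (dom_refl total_smooth_atlas p).
by apply: filterS => z dz; rewrite [RHS](coord_vertical _ dz).
Qed.

Section Lifts.
Variable cov : forall p, V -> (forall q, B q) -> B p.
Hypothesis hc : connection A cov.
Local Notation hor := (horizontal_lift (B := B) cov).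

Lemma section_smooth_frame (tau : M -> W) (x0 b : M) : tdom B x0 b ->
  smooth_near A tau b -> section_smooth_near A (fun b' => frame B x0 b' (tau b')) b.
Proof.
move=> t st; apply: (coord_section_smooth fW hA hB t).
apply: smooth_near_eq st.
have := near_tdom hB (dom_refl hA b) t; apply: filterS => z tz.
by rewrite (frameK hB tz).
Qed.

(** Expanding the section on the local frame, the Leibniz rule separates the
    derivative of the coordinates from the Christoffel term. *)
Lemma coord_cov_frame (tau : M -> W) (x0 b : M) v : tdom B x0 b ->
  smooth_near A tau b ->
  coord B x0 b (cov b v (fun b' => frame B x0 b' (tau b'))) =
  dif A tau b v + coord B x0 b (cov b v (fun b' => frame B x0 b' (tau b))).
Proof.
move=> t st; have [d [bs [c [lc cc bE]]]] := fW.
have nt := near_tdom hB (dom_refl hA b) t.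
have sc i : smooth_near A (fun b' => c i (tau b') : R^o) b.
  apply: (@smooth_at_comp _ _ _ _ (tau \o unchart A b) (c i)) => //.
  exact: smooth_at_linear.
have sf i : section_smooth_near A (fun b' => frame B x0 b' (bs i)) b.
  exact: frame_section_smooth.
have expand (sigma : M -> W) (ss : smooth_near A sigma b) :
    cov b v (fun b' => frame B x0 b' (sigma b')) =
    cov b v (fun b' => \sum_i (c i (sigma b') : R) *: frame B x0 b' (bs i)).
  apply: (cov_near_eq hA hB hc); first exact: section_smooth_frame.
  apply: filterS nt => z tz.
  by rewrite -(linear_sum_scale _ _ (frameP hB tz)) -bE.
rewrite expand // (cov_sum hA hB hc v sc sf) big_split /=.
rewrite (linearDP _ _ (coordP hB t)); congr (_ + _).
  rewrite (linear_sum_scale _ _ (coordP hB t)) [RHS]bE; apply: eq_bigr => i _.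
  rewrite (frameK hB t); congr (_ *: _).
  have dt : differentiable (tau \o unchart A b) (chart A b b) := smooth_at_diff st.
  have [d1 e1] := is_diff_linear (tau (unchart A b (chart A b b))) (lc i) (cc i).
  by rewrite /dif (derive_comp v dt d1) (deriveE _ d1) e1.
have scst (a : R^o) : smooth_near A (fun _ : M => a) b by exact: smooth_at_cst.
rewrite [in RHS](expand (fun=> tau b)); last exact: smooth_at_cst.
rewrite (cov_sum hA hB hc v (fun i => scst _) sf); congr (coord _ _ _ _).
apply: eq_bigr => i _; rewrite /dif.
by rewrite (_ : _ \o _ = cst (c i (tau b) : R^o)) // derive_cst scale0r add0r.
Qed.

(** Horizontal lifts do not depend on the trivialization used to write them. *)
Lemma coord_horizontal (p q : total B) v : dom TA p q ->
  coord TB p q (hor q v) =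
  (coord (tangent_bundle A) (base p) (base q) v,
   - coord B (base p) (base q) (cov (base q) v
       (fun b => frame B (base p) b (coord B (base p) (base q) (vec q))))).
Proof.
move=> dpq; have [/= dp tp] := dpq.
have dq := dom_refl hA (base q); have tq := tdom_refl hB (base q).
set y := coord B (base q) (base q) (vec q).
pose tau b := coord B (base p) b (frame B (base q) b y).
have st : smooth_near A tau (base q) by case: hB => _ _ _; exact.
rewrite /horizontal_lift /vertical_lift -/y.
set s := cov _ _ _.
rewrite (_ : _ - _ = (v, - coord B (base q) (base q) s)); last first.
  by congr pair; rewrite /= ?subr0 ?sub0r.
rewrite [LHS](coord_total _ _ dpq); congr pair.
rewrite -/y -/(tau) (linearNP _ (frameP hB tq)) (coordK hB tq).
rewrite (linearNP _ (coordP hB tp)).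
have -> : s = cov (base q) v (fun b => frame B (base p) b (tau b)).
  apply: (cov_near_eq hA hB hc); first exact: frame_section_smooth.
  have := near_tdom hB dq tp; apply: filterS => z tz.
  by rewrite /tau (coordK hB tz).
rewrite (coord_cov_frame v tp st) opprD addNKr.
by rewrite /tau /y (coordK hB tq).
Qed.

Lemma horizontal_liftP (q : total B) : linear (hor q).
Proof.
move=> a v w; rewrite /horizontal_lift.
set s := (fun b => frame B _ b _).
have ss : section_smooth_near A s (base q).
  by apply: frame_section_smooth => //; exact: (tdom_refl hB).
rewrite (covPl hc a v w ss) vertical_liftP scalerBr.
rewrite (_ : (a *: v + w, 0) = a *: (v, 0 : W) + (w, 0)); last first.
  by congr pair; rewrite /= scaler0 addr0.
by rewrite opprD addrACA.
Qed.

Lemma tangent_split (q : total B) (w : V * W) :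
  exists t, w = hor q w.1 + vertical_lift q t.
Proof.
have tq := tdom_refl hB (base q).
exists (frame B (base q) (base q) (w - hor q w.1).2).
rewrite /vertical_lift (frameK hB tq) -[LHS](subrK (hor q w.1)) addrC.
congr (_ + _); rewrite [LHS]surjective_pairing; congr pair.
by rewrite /= !subr0 subrr.
Qed.

(** By [coord_horizontal], the vertical coordinates form the Christoffel term,
    which is linear along the fibre with smooth coefficients on the base. *)
Lemma horizontal_smooth (X : M -> V) (p : total B) :
  vfield_smooth_near A X (base p) ->
  vfield_smooth_near TA (fun q => hor q (X (base q))) p.
Proof.
move=> sX; have [d [bs [c [lc cc bE]]]] := fW.
have dp := dom_refl total_smooth_atlas p.
have t0 := tdom_refl hB (base p).
pose Gam i (b : M) := coord B (base p) b
  (cov b (X b) (fun b' => frame B (base p) b' (bs i))).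
have sG i : smooth_near A (Gam i) (base p).
  by apply: (cov_smooth hc sX); exact: frame_section_smooth.
have sz : smooth_at (fun z : V * W => - \sum_i c i z.2 *: Gam i (unchart A (base p) z.1))
   (chart TA p p).
  apply: smooth_atN.
  apply: smooth_at_sum => i; apply: smooth_atZ.
    apply: (@smooth_at_comp _ _ _ _ snd (c i)) => //; first exact: smooth_at_snd.
    exact: smooth_at_linear.
  exact: (smooth_near_base (sG i)).
have := smooth_at_pair (smooth_near_base sX) sz.
apply: smooth_at_eq.
have n1 := near_dom total_smooth_atlas dp dp.
have n2 := unchartK total_smooth_atlas dp.
apply: filterS2 n1 n2 => z dz ez.
rewrite [RHS](coord_horizontal _ dz); congr pair; congr (- _).
have [/= dz1 tz1] := dz.
set b := unchart A (base p) z.1 in dz1 tz1 *.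
have -> : coord B (base p) b (frame B (base p) b z.2) = z.2 by exact: (frameK hB).
have scst (a : R^o) : smooth_near A (fun _ : M => a) b by exact: smooth_at_cst.
have sf i : section_smooth_near A (fun b' => frame B (base p) b' (bs i)) b.
  exact: frame_section_smooth.
have -> : cov b (X b) (fun b' => frame B (base p) b' z.2) =
   cov b (X b) (fun b' => \sum_i (c i z.2 : R) *: frame B (base p) b' (bs i)).
  apply: (cov_near_eq hA hB hc); first exact: frame_section_smooth.
  have := near_tdom hB (dom_refl hA b) tz1; apply: filterS => x tx.
  by rewrite -(linear_sum_scale _ _ (frameP hB tx)) -bE.
rewrite (cov_sum hA hB hc _ (fun i => scst _) sf).
rewrite (eq_bigr (fun i => (c i z.2 : R) *: cov b (X b) (fun b' => frame B (base p) b' (bs i)))).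
  by rewrite (linear_sum_scale _ _ (coordP hB tz1)).
move=> i _; rewrite /dif.
by rewrite (_ : _ \o _ = cst (c i z.2 : R^o)) // derive_cst scale0r add0r.
Qed.

End Lifts.
End TotalSpace.

(** * The Leibniz rule for the Sasaki connection *)

Section Differentials.
Variables (R : realType) (T : Type) (V : normedModType R) (A : atlas T V).
Implicit Types f g : T -> R^o.

Lemma difD f g p v : smooth_near A f p -> smooth_near A g p ->
  dif A (fun q => f q + g q : R^o) p v = dif A f p v + dif A g p v.
Proof.
move=> /smooth_at_diff df /smooth_at_diff dg.
rewrite /dif [LHS](@deriveD _ _ _ (f \o unchart A p) (g \o unchart A p)) //.
  exact: diff_derivable.
exact: diff_derivable.
Qed.

Lemma difB f g p v : smooth_near A f p -> smooth_near A g p ->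
  dif A (fun q => f q - g q : R^o) p v = dif A f p v - dif A g p v.
Proof.
move=> /smooth_at_diff df /smooth_at_diff dg.
rewrite /dif [LHS](@deriveB _ _ _ (f \o unchart A p) (g \o unchart A p)) //;
  exact: diff_derivable.
Qed.

Lemma difM f g p v : smooth_atlas A -> smooth_near A f p -> smooth_near A g p ->
  dif A (fun q => (f q : R) * (g q : R) : R^o) p v =
  (f p : R) * dif A g p v + (dif A f p v : R) * (g p : R).
Proof.
move=> hA /smooth_at_diff df /smooth_at_diff dg.
rewrite /dif [LHS](@deriveM _ _ (f \o unchart A p) (g \o unchart A p)) //.
- rewrite /= chartK //; last exact: dom_refl.
  by congr (_ + _); exact: mulrC.
- exact: diff_derivable.
- exact: diff_derivable.
Qed.

Lemma dif_linear (W : normedModType R) (f : T -> W) p :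
  smooth_near A f p -> linear (dif A f p).
Proof.
move=> /smooth_at_diff df a v w.
by rewrite /dif !(deriveE _ df) linearP.
Qed.

Lemma dif_cst (W : normedModType R) (c : W) p v : dif A (fun=> c) p v = 0.
Proof. exact: derive_cst. Qed.

Lemma smooth_nearM f g p : smooth_near A f p -> smooth_near A g p ->
  smooth_near A (fun q => (f q : R) * (g q : R) : R^o) p.
Proof. exact: smooth_atZ. Qed.

End Differentials.

Section Compatibility.
Variables (R : realType) (T : Type) (V W : normedModType R).
Variables (A : atlas T V) (B : bundle T W).
Hypotheses (hA : smooth_atlas A) (hB : smooth_bundle A B).
Variables (h : forall p, B p -> B p -> R).
Variable cov : forall p, V -> (forall q, B q) -> B p.
Hypotheses (hh : bundle_metric A h) (hc : connection A cov).
Variables (p : T) (w : V) (Z : forall q, B q).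
Hypothesis sZ : section_smooth_near A Z p.

(** The Leibniz rule, along the single vector [w], for the product with a fixed
    section [Z]. *)
Definition compatible_at (N : forall q, B q) : Prop :=
  dif A (fun q => h (N q) (Z q) : R^o) p w =
  h (cov p w N) (Z p) + h (N p) (cov p w Z).

Let hi q : inner_product (@h q). Proof. exact: (metric_inner hh q). Qed.

Lemma compatible_eq N N' : section_smooth_near A N p ->
  near_point A p (fun q => N q = N' q) -> compatible_at N -> compatible_at N'.
Proof.
move=> sN NN; rewrite /compatible_at (cov_near_eq hA hB hc w sN NN).
rewrite (near_self hA NN) => <-; apply: dif_eq.
by move: NN; apply: filterS => z ->.
Qed.

Lemma compatible0 : compatible_at (fun=> 0).
Proof.
rewrite /compatible_at (cov_near0 hA hc); last 2 first.
- exact: (section_smooth0 hA hB).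
- exact: nearW.
rewrite !(ip0l (hi _)) addr0 -[RHS](dif_cst A (0 : R^o) p w).
by apply: dif_eq; apply: nearW => z; rewrite (ip0l (hi _)).
Qed.

Lemma compatibleD N N' : section_smooth_near A N p -> section_smooth_near A N' p ->
  compatible_at N -> compatible_at N' -> compatible_at (fun q => N q + N' q).
Proof.
move=> sN sN' cN cN'; rewrite /compatible_at (covD hc) //.
rewrite !(ipDl (hi _)) addrACA -cN -cN' -difD; last 2 first.
- exact: (metric_smooth hh sN sZ).
- exact: (metric_smooth hh sN' sZ).
by apply: dif_eq; apply: nearW => z; rewrite (ipDl (hi _)).
Qed.

Lemma compatibleZ (f : T -> R^o) N : smooth_near A f p ->
  section_smooth_near A N p -> compatible_at N ->
  compatible_at (fun q => (f q : R) *: N q).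
Proof.
move=> sf sN cN; rewrite /compatible_at (covZ hc) //.
rewrite (ipDl (hi _)) !(ipZl (hi _)) -addrA -mulrDr -cN addrC.
rewrite -(difM w hA sf (metric_smooth hh sN sZ)).
by apply: dif_eq; apply: nearW => z; rewrite (ipZl (hi _)).
Qed.

Lemma compatible_sum k (f : 'I_k -> T -> R^o) (N : 'I_k -> forall q, B q) :
  (forall i, smooth_near A (f i) p) ->
  (forall i, section_smooth_near A (N i) p) ->
  (forall i, compatible_at (N i)) ->
  compatible_at (fun q => \sum_i (f i q : R) *: N i q).
Proof.
elim: k f N => [|k IH] f N sf sN cN.
  apply: compatible_eq compatible0; first exact: (section_smooth0 hA hB).
  by apply: nearW => z; rewrite big_ord0.
apply: (@compatible_eq (fun q => (f ord0 q : R) *: N ord0 q +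
   \sum_i (f (lift ord0 i) q : R) *: N (lift ord0 i) q)).
- apply: (section_smoothD hA hB); first exact: (section_smoothZ hA hB).
  exact: (section_smooth_sum hA hB).
- by apply: nearW => z; rewrite big_ord_recl.
- apply: compatibleD; last exact: IH.
  + exact: (section_smoothZ hA hB).
  + exact: (section_smooth_sum hA hB).
  + exact: compatibleZ.
Qed.

(** Both sides of the Leibniz rule are additive in [N] and vary in the same way
    when [N] is multiplied by a function, so it is enough to check the rule on
    local frames. *)
Lemma compatible_frame k (f : 'I_k -> T -> R^o) (E : 'I_k -> forall q, B q) N :
  (forall i, smooth_near A (f i) p) ->
  (forall i, section_smooth_near A (E i) p) ->
  (forall i, compatible_at (E i)) ->
  near_point A p (fun q => N q = \sum_i (f i q : R) *: E i q) ->
  compatible_at N.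
Proof.
move=> sf sE cE NE; apply: compatible_eq (compatible_sum sf sE cE).
  exact: (section_smooth_sum hA hB).
by move: NE; apply: filterS => z ->.
Qed.

End Compatibility.

Section Sasaki.
Variables (R : realType) (M : Type) (V W : normedModType R).
Variables (A : atlas M V) (B : bundle M W).
Hypotheses (fV : finite_dim V) (fW : finite_dim W).
Hypotheses (hA : smooth_atlas A) (hB : smooth_bundle A B).
Variables (g : M -> V -> V -> R) (nabla : M -> V -> (M -> V) -> V).
Hypothesis hng : metric_compatible (B := tangent_bundle A) A g nabla.
Variables (h : forall p, B p -> B p -> R).
Variable cov : forall p, V -> (forall q, B q) -> B p.
Hypotheses (hh : bundle_metric A h) (hc : connection A cov).
Hypothesis hch : metric_compatible A h cov.
Variables (G : total B -> V * W -> V * W -> R)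
  (D : total B -> V * W -> (total B -> V * W) -> V * W).
Hypotheses (hG : Sasaki_metric A cov g h G) (hD : Sasaki_connection A cov nabla D).

Local Notation TA := (total_atlas A B).
Local Notation hor := (horizontal_lift (B := B) cov).
Local Notation ver := (vertical_lift (V := V) (B := B)).

Let fT := finite_dim_total fV fW.
Let hTA := total_smooth_atlas fV fW hA hB.
Let hTB := tangent_smooth_bundle fT hTA.

Let GM : bundle_metric (B := tangent_bundle TA) TA G. Proof. by case: hG. Qed.
Let Gi p : inner_product (U := tangent_bundle TA p) (G p).
Proof. exact: (metric_inner GM p). Qed.
Let Dc : connection (B := tangent_bundle TA) TA D. Proof. by case: hD. Qed.

Lemma G_hor q v w : G q (hor q v) (hor q w) = g (base q) v w.
Proof. by case: hG => _ /(_ q)[]. Qed.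
Lemma G_ver q s t : G q (ver q s) (ver q t) = h s t.
Proof. by case: hG => _ /(_ q)[]. Qed.
Lemma G_hor_ver q v t : G q (hor q v) (ver q t) = 0.
Proof. by case: hG => _ /(_ q)[]. Qed.
Lemma G_ver_hor q v t : G q (ver q t) (hor q v) = 0.
Proof. by rewrite (ipC (Gi q)) G_hor_ver. Qed.

Lemma hor1 q v : (hor q v).1 = v.
Proof. by rewrite /horizontal_lift /= subr0. Qed.


Local Notation TB := (tangent_bundle TA).
Local Notation compat p w Z N :=
  (compatible_at (B := TB) TA G D p w Z N).

(** The first coordinates of [N] are its coefficients on horizontal lifts of a
    frame of the base; what remains is vertical, and a combination of vertical
    lifts of a frame of the bundle. *)
Lemma compatible_lifts p w (Z N : forall q, TB q) :
  section_smooth_near (B := TB) TA Z p -> section_smooth_near (B := TB) TA N p ->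
  (forall X, vfield_smooth_near A X (base p) ->
     compat p w Z (fun q => hor q (X (base q)))) ->
  (forall s, section_smooth_near A s (base p) ->
     compat p w Z (fun q => ver q (s (base q)))) ->
  compat p w Z N.
Proof.
move=> sZ sN cH cV.
have [d [b [c [lc cc bE]]]] := fV; have [d' [b' [c' [lc' cc' bE']]]] := fW.
have hTM := tangent_smooth_bundle fV hA.
have dp := dom_refl hTA p.
pose X i (x : M) : V := frame (tangent_bundle A) (base p) x (b i).
have sX i : vfield_smooth_near A (X i) (base p).
  exact: (frame_section_smooth hTM (b i) (tdom_refl hTM (base p))).
pose HX i : forall q, TB q := fun q => hor q (X i (base q)).
have sHX i : section_smooth_near (B := TB) TA (HX i) p.
  exact: (horizontal_smooth fV fW hA hB hc (sX i)).
pose a i (q : total B) : R^o := c i (coord TB p q (N q)).1.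
have sa i : smooth_near TA (a i) p.
  apply: (@smooth_at_comp _ _ _ _ (fun z => coord TB p (unchart TA p z) (N (unchart TA p z)))
    (fun y : V * W => c i y.1)) => //.
  apply: (@smooth_at_comp _ _ _ _ fst (c i)) => //; first exact: smooth_at_fst.
  exact: smooth_at_linear.
pose N0 : forall q, TB q := fun q => \sum_i (a i q : R) *: HX i q.
have sN0 : section_smooth_near (B := TB) TA N0 p.
  exact: (section_smooth_sum hTA hTB).
pose N1 : forall q, TB q := fun q => N q - N0 q.
have sN1 : section_smooth_near (B := TB) TA N1 p by exact: (section_smoothB hTA hTB).
have cN0 : compat p w Z N0.
  by apply: (compatible_sum hTA hTB GM Dc sZ) => // i; exact: cH.
pose e j (x : M) := frame B (base p) x (b' j).
have se j : section_smooth_near A (e j) (base p).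
  exact: (frame_section_smooth hB (b' j) (tdom_refl hB (base p))).
pose Ue j : forall q, TB q := fun q => ver q (e j (base q)).
have sUe j : section_smooth_near (B := TB) TA (Ue j) p.
  exact: (vertical_smooth fV fW hA hB (se j)).
pose r j (q : total B) : R^o := c' j (coord TB p q (N1 q)).2.
have sr j : smooth_near TA (r j) p.
  apply: (@smooth_at_comp _ _ _ _ (fun z => coord TB p (unchart TA p z) (N1 (unchart TA p z)))
    (fun y : V * W => c' j y.2)) => //.
  apply: (@smooth_at_comp _ _ _ _ snd (c' j)) => //; first exact: smooth_at_snd.
  exact: smooth_at_linear.
have cN1 : compat p w Z N1.
  apply: (compatible_frame hTA hTB GM Dc sZ sr sUe (fun j => cV _ (se j))).
  have := near_dom hTA dp dp; apply: filterS => z dz.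
  set q := unchart TA p z in dz *; have [/= dq tq] := dz.
  apply: (can_inj (coordK hTB dz)).
  rewrite (linear_sum_scale _ _ (coordP hTB dz)).
  have N0E : coord TB p q (N0 q) = \sum_i (a i q : R) *: coord TB p q (HX i q).
    exact: (linear_sum_scale _ _ (coordP hTB dz)).
  have HXE i : (coord TB p q (HX i q)).1 = b i.
    by rewrite [coord _ _ _ _](coord_horizontal fV fW hA hB hc _ dz) [LHS](frameK hTM dq).
  have UeE j : coord TB p q (Ue j q) = (0, b' j).
    rewrite [LHS](coord_vertical fV fW hA hB _ dz); congr pair.
    exact: (frameK hB tq).
  have lfst : linear (fst : V * W -> V) by [].
  have lz : linear (fun y : W => (0, y) : V * W).
    by move=> k y y'; congr pair; rewrite /= scaler0 addr0.
  have N1E : (coord TB p q (N1 q)).1 = 0.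
    rewrite [coord _ _ _ _](linearDP _ _ (coordP hTB dz)).
    rewrite (linearNP _ (coordP hTB dz)) N0E [LHS](linearDP _ _ lfst).
    rewrite (linearNP _ lfst) (linear_sum_scale _ _ lfst).
    rewrite (eq_bigr (fun i => c i (coord TB p q (N q)).1 *: b i)).
      by rewrite -bE subrr.
    by move=> i _; rewrite HXE.
  transitivity ((0, (coord TB p q (N1 q)).2) : V * W).
    by rewrite [LHS]surjective_pairing N1E.
  rewrite [in LHS](bE' (coord TB p q (N1 q)).2) [LHS](linear_sum_scale _ _ lz).
  by apply: eq_bigr => j _; rewrite -UeE.
have -> : N = (fun q => N0 q + N1 q).
  by apply: functional_extensionality_dep => q; rewrite addrC subrK.
exact: (compatibleD GM Dc sZ sN0 sN1 cN0 cN1).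
Qed.

(** The product of two horizontal lifts comes from the base, where [nabla] is
    metric; the product of a horizontal and a vertical lift is zero. *)
Lemma compatible_horizontal p X N : vfield_smooth_near A X (base p) ->
  vfield_smooth_near TA N p ->
  compat p (hor p (X (base p))) (fun q => hor q (X (base q))) N.
Proof.
move=> sX sN.
have s0 : section_smooth_near A (fun q => 0 : B q) (base p).
  exact: (section_smooth0 hA hB).
apply: (compatible_lifts (horizontal_smooth fV fW hA hB hc sX) sN).
- move=> Y sY; rewrite /compatible_at.
  have [_ /(_ p X Y _ _ sX sY s0 s0) [DY _ _ _]] := hD.
  have [_ /(_ p X X _ _ sX sX s0 s0) [DX _ _ _]] := hD.
  rewrite DY DX !G_hor -(hng (X (base p)) sY sX).
  have e : (fun q => G q (hor q (Y (base q))) (hor q (X (base q))) : R^o) =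
           (fun b => g b (Y b) (X b) : R^o) \o @base R M W B.
    by apply/funext => q; exact: G_hor.
  by rewrite [LHS](congr1 (fun f => dif TA f p _) e) dif_base hor1.
- move=> s ss; rewrite /compatible_at.
  have [_ /(_ p X X _ _ sX sX ss s0) [DX Ds _ _]] := hD.
  have e : (fun q => G q (ver q (s (base q))) (hor q (X (base q))) : R^o) = fun=> 0.
    by apply/funext => q; exact: G_ver_hor.
  rewrite DX Ds !G_ver_hor addr0 [LHS](congr1 (fun f => dif TA f p _) e).
  exact: dif_cst.
Qed.

(** Vertical derivatives of lifts vanish, as do those of functions that come from
    the base. *)
Lemma compatible_vertical p s N : section_smooth_near A s (base p) ->
  vfield_smooth_near TA N p ->
  compat p (ver p (s (base p))) (fun q => ver q (s (base q))) N.
Proof.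
move=> ss sN.
have hTM := tangent_smooth_bundle fV hA.
have s0 : vfield_smooth_near A (fun=> 0) (base p).
  exact: (section_smooth0 hA hTM).
apply: (compatible_lifts (vertical_smooth fV fW hA hB ss) sN).
- move=> Y sY; rewrite /compatible_at.
  have [_ /(_ p _ Y _ _ s0 sY ss ss) [_ _ DY Ds]] := hD.
  have e : (fun q => G q (hor q (Y (base q))) (ver q (s (base q))) : R^o) = fun=> 0.
    by apply/funext => q; exact: G_hor_ver.
  rewrite DY Ds (ip0l (Gi p)) (ip0r (Gi p)) addr0.
  by rewrite [LHS](congr1 (fun f => dif TA f p _) e); exact: dif_cst.
- move=> t st; rewrite /compatible_at.
  have [_ /(_ p _ _ _ _ s0 s0 ss st) [_ _ _ Dt]] := hD.
  have [_ /(_ p _ _ _ _ s0 s0 ss ss) [_ _ _ Ds]] := hD.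
  rewrite Dt Ds (ip0l (Gi p)) (ip0r (Gi p)) addr0.
  have e : (fun q => G q (ver q (t (base q))) (ver q (s (base q))) : R^o) =
           (fun b => h (t b) (s b) : R^o) \o @base R M W B.
    by apply/funext => q; exact: G_ver.
  by rewrite [LHS](congr1 (fun f => dif TA f p _) e) dif_base; exact: derive0.
Qed.

(** The derivative of the horizontal lift of [X] along itself is horizontal,
    hence orthogonal to [N]. *)
Lemma weingarten_horizontal p X N : vfield_smooth_near A X (base p) ->
  vfield_smooth_near TA N p -> (forall v, G p (N p) (hor p v) = 0) ->
  G p (D p (hor p (X (base p))) N) (hor p (X (base p))) =
  dif TA (fun q => G q (N q) (hor q (X (base q))) : R^o) p (hor p (X (base p))).
Proof.
move=> sX sN Nh; rewrite [RHS](compatible_horizontal sX sN).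
have s0 : section_smooth_near A (fun q => 0 : B q) (base p).
  exact: (section_smooth0 hA hB).
have [_ /(_ p X X _ _ sX sX s0 s0) [DX _ _ _]] := hD.
by rewrite DX Nh addr0.
Qed.

(** The derivative of a vertical lift along a vertical vector is zero. *)
Lemma weingarten_vertical p s N : section_smooth_near A s (base p) ->
  vfield_smooth_near TA N p ->
  G p (D p (ver p (s (base p))) N) (ver p (s (base p))) =
  dif TA (fun q => G q (N q) (ver q (s (base q))) : R^o) p (ver p (s (base p))).
Proof.
move=> ss sN; rewrite [RHS](compatible_vertical ss sN).
have hTM := tangent_smooth_bundle fV hA.
have s0 : vfield_smooth_near A (fun=> 0) (base p).
  exact: (section_smooth0 hA hTM).
have [_ /(_ p _ _ _ _ s0 s0 ss ss) [_ _ _ Ds]] := hD.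
by rewrite Ds (ip0r (Gi p)) addr0.
Qed.

End Sasaki.

(** * The logarithm of the norm and radial graphs *)

Lemma is_derive_quadratic (R : realType) (a b c : R) :
  is_derive (0 : R^o) 1 (fun k : R^o => a + k * b + k * k * c : R^o) b.
Proof.
pose p : {poly R} := a%:P + b *: 'X + c *: 'X^2.
have pE (k : R) : p.[k] = a + k * b + k * k * c.
  by rewrite /p !(hornerD, hornerZ, hornerX, hornerXn, hornerC); ring.
have -> : (fun k : R^o => a + k * b + k * k * c : R^o) = horner p.
  by apply/funext => k; exact/esym/pE.
apply: is_derive_eq (is_derive_poly p (0 : R)) _.
by rewrite /p !derivD derivC !derivZ derivX derivXn
  !(hornerD, hornerZ, hornerX, hornerXn, hornerC, hornerMn) expr1; ring.
Qed.

Lemma derive1_quadratic (R : realType) (a b c : R) :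
  'D_1 (fun k : R^o => a + k * b + k * k * c : R^o) 0 = b.
Proof. by have /@derive_val := is_derive_quadratic a b c. Qed.

Lemma derive_ln (R : realType) (x t : R^o) : 0 < x ->
  'D_t (@ln R : R^o -> R^o) x = t / x :> R.
Proof.
move=> x0; have d : differentiable (@ln R : R^o -> R^o) x.
  exact: smooth_at_diff (smooth_at_ln x0).
rewrite (deriveE _ d) -{1}[t]mulr1 -[t * 1]/(t *: (1 : R^o)) linearZ /=.
by rewrite -(deriveE _ d); have := is_derive1_ln x0 => /@derive_val ->.
Qed.

Section RadialFunctions.
Variables (R : realType) (M : Type) (V W : normedModType R).
Variables (A : atlas M V) (B : bundle M W).
Hypotheses (fV : finite_dim V) (fW : finite_dim W).
Hypotheses (hA : smooth_atlas A) (hB : smooth_bundle A B).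
Variables (h : forall p, B p -> B p -> R).
Hypothesis hh : bundle_metric A h.

Local Notation TA := (total_atlas A B).
Local Notation TB := (tangent_bundle TA).
Local Notation ver := (vertical_lift (V := V) (B := B)).

Let fT := finite_dim_total fV fW.
Let hTA := total_smooth_atlas fV fW hA hB.
Let hi q : inner_product (@h q). Proof. exact: (metric_inner hh q). Qed.

Definition sqnorm (xi : total B) : R := h (vec xi) (vec xi).

Lemma sqnorm_gt0 xi : punctured xi -> 0 < sqnorm xi.
Proof. exact: (ip_gt0 (hi _)). Qed.

Lemma gt0_punctured xi : 0 < sqnorm xi -> punctured xi.
Proof.
by move=> x0; apply: contraTN x0 => /eqP e; rewrite /sqnorm e (ip0l (hi _)) ltxx.
Qed.

Lemma sqnorm_smooth p : smooth_near TA (sqnorm : _ -> R^o) p.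
Proof.
have [d [b [c [lc cc bE]]]] := fW.
have t0 := tdom_refl hB (base p).
pose e i (x : M) := frame B (base p) x (b i).
have sh i j : smooth_near TA ((fun x => h (e i x) (e j x) : R^o) \o @base R M W B) p.
  apply: (smooth_near_base (A := A) fV).
  by apply: (metric_smooth hh); exact: frame_section_smooth.
have sc i : smooth_at (fun z : V * W => c i z.2) (chart TA p p).
  apply: (@smooth_at_comp _ _ _ _ snd (c i)) => //; first exact: smooth_at_snd.
  exact: smooth_at_linear.
have := smooth_at_sum (fun i => smooth_at_sum (fun j =>
  smooth_atZ (smooth_atZ (sc i) (sc j)) (sh i j))).
apply: smooth_at_eq.
have := near_dom hTA (dom_refl hTA p) (dom_refl hTA p).
apply: filterS => z [/= _ tz].
set x := unchart A (base p) z.1 in tz *.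
rewrite /sqnorm /= [in RHS](bE z.2) (linear_sum_scale _ _ (frameP hB tz)).
rewrite (ip_suml (hi _)); apply: eq_bigr => i _.
rewrite (ip_sumr (hi _)); apply: eq_bigr => j _.
by rewrite (ipZl (hi _)) (ipZr (hi _)) mulrA.
Qed.

Lemma unchart_vertical q (t : B (base q)) (k : R) :
  unchart TA q (k *: ver q t + chart TA q q) =
  existT (fun x => B x) (base q) (k *: t + vec q).
Proof.
have t0 := tdom_refl hB (base q).
rewrite -(@existT_frame _ _ _ _ _ _ hB (base q) (base q)
  (unchart A (base q) (k *: 0 + chart A (base q) (base q)))) //.
  by rewrite (coordP hB t0).
by rewrite scaler0 add0r chartK //; exact: dom_refl.
Qed.

(** Vertical vectors are velocities of straight lines of the fibre. *)
Lemma dif_vertical (U : normedModType R) (F : total B -> U) q (t : B (base q)) :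
  dif TA F q (ver q t) =
  'D_1 (fun k : R^o => F (existT (fun x => B x) (base q) (k *: t + vec q))) 0.
Proof.
rewrite /dif derive_line; congr derive; apply/funext => k.
by rewrite /= -[in RHS](@unchart_vertical q t k).
Qed.

Lemma dif_sqnorm_vertical q t : dif TA (sqnorm : _ -> R^o) q (ver q t) = 2 * h t (vec q).
Proof.
rewrite dif_vertical -(derive1_quadratic (sqnorm q) (2 * h t (vec q)) (h t t)).
congr derive; apply/funext => k; rewrite /sqnorm /=.
rewrite !(ipDl (hi _)) !(ipDr (hi _)) !(ipZl (hi _)) !(ipZr (hi _)).
rewrite (ipC (hi _) (vec q) t); ring.
Qed.

Section Horizontal.
Variable cov : forall p, V -> (forall q, B q) -> B p.
Hypotheses (hc : connection A cov) (hch : metric_compatible A h cov).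
Local Notation hor := (horizontal_lift (B := B) cov).

(** Along the section [s] with constant coordinates through [vec q], the squared
    norm varies by [2 * h (cov v s) s], because [cov] is metric; the vertical part
    of the horizontal lift compensates this. *)
Lemma dif_sqnorm_horizontal q v : dif TA (sqnorm : _ -> R^o) q (hor q v) = 0.
Proof.
have t0 := tdom_refl hB (base q).
set y := coord B (base q) (base q) (vec q).
pose s b := frame B (base q) b y.
have ss : section_smooth_near A s (base q) by exact: frame_section_smooth.
have sq : s (base q) = vec q by exact: (coordK hB).
have lin := dif_linear (sqnorm_smooth q).
rewrite /horizontal_lift (linearDP _ _ lin) (linearNP _ lin).
rewrite dif_sqnorm_vertical -/s.
have -> : dif TA (sqnorm : _ -> R^o) q (v, 0) =
          dif A (fun b => h (s b) (s b) : R^o) (base q) v.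
  apply: derive_line_ext => k.
  by rewrite /sqnorm /= scaler0 add0r.
rewrite (hch v ss ss) sq (ipC (hi _) (vec q)); ring.
Qed.
End Horizontal.

Definition log_norm (xi : total B) : R := 2^-1 * ln (sqnorm xi).

Lemma near_punctured p : punctured p -> near_point TA p punctured.
Proof.
move=> pp.
have c := smooth_at_cont (sqnorm_smooth p).
have : nbhs ((sqnorm : _ -> R^o) (unchart TA p (chart TA p p))) [set x : R^o | 0 < x].
  rewrite (chartK hTA (dom_refl hTA p)).
  by apply: open_nbhs_nbhs; split; [exact: open_gt|exact: sqnorm_gt0].
move=> /c n; have {}n : \forall z \near chart TA p p, 0 < sqnorm (unchart TA p z) := n.
by apply: filterS n => z; exact: gt0_punctured.
Qed.

Lemma log_norm_smooth p : punctured p -> smooth_near TA (log_norm : _ -> R^o) p.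
Proof.
move=> pp.
suff sl : smooth_at ((@ln R : R^o -> R^o) \o ((sqnorm : _ -> R^o) \o unchart TA p))
    (chart TA p p).
  exact: (smooth_atZ (smooth_at_cst (2^-1 : R^o) _) sl).
apply: (@smooth_at_comp _ _ _ _ ((sqnorm : _ -> R^o) \o unchart TA p) (@ln R : R^o -> R^o)).
- exact: finite_dim_R.
- exact: sqnorm_smooth.
- apply: smooth_at_ln; suff: 0 < sqnorm (unchart TA p (chart TA p p)) by [].
  by rewrite (chartK hTA (dom_refl hTA p)); exact: sqnorm_gt0.
Qed.

Lemma dif_log_norm q w : punctured q ->
  dif TA (log_norm : _ -> R^o) q w =
  2^-1 * (dif TA (sqnorm : _ -> R^o) q w / sqnorm q).
Proof.
move=> pq; have q0 := sqnorm_gt0 pq.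
have e : sqnorm (unchart TA q (chart TA q q)) = sqnorm q.
  by rewrite (chartK hTA (dom_refl hTA q)).
have dln : differentiable (@ln R : R^o -> R^o) (sqnorm (unchart TA q (chart TA q q))).
  by rewrite e; apply: smooth_at_diff; exact: smooth_at_ln.
have ds := smooth_at_diff (sqnorm_smooth q).
rewrite /dif (_ : _ \o _ = 2^-1 *:
  ((@ln R : R^o -> R^o) \o ((sqnorm : _ -> R^o) \o unchart TA q))) //.
rewrite deriveZ; last first.
  by apply: diff_derivable; exact: differentiable_comp ds dln.
rewrite (derive_comp w ds dln); congr (_ * _).
set t := 'D_w _ _.
rewrite -[((sqnorm : _ -> R^o) \o unchart TA q) _]/(sqnorm (unchart TA q
  (chart TA q q))) e in dln *.
exact: derive_ln.
Qed.

Lemma dif_log_norm_vertical q t : punctured q ->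
  dif TA (log_norm : _ -> R^o) q (ver q t) = h t (vec q) / sqnorm q.
Proof.
move=> pq; have q0 := sqnorm_gt0 pq; rewrite dif_log_norm // dif_sqnorm_vertical.
by field; rewrite gt_eqF.
Qed.

Lemma expR_log_norm xi : punctured xi -> expR (log_norm xi) ^+ 2 = sqnorm xi.
Proof.
move=> /sqnorm_gt0 x0; rewrite -expRM_natl /log_norm.
by rewrite (_ : _ * _ = ln (sqnorm xi)) ?lnK //; field.
Qed.

Lemma bnormE xi : punctured xi -> bnorm h xi = expR (log_norm xi).
Proof.
by move=> px; rewrite /bnorm -/(sqnorm xi) -expR_log_norm // sqrtr_sqr gtr0_norm ?expR_gt0.
Qed.

Lemma sqnorm_bscale c (xi : total B) : sqnorm (bscale c xi) = c ^+ 2 * sqnorm xi.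
Proof. by rewrite /sqnorm /= (ipZl (hi _)) (ipZr (hi _)) mulrA -expr2. Qed.

Lemma punctured_bscale c (xi : total B) : 0 < c -> punctured xi -> punctured (bscale c xi).
Proof.
move=> c0 px; apply: gt0_punctured; rewrite sqnorm_bscale mulr_gt0 ?exprn_gt0 //.
exact: sqnorm_gt0.
Qed.

Lemma log_norm_bscale c (xi : total B) : 0 < c -> punctured xi ->
  log_norm (bscale c xi) = ln c + log_norm xi.
Proof.
move=> c0 /sqnorm_gt0 x0; rewrite /log_norm sqnorm_bscale lnM ?posrE ?exprn_gt0 //.
by rewrite lnXn // mulrDr -mulr_natl; field.
Qed.

Lemma bscale_bscale c d (xi : total B) : bscale c (bscale d xi) = bscale (c * d) xi.
Proof. by rewrite /bscale /= scalerA. Qed.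

Lemma bscale1 (xi : total B) : bscale 1 xi = xi.
Proof. by case: xi => b y; rewrite /bscale /= scale1r. Qed.

Lemma unit_sqnorm xi : unit_sphere_bundle h xi <-> sqnorm xi = 1.
Proof.
rewrite /unit_sphere_bundle /bnorm /= -/(sqnorm xi); split=> [e|->]; last exact: sqrtr1.
by rewrite -[LHS]sqr_sqrtr ?e ?expr1n //; exact: (ip_ge0 (hi _)).
Qed.

Lemma unit_punctured (xi : total B) : unit_sphere_bundle h xi -> punctured xi.
Proof. by move=> /unit_sqnorm e; apply: gt0_punctured; rewrite e. Qed.

Lemma log_norm_unit xi : unit_sphere_bundle h xi -> log_norm xi = 0.
Proof. by move=> /unit_sqnorm e; rewrite /log_norm e ln1 mulr0. Qed.

Definition normalize (xi : total B) := bscale (expR (- log_norm xi)) xi.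

Lemma normalize_unit (xi : total B) : punctured xi -> unit_sphere_bundle h (normalize xi).
Proof.
move=> px; apply/unit_sqnorm.
by rewrite sqnorm_bscale -expR_log_norm // -exprMn -expRD addNr expR0 expr1n.
Qed.

Lemma normalize_bscale c (xi : total B) : 0 < c -> punctured xi ->
  normalize (bscale c xi) = normalize xi.
Proof.
move=> c0 px; rewrite /normalize log_norm_bscale // bscale_bscale; congr bscale.
by rewrite opprD expRD (expRN (ln c)) lnK ?posrE // mulrAC mulVf ?mul1r // gt_eqF.
Qed.

Lemma normalize_id xi : unit_sphere_bundle h xi -> normalize xi = xi.
Proof. by move=> ux; rewrite /normalize log_norm_unit // oppr0 expR0 bscale1. Qed.

Section Graph.
Variable u : total B -> R.

(** Constant along rays, so that its extrema on the punctured total space are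
    those of [u] on the unit sphere bundle. *)
Definition radial_ext (xi : total B) : R := u (normalize xi).

Lemma radial_ext_bscale c (xi : total B) : 0 < c -> punctured xi ->
  radial_ext (bscale c xi) = radial_ext xi.
Proof. by move=> c0 px; rewrite /radial_ext normalize_bscale. Qed.

(** Presents the graph as a level set in the punctured total space. *)
Lemma radial_graphP p :
  radial_graph h u p <-> punctured p /\ log_norm p = radial_ext p.
Proof.
split=> [[xi ux <-]|[pp e]].
  have px := unit_punctured ux.
  split; first by apply: punctured_bscale => //; exact: expR_gt0.
  rewrite radial_ext_bscale ?expR_gt0 // log_norm_bscale ?expR_gt0 //.
  by rewrite expRK log_norm_unit // addr0 /radial_ext normalize_id.
exists (normalize p); first exact: normalize_unit.
by rewrite -/(radial_ext p) -e bscale_bscale -expRD subrr expR0 bscale1.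
Qed.

(** The retraction of a neighbourhood of the graph onto the graph along the
    rays. *)
Definition retract (xi : total B) :=
  bscale (expR (radial_ext xi - log_norm xi)) xi.

Lemma retract_graph xi : punctured xi -> radial_graph h u (retract xi).
Proof.
move=> px; apply/radial_graphP; split.
  by apply: punctured_bscale => //; exact: expR_gt0.
by rewrite radial_ext_bscale ?expR_gt0 // log_norm_bscale ?expR_gt0 // expRK subrK.
Qed.

Lemma chart_bscale p q c : tdom B (base p) (base q) ->
  chart TA p (bscale c q) = ((chart TA p q).1, c *: (chart TA p q).2).
Proof. by move=> t; congr pair; exact: (linearZP _ _ (coordP hB t)). Qed.

Lemma bscale_unchart p z c : tdom B (base p) (unchart A (base p) z.1) ->
  bscale c (unchart TA p z) = unchart TA p (z.1, c *: z.2).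
Proof.
move=> t; rewrite /bscale /=; congr existT.
by rewrite (linearZP _ _ (frameP hB t)).
Qed.

Lemma near_total_tdom p : \forall z \near chart TA p p,
  tdom B (base p) (unchart A (base p) z.1).
Proof.
by have := near_dom hTA (dom_refl hTA p) (dom_refl hTA p); apply: filterS => z [].
Qed.

(** Gives the smoothness of [normalize] and [retract], which multiply vectors by
    the exponential of a smooth function. *)
Lemma scaling_smooth (f : total B -> R^o) p : smooth_near TA f p ->
  smooth_at (fun z : V * W => (z.1, (expR (f (unchart TA p z)) : R^o) *: z.2))
    (chart TA p p).
Proof.
move=> sf; apply: smooth_at_pair; first exact: smooth_at_fst.
apply: smooth_atZ; last exact: smooth_at_snd.
apply: (@smooth_at_comp _ _ _ _ (f \o unchart TA p) (expR : R^o -> R^o)) => //.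
  exact: finite_dim_R.
exact: smooth_at_expR.
Qed.

Hypothesis su : smooth_on_subset TA (unit_sphere_bundle h) u.

(** Near a point, [radial_ext] is the composite of the normalization with a
    local smooth extension of [u]. *)
Lemma radial_ext_smooth p : punctured p ->
  smooth_near TA (radial_ext : _ -> R^o) p.
Proof.
move=> pp; have [u' su' uu'] := su (normalize_unit pp).
have sl : smooth_near TA (fun q => - log_norm q : R^o) p.
  exact: smooth_atN (log_norm_smooth pp).
have sn := scaling_smooth sl.
set nu := (fun z : V * W => _) in sn.
have nuE : nu (chart TA p p) = chart TA p (normalize p).
  by rewrite /nu (chartK hTA (dom_refl hTA p)) chart_bscale //; exact: (tdom_refl hB).
have cn := smooth_at_cont sn; rewrite /prop_for /continuous_at nuE in cn.
have n1 : \forall z \near chart TA p p, unit_sphere_bundle h (unchart TA p (nu z)) ->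
   u' (unchart TA p (nu z)) = u (unchart TA p (nu z)) := cn _ uu'.
apply: (@smooth_at_eq _ _ _ ((u' \o unchart TA p) \o nu)).
  apply: filterS3 n1 (near_punctured pp) (near_total_tdom p) => z e pz tz.
  have E : unchart TA p (nu z) = normalize (unchart TA p z).
    by rewrite /normalize bscale_unchart.
  by rewrite /= e E //; exact: normalize_unit.
apply: smooth_at_comp => //; rewrite nuE; exact: su'.
Qed.

Lemma tangent_dif (Y : set (total B)) (f : total B -> R^o) p w :
  smooth_near TA f p -> near_point TA p (fun q => Y q -> f q = 0) ->
  tangent_vector TA Y p w -> dif TA f p w = 0.
Proof.
move=> sf f0 [c [c0 cY sc cw]].
have cc := smooth_at_cont sc.
rewrite /prop_for /continuous_at /comp c0 in cc.
have n0 : \forall t \near (0 : R^o), Y (unchart TA p (chart TA p (c t))) ->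
   f (unchart TA p (chart TA p (c t))) = 0 := cc _ f0.
have e0 : (chart TA p \o c) 0 = chart TA p p by rewrite /= c0.
have df : differentiable (f \o unchart TA p) ((chart TA p \o c) 0).
  by rewrite e0; exact: smooth_at_diff.
rewrite /dif -cw -[in LHS]e0 -(derive_comp (1 : R^o) (smooth_at_diff sc) df).
rewrite -[RHS](derive_cst (0 : R^o) (0 : R^o) (1 : R^o)).
apply: near_eq_derive; apply: filterS2 n0 cY => t ft [Yt dt].
by apply: ft; rewrite (chartK hTA dt).
Qed.

(** The line with direction [w] in the chart, pushed onto the graph by [retract],
    still has velocity [w], because the scaling factor is stationary. *)
Lemma kernel_tangent q w : radial_graph h u q ->
  dif TA (fun xi => radial_ext xi - log_norm xi : R^o) q w = 0 ->
  tangent_vector TA (radial_graph h u) q w.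
Proof.
move=> /radial_graphP[pq eq] dw.
have sF : smooth_near TA (fun xi => radial_ext xi - log_norm xi : R^o) q.
  exact: smooth_atB (radial_ext_smooth pq) (log_norm_smooth pq).
have sS := scaling_smooth sF.
set S := (fun z : V * W => _) in sS.
pose l (t : R^o) := t *: w + chart TA q q.
have l0 : l 0 = chart TA q q by rewrite /l scale0r add0r.
have sl : smooth_at l 0.
  apply: smooth_atD; last exact: smooth_at_cst.
  by apply: smooth_atZ; [exact: smooth_at_id|exact: smooth_at_cst].
have cl := smooth_at_cont sl; rewrite /prop_for /continuous_at l0 in cl.
have nt : \forall t \near (0 : R^o), tdom B (base q) (unchart A (base q) (l t).1) :=
  cl _ (near_total_tdom q).
have np : \forall t \near (0 : R^o), punctured (unchart TA q (l t)) :=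
  cl _ (near_punctured pq).
have nd : \forall t \near (0 : R^o), dom TA q (unchart TA q (l t)) :=
  cl _ (near_dom hTA (dom_refl hTA q) (dom_refl hTA q)).
have nK : \forall t \near (0 : R^o), chart TA q (unchart TA q (l t)) = l t :=
  cl _ (unchartK hTA (dom_refl hTA q)).
have nE : \forall t \near (0 : R^o), (S \o l) t =
    (chart TA q \o (fun t => retract (unchart TA q (l t)))) t.
  apply: filterS2 nt nK => t tt Kt.
  by rewrite [RHS](@chart_bscale q (unchart TA q (l t)) _ tt) Kt.
have sSl : smooth_at (S \o l) 0 by apply: smooth_at_comp => //; rewrite l0.
exists (fun t => retract (unchart TA q (l t))); split.
- by rewrite l0 (chartK hTA (dom_refl hTA q)) /retract eq subrr expR0 bscale1.
- by apply: filterS2 np nd => t pt dt; split=> //; exact: retract_graph.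
- exact: smooth_at_eq nE sSl.
rewrite -(near_eq_derive _ nE).
rewrite (derive_comp _ (smooth_at_diff sl)) l0; last exact: smooth_at_diff.
have -> : 'D_1 l 0 = w.
  rewrite -[RHS](derive_id (chart TA q q) w); apply: derive_line_ext => t /=.
  by rewrite /l addr0 [_%:A]mulr1.
have d1 : differentiable (@fst V W) (chart TA q q).
  exact: smooth_at_diff (smooth_at_fst _).
have d2 : differentiable (@snd V W) (chart TA q q).
  exact: smooth_at_diff (smooth_at_snd _).
have dF := smooth_at_diff sF.
pose f (z : V * W) : R^o := expR (radial_ext (unchart TA q z) - log_norm (unchart TA q z)).
have dex : differentiable (expR : R^o -> R^o)
    (radial_ext (unchart TA q (chart TA q q)) - log_norm (unchart TA q (chart TA q q))).
  exact: smooth_at_diff (smooth_at_expR _).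
have df : differentiable f (chart TA q q) by exact: (differentiable_comp dF dex).
have Df : 'd f (chart TA q q) w = 0.
  rewrite -(deriveE _ df) [LHS](derive_comp w dF dex).
  by move: dw; rewrite /dif => ->; exact: derive0.
have f1 : f (chart TA q q) = 1.
  by rewrite /f (chartK hTA (dom_refl hTA q)) eq subrr expR0.
have [d3 e3] := is_diff_scale df d2.
rewrite [LHS](derive_pair w d1 d3) (deriveE _ d3) e3 Df f1 scale0r addr0 scale1r.
rewrite [RHS]surjective_pairing; congr pair.
  rewrite -[RHS](derive_id (chart TA q q).1 w.1); exact: derive_line_ext.
rewrite -(deriveE _ d2) -[RHS](derive_id (chart TA q q).2 w.2); exact: derive_line_ext.
Qed.

End Graph.
End RadialFunctions.

(** * Derivatives at a critical point *)

Section Hessian.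
Variables (R : realType) (T : Type) (V : normedModType R) (A : atlas T V).
Hypotheses (fV : finite_dim V) (hA : smooth_atlas A).
Implicit Types f : T -> R^o.

Lemma coord_tangent_id p v : coord (tangent_bundle A) p p v = v.
Proof.
rewrite -[RHS](derive_id (chart A p p) v) /=; apply: near_eq_derive.
exact: unchartK (dom_refl hA p).
Qed.

(** This quadratic form depends on the chart, except at critical points of [f]. *)
Definition hessian f p v : R := 'D_v ('D_v (f \o unchart A p)) (chart A p p).

Lemma dif_field f p Z : smooth_near A f p ->
  \forall z \near chart A p p,
    dif A f (unchart A p z) (Z (unchart A p z)) =
    'D_(coord (tangent_bundle A) p (unchart A p z) (Z (unchart A p z)))
      (f \o unchart A p) z.
Proof.
move=> sf; have dp := dom_refl hA p.
have := smooth_near_near fV hA sf.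
apply: filterS3 (near_dom hA dp dp) (unchartK hA dp) => z dz zK sz.
by rewrite (dif_chart fV hA _ dz sz) zK.
Qed.

Lemma dif_field_smooth f p Z : smooth_near A f p -> vfield_smooth_near A Z p ->
  smooth_near A (fun q => dif A f q (Z q) : R^o) p.
Proof.
move=> sf sZ; have := smooth_at_dir fV sf sZ; apply: smooth_at_eq.
by have := dif_field Z sf; apply: filterS => z e; rewrite [RHS]e.
Qed.

(** The derivatives of the components of [Z] are multiplied by derivatives of
    [f] at [p], which vanish. *)
Lemma hessian_field f p Z : smooth_near A f p -> vfield_smooth_near A Z p ->
  (forall v, dif A f p v = 0) ->
  dif A (fun q => dif A f q (Z q) : R^o) p (Z p) = hessian f p (Z p).
Proof.
move=> sf sZ crit; have [d [b [c [lc cc bE]]]] := fV.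
have dp := dom_refl hA p.
set F := f \o unchart A p.
pose Zh z := coord (tangent_bundle A) p (unchart A p z) (Z (unchart A p z)).
have sF : smooth_at F (chart A p p) := sf.
have sDF i : smooth_at ('D_(b i) F : V -> R^o) (chart A p p) := smooth_at_derive (b i) sF.
have sc i : smooth_at (fun z => c i (Zh z)) (chart A p p).
  by apply: (@smooth_at_comp _ _ _ _ Zh (c i)) => //; exact: smooth_at_linear.
have dF0 i : 'D_(b i) F (chart A p p) = 0 by exact: crit.
have Zp : Zh (chart A p p) = Z p by rewrite /Zh chartK // coord_tangent_id.
have e1 : \forall z \near chart A p p,
    \sum_i c i (Zh z) *: 'D_(b i) F z = dif A f (unchart A p z) (Z (unchart A p z)).
  apply: filterS2 (dif_field Z sf) (smooth_at_near sF) => z -> /smooth_at_diff dz.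
  by rewrite -derive_sum_dir // -bE.
have e2 : \forall z \near chart A p p,
    \sum_i c i (Z p) *: 'D_(b i) F z = 'D_(Z p) F z.
  have := smooth_at_near sF; apply: filterS => z /smooth_at_diff dz.
  by rewrite -derive_sum_dir // -bE.
rewrite /hessian -/F -(near_eq_derive _ e2) {1}/dif -(near_eq_derive _ e1).
have dsum (k : 'I_d -> V -> R^o) : (forall i, smooth_at (k i) (chart A p p)) ->
   'D_(Z p) (fun z => \sum_i k i z *: 'D_(b i) F z) (chart A p p) =
   \sum_i k i (chart A p p) *: 'D_(Z p) ('D_(b i) F) (chart A p p).
  move=> sk; rewrite (_ : (fun z => _) = \sum_i (fun z => k i z *: 'D_(b i) F z)); last first.
    by apply/funext => z; rewrite fct_sumE.
  rewrite derive_sum => [|i].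
    apply: eq_bigr => i _.
    have [d1 e] := is_diff_scale (smooth_at_diff (sk i)) (smooth_at_diff (sDF i)).
    rewrite (deriveE _ d1) e dF0 scaler0 addr0 -deriveE //.
    exact: smooth_at_diff.
  apply: diff_derivable.
  by have [] := is_diff_scale (smooth_at_diff (sk i)) (smooth_at_diff (sDF i)).
rewrite (dsum _ sc) (dsum (fun i _ => c i (Z p))); last first.
  by move=> i; exact: smooth_at_cst.
by apply: eq_bigr => i _; rewrite Zp.
Qed.

End Hessian.

(** * The shape operator of a radial graph at a critical point *)

Lemma derive1_ratio (R : realType) (c s : R) : 0 < s ->
  'D_1 (fun k : R^o => k * c / (s + k * k * c) : R^o) 0 = c / s.
Proof.
move=> s0.
pose P (a b d : R) := fun k : R^o => a + k * b + k * k * d : R^o.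
have dP a b d : derivable (P a b d : R^o -> R^o) 0 1.
  by have [] := @is_derive_quadratic R a b d.
have P0 a b d : P a b d 0 = a by rewrite /P !mul0r !addr0.
have -> : (fun k : R^o => k * c / (s + k * k * c) : R^o) =
    P 0 c 0 * (fun k => (P s 0 c k)^-1).
  by apply/funext => k; rewrite /P fctE add0r !mulr0 !addr0.
have nz : P s 0 c 0 != 0 by rewrite P0 gt_eqF.
have dV := derivableV nz (dP s 0 c).
rewrite (deriveM (dP 0 c 0) dV) P0 scale0r add0r.
have -> : 'D_1 (P 0 c 0) 0 = c by have /@derive_val := @is_derive_quadratic R 0 c 0.
by rewrite P0; exact: mulrC.
Qed.

Section RadialGraphs.
Variables (R : realType) (M : Type) (V W : normedModType R).
Variables (A : atlas M V) (B : bundle M W).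
Hypotheses (fV : finite_dim V) (fW : finite_dim W).
Hypotheses (hA : smooth_atlas A) (hB : smooth_bundle A B).
Variables (g : M -> V -> V -> R) (nabla : M -> V -> (M -> V) -> V).
Hypothesis hng : metric_compatible (B := tangent_bundle A) A g nabla.
Variables (h : forall p, B p -> B p -> R).
Variable cov : forall p, V -> (forall q, B q) -> B p.
Hypotheses (hh : bundle_metric A h) (hc : connection A cov).
Hypothesis hch : metric_compatible A h cov.
Variables (G : total B -> V * W -> V * W -> R)
  (D : total B -> V * W -> (total B -> V * W) -> V * W).
Hypotheses (hG : Sasaki_metric A cov g h G) (hD : Sasaki_connection A cov nabla D).

Local Notation TA := (total_atlas A B).
Local Notation TB := (tangent_bundle TA).
Local Notation hor := (horizontal_lift (B := B) cov).
Local Notation ver := (vertical_lift (V := V) (B := B)).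
Local Notation log_norm := (log_norm h).
Local Notation sqnorm := (sqnorm h).

Let fT := finite_dim_total fV fW.
Let hTA := total_smooth_atlas fV fW hA hB.
Let hTB := tangent_smooth_bundle fT hTA.
Let hi q : inner_product (@h q). Proof. exact: (metric_inner hh q). Qed.
Let GM : bundle_metric (B := TB) TA G. Proof. by case: hG. Qed.
Let Gi p : inner_product (U := TB p) (G p). Proof. exact: (metric_inner GM p). Qed.

Definition euler (q : total B) : V * W := ver q (vec q).

Lemma scaled_euler_smooth (f : total B -> R^o) p : smooth_near TA f p ->
  vfield_smooth_near TA (fun q => ver q ((f q : R) *: vec q)) p.
Proof.
move=> sf.
have s : smooth_at (fun z : V * W => (0 : V, (f (unchart TA p z) : R) *: z.2))
    (chart TA p p).
  apply: smooth_at_pair; first exact: smooth_at_cst.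
  by apply: smooth_atZ => //; exact: smooth_at_snd.
apply: smooth_at_eq s.
have dp := dom_refl hTA p.
apply: filterS2 (near_dom hTA dp dp) (unchartK hTA dp) => z dz zK.
have [/= _ tz] := dz.
rewrite [RHS](coord_vertical fV fW hA hB _ dz); congr pair.
by rewrite (linearZP _ _ (coordP hB tz)) [coord _ _ _ _](frameK hB tz).
Qed.

Lemma euler_smooth p : vfield_smooth_near TA euler p.
Proof.
have := scaled_euler_smooth (smooth_at_cst (1 : R^o) (chart TA p p) :
  smooth_near TA (fun=> 1 : R^o) p).
rewrite (_ : (fun q => _) = euler) //.
by apply/funext => q; rewrite scale1r.
Qed.

Lemma dif_log_norm_horizontal q v : punctured q ->
  dif TA (log_norm : _ -> R^o) q (hor q v) = 0.
Proof.
move=> pq; rewrite (dif_log_norm fV fW hA hB hh _ pq).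
by rewrite (dif_sqnorm_horizontal fV fW hA hB hh hch) mul0r mulr0.
Qed.

Lemma G_vertical_split q t v s : G q (ver q t) (hor q v + ver q s) = h t s.
Proof.
have -> : G q (ver q t) (hor q v + ver q s) =
  G q (ver q t) (hor q v) + G q (ver q t) (ver q s) by exact: (ipDr (Gi q)).
by rewrite (G_ver_hor hG) (G_ver hG) add0r.
Qed.

(** The gradient of the logarithm of the norm is the Euler field divided by
    the squared norm. *)
Lemma dif_log_norm_euler q w : punctured q ->
  dif TA (log_norm : _ -> R^o) q w = G q (euler q) w / sqnorm q.
Proof.
move=> pq; have [t ->] := tangent_split hB cov q w.
rewrite G_vertical_split.
rewrite (linearDP _ _ (dif_linear (log_norm_smooth fV fW hA hB hh pq))).
rewrite (dif_log_norm_horizontal _ pq) add0r.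
by rewrite (dif_log_norm_vertical fV fW hA hB hh _ pq) (ipC (hi _)).
Qed.

Section Graph.
Variable u : total B -> R.
Hypothesis su : smooth_on_subset TA (unit_sphere_bundle h) u.
Local Notation ru := (radial_ext h u).
Local Notation Y := (radial_graph h u).

Lemma dif_radial_ext_euler q : punctured q -> dif TA (ru : _ -> R^o) q (euler q) = 0.
Proof.
move=> pq; rewrite (dif_vertical hA hB) -[RHS](derive_cst (ru q : R^o) (0 : R^o) 1).
apply: near_eq_derive.
have : \forall k \near (0 : R^o), -1 < k by apply: lt_nbhsr; lra.
apply: filterS => k k1.
rewrite -[X in X + _]/(k *: vec q) -[X in _ + X]scale1r -scalerDl.
by rewrite -[existT _ _ _]/(bscale (k + 1) q) (radial_ext_bscale hh) //; lra.
Qed.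

Definition defining (q : total B) : R^o := ru q - log_norm q.

Lemma defining_smooth q : punctured q -> smooth_near TA defining q.
Proof.
move=> pq; apply: smooth_atB; first exact: (radial_ext_smooth fV fW hA hB hh su pq).
exact: (log_norm_smooth fV fW hA hB hh pq).
Qed.

Lemma dif_defining q w : punctured q ->
  dif TA defining q w =
  dif TA (ru : _ -> R^o) q w - dif TA (log_norm : _ -> R^o) q w.
Proof.
move=> pq; apply: difB; first exact: (radial_ext_smooth fV fW hA hB hh su pq).
exact: (log_norm_smooth fV fW hA hB hh pq).
Qed.

Lemma dif_defining_euler q : punctured q -> dif TA defining q (euler q) = -1.
Proof.
move=> pq; rewrite dif_defining // dif_radial_ext_euler // sub0r.
rewrite (dif_log_norm_vertical fV fW hA hB hh _ pq) divff // gt_eqF //.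
exact: (sqnorm_gt0 hh).
Qed.

Lemma tangent_defining q w : Y q ->
  tangent_vector TA Y q w <-> dif TA defining q w = 0.
Proof.
move=> Yq; have [pq _] := (radial_graphP hh u q).1 Yq; split.
  apply: (tangent_dif fV fW hA hB (defining_smooth pq)).
  apply: filterS (near_dom hTA (dom_refl hTA q) (dom_refl hTA q)) => z _.
  by move=> /(radial_graphP hh u)[_ e]; rewrite /defining e subrr.
exact: (kernel_tangent fV fW hA hB hh su).
Qed.

(** A normal vector of the graph is determined by its product with the Euler
    vector, which is transverse to the graph. *)
Lemma normal_defining q v : Y q ->
  (forall w, tangent_vector TA Y q w -> G q v w = 0) ->
  forall w, G q v w = - dif TA defining q w * G q v (euler q).
Proof.
move=> Yq nv w; have [pq _] := (radial_graphP hh u q).1 Yq.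
pose c : R := dif TA defining q w.
have lin := dif_linear (defining_smooth pq).
have : G q v (w + c *: euler q) = 0.
  apply: nv; apply/(tangent_defining _ Yq).
  rewrite (linearDP _ _ lin) (linearZP _ _ lin) dif_defining_euler //.
  by rewrite (_ : c *: -1 = - c); [exact: subrr|exact: mulrN1].
have -> : G q v (w + c *: euler q) = G q v w + c * G q v (euler q).
  by rewrite -(ipZr (Gi q)); exact: (ipDr (Gi q)).
by rewrite -/c; lra.
Qed.

Section CriticalPoint.
Variables (p : total B) (N : total B -> V * W).
Hypotheses (Yp : Y p) (crit : forall w, dif TA (ru : _ -> R^o) p w = 0).
Hypothesis sN : vfield_smooth_near TA N p.
Hypothesis nN : near_point TA p
  (fun q => Y q -> oriented_unit_normal TA G (radial_field h) Y q (N q)).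

Let r := bnorm h p.
Let pp : punctured p. Proof. by have [] := (radial_graphP hh u p).1 Yp. Qed.
Let r0 : 0 < r. Proof. by rewrite /r (bnormE hh) // expR_gt0. Qed.
Let r2 : sqnorm p = r ^+ 2. Proof. by rewrite /r (bnormE hh) // (expR_log_norm hh). Qed.

Lemma critical_normal w :
  G p (N p) w = G p (euler p) w / r ^+ 2 * G p (N p) (euler p).
Proof.
have [nn _ _] := near_self hTA nN Yp.
rewrite (normal_defining Yp nn w) dif_defining // crit sub0r opprK.
by rewrite dif_log_norm_euler // r2.
Qed.

(** At a critical point the tangent space of the graph is the orthogonal of the
    Euler vector, so the unit normal is the radial unit vector. *)
Lemma critical_normal_euler : G p (N p) (euler p) = r.
Proof.
have [_ n1 npos] := near_self hTA nN Yp.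
have rE : G p (N p) (radial_field h p) = r^-1 * G p (N p) (euler p).
  rewrite /radial_field (linearZP _ _ (vertical_liftP hB (V := V) (q := p))).
  exact: (ipZr (Gi p)).
have e0 : 0 < G p (N p) (euler p) by move: npos; rewrite rE pmulr_rgt0 ?invr_gt0.
have ee : G p (N p) (euler p) ^+ 2 = r ^+ 2.
  have := critical_normal (N p); rewrite n1.
  rewrite (_ : G p (euler p) (N p) = G p (N p) (euler p)); last exact: (ipC (Gi p)).
  set x := G p (N p) (euler p) => e.
  transitivity (r ^+ 2 * (x / r ^+ 2 * x)); last by rewrite -e mulr1.
  by field; rewrite gt_eqF.
by apply/eqP; rewrite -(eqrXn2 (n := 2)) // ?ltW // ee.
Qed.

Lemma critical_normal_horizontal v : G p (N p) (hor p v) = 0.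
Proof. by rewrite critical_normal (G_ver_hor hG) !mul0r. Qed.

(** The functions [G N Z] and [- dif F Z * G N euler] agree on the graph, where
    [F] is the defining function; at a critical point only [dif F Z] has to be
    differentiated, because it vanishes there. *)
Lemma dif_normal_field Z : vfield_smooth_near TA Z p -> G p (euler p) (Z p) = 0 ->
  dif TA (fun q => G q (N q) (Z q) : R^o) p (Z p) =
  - r * dif TA (fun q => dif TA (defining : _ -> R^o) q (Z q) : R^o) p (Z p).
Proof.
move=> sZ Z0.
have sA0 : smooth_near TA (fun q => G q (N q) (Z q) : R^o) p.
  exact: (metric_smooth GM sN sZ).
have sA1 : smooth_near TA (fun q => dif TA (defining : _ -> R^o) q (Z q) : R^o) p.
  exact: (dif_field_smooth fT hTA (defining_smooth pp) sZ).
have sA2 : smooth_near TA (fun q => G q (N q) (euler q) : R^o) p.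
  exact: (metric_smooth GM sN (euler_smooth p)).
have dZ : dif TA defining p (Z p) = 0.
  by rewrite dif_defining // crit dif_log_norm_euler // Z0 mul0r subrr.
have sA12 := smooth_nearM sA1 sA2.
pose phi (q : total B) : R^o := G q (N q) (Z q) +
  dif TA (defining : _ -> R^o) q (Z q) * G q (N q) (euler q).
have sphi : smooth_near TA phi p by exact: (smooth_atD sA0 sA12).
have vanish : near_point TA p (fun q => Y q -> phi q = 0).
  apply: filterS nN => z nz Yz; have [nn _ _] := nz Yz.
  by rewrite /phi (normal_defining Yz nn (Z _)) mulNr addNr.
have := tangent_dif fV fW hA hB sphi vanish ((tangent_defining (Z p) Yp).2 dZ).
rewrite (difD _ sA0 sA12) (difM _ hTA sA1 sA2) dZ mul0r add0r.
by rewrite critical_normal_euler; lra.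
Qed.

Lemma dif_defining_field Z : vfield_smooth_near TA Z p ->
  dif TA (fun q => dif TA (defining : _ -> R^o) q (Z q) : R^o) p (Z p) =
  hessian TA (ru : _ -> R^o) p (Z p) -
  dif TA (fun q => dif TA (log_norm : _ -> R^o) q (Z q) : R^o) p (Z p).
Proof.
move=> sZ.
have sru := radial_ext_smooth fV fW hA hB hh su pp.
have sln := log_norm_smooth fV fW hA hB hh pp.
rewrite -(hessian_field fT hTA sru sZ crit) -difB.
- apply: dif_eq; apply: filterS (near_punctured fV fW hA hB hh pp) => z pz.
  exact: dif_defining.
- exact: (dif_field_smooth fT hTA sru sZ).
- exact: (dif_field_smooth fT hTA sln sZ).
Qed.

(** On horizontal lifts the differential of [log_norm] is identically zero, and
    only [radial_ext] contributes. *)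
Lemma shape_horizontal X : vfield_smooth_near A X (base p) ->
  G p (D p (hor p (X (base p))) N) (hor p (X (base p))) =
  - r * hessian TA (ru : _ -> R^o) p (hor p (X (base p))).
Proof.
move=> sX.
rewrite (weingarten_horizontal fV fW hA hB hng hc hG hD sX sN critical_normal_horizontal).
have sZ := horizontal_smooth fV fW hA hB hc sX.
have dN := dif_normal_field sZ (G_ver_hor hG _ _); have dF := dif_defining_field sZ.
rewrite [X in _ * X]dF in dN; apply: (etrans dN); congr (_ * _).
rewrite -[RHS]subr0; congr (_ - _).
rewrite -[RHS](dif_cst TA (0 : R^o) p (hor p (X (base p)))).
apply: dif_eq; apply: filterS (near_punctured fV fW hA hB hh pp) => z pz.
exact: dif_log_norm_horizontal.
Qed.

(** On vertical lifts [log_norm] contributes the curvature of the round sphere of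
    radius [r] in the fibre. *)
Lemma shape_vertical s : section_smooth_near A s (base p) ->
  h (s (base p)) (vec p) = 0 ->
  G p (D p (ver p (s (base p))) N) (ver p (s (base p))) =
  h (s (base p)) (s (base p)) / r -
  r * hessian TA (ru : _ -> R^o) p (ver p (s (base p))).
Proof.
move=> ss s0.
rewrite (weingarten_vertical fV fW hA hB hc hG hD ss sN).
have sZ := vertical_smooth fV fW hA hB ss.
have Z0 : G p (euler p) (ver p (s (base p))) = 0.
  by rewrite (G_ver hG) (ipC (hi _)).
have dN := dif_normal_field sZ Z0; have dF := dif_defining_field sZ.
rewrite [X in _ * X]dF in dN; apply: (etrans dN).
set c := h (s (base p)) (s (base p)).
suff -> : dif TA (fun q => dif TA (log_norm : _ -> R^o) q (ver q (s (base q))) : R^o)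
    p (ver p (s (base p))) = c / r ^+ 2.
  by field; rewrite gt_eqF.
transitivity (dif TA (fun q => h (s (base q)) (vec q) / sqnorm q : R^o)
    p (ver p (s (base p)))).
  apply: dif_eq; apply: filterS (near_punctured fV fW hA hB hh pp) => z pz.
  exact: (dif_log_norm_vertical fV fW hA hB hh).
rewrite (dif_vertical hA hB).
rewrite -(@derive1_ratio R c (r ^+ 2)) ?exprn_gt0 //.
apply: (congr1 (fun f : R^o -> R^o => 'D_1 f 0)); apply/funext => k.
rewrite /= /sqnorm /=.
rewrite !(ipDl (hi _)) !(ipDr (hi _)) !(ipZl (hi _)) !(ipZr (hi _)).
rewrite (ipC (hi _) (vec p)) s0 -/c -[h (vec p) (vec p)]/(sqnorm p) r2.
by congr (_ * _^-1); ring.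
Qed.

End CriticalPoint.
End Graph.
End RadialGraphs.

(** * Adapted frames and the mean curvature *)

Section Frames.
(* [m] is the rank of the bundle minus one. *)
Variables (R : realType) (M : Type) (n m : nat).
Local Notation V := 'rV[R]_n.
Local Notation W := 'rV[R]_m.+1.
Variables (A : atlas M V) (B : bundle M W).
Hypotheses (hA : smooth_atlas A) (hB : smooth_bundle A B).
Variables (g : M -> V -> V -> R) (nabla : M -> V -> (M -> V) -> V).
Hypothesis hg : bundle_metric (B := tangent_bundle A) A g.
Hypothesis hng : metric_compatible (B := tangent_bundle A) A g nabla.
Variables (h : forall p, B p -> B p -> R).
Variable cov : forall p, V -> (forall q, B q) -> B p.
Hypotheses (hh : bundle_metric A h) (hc : connection A cov).
Hypothesis hch : metric_compatible A h cov.
Variables (G : total B -> V * W -> V * W -> R)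
  (D : total B -> V * W -> (total B -> V * W) -> V * W).
Hypotheses (hG : Sasaki_metric A cov g h G) (hD : Sasaki_connection A cov nabla D).

Local Notation TA := (total_atlas A B).
Local Notation TB := (tangent_bundle TA).
Local Notation hor := (horizontal_lift (B := B) cov).
Local Notation ver := (vertical_lift (V := V) (B := B)).
Local Notation eul := (@euler R M _ _ B : total B -> V * W).

Let fV := finite_dim_rV R n.
Let fW := finite_dim_rV R m.+1.
Let fT := finite_dim_total fV fW.
Let hTA := total_smooth_atlas fV fW hA hB.
Let hTB := tangent_smooth_bundle fT hTA.
Let hi q : inner_product (@h q). Proof. exact: (metric_inner hh q). Qed.
Let gi b : inner_product (U := V) (g b). Proof. exact: (metric_inner hg b). Qed.
Let GM : bundle_metric (B := TB) TA G. Proof. by case: hG. Qed.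
Let Gi p : inner_product (U := (V * W)%type) (G p).
Proof. exact: (metric_inner GM p). Qed.
Let Dc : connection (B := TB) TA D. Proof. by case: hD. Qed.

Lemma fibre_inner b : inner_product (U := W)
  (fun y y' => h (frame B b b y) (frame B b b y')).
Proof.
have t := tdom_refl hB b; split=> [a x y z|x y|x x0].
- by rewrite (frameP hB t) (ipPl (hi b)).
- exact: (ipC (hi b)).
- apply: (ip_gt0 (hi b)); apply: contra x0 => /eqP e.
  by apply/eqP; rewrite -[x](frameK hB t) e (linear0P (coordP hB t)).
Qed.

(** Gram-Schmidt in the tangent space of the base and in the fibre; in the fibre
    the process starts with the radial unit vector, which is then left out. *)
Lemma adapted_frame p : punctured p -> exists F0 : 'I_(n + m) -> V * W,
  [/\ forall a c, G p (F0 a) (F0 c) = (a == c)%:R,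
      forall w, G p (eul p) w = 0 <->
        exists c : 'I_(n + m) -> R, w = \sum_a c a *: F0 a,
      forall i, exists x, F0 (lshift m i) = hor p x &
      forall j, exists t, [/\ F0 (rshift n j) = ver p t, h t (vec p) = 0 &
                            h t t = 1]].
Proof.
move=> pp; set b := base p; have tb := tdom_refl hB b.
have s0 := sqnorm_gt0 hh pp; set s := sqnorm h p in s0.
have on0 (k : nat) (ip : 'rV[R]_k -> 'rV[R]_k -> R) : orthonormal_upto ip 0 (fun=> 0).
  by [].
have [x _ onx] := orthonormal_complete (gi b) (leq0n n) (on0 n (g b)).
pose ip y y' := h (frame B b b y) (frame B b b y').
have hip : inner_product (U := W) ip := fibre_inner b.
pose e0 := (Num.sqrt s)^-1 *: coord B b b (vec p).
have ip0 y : ip y e0 = (Num.sqrt s)^-1 * h (frame B b b y) (vec p).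
  by rewrite /ip /e0 (linearZP _ _ (frameP hB tb)) (ipZr (hi b)) (coordK hB tb).
have one0 : orthonormal_upto ip 1 (fun=> e0).
  move=> [|//] [|//] _ _; rewrite ip0 /e0 (linearZP _ _ (frameP hB tb)).
  rewrite (ipZl (hi b)) (coordK hB tb) -/(sqnorm h p) -/s mulrA -expr2 exprVn.
  by rewrite sqr_sqrtr ?ltW // mulVf // gt_eqF.
have [e eE one] := orthonormal_complete hip (ltn0Sn m) one0.
(* The first vector of the completed family is the radial unit vector. *)
have e00 : e 0%N = e0 := eE 0%N isT.
pose t (j : nat) : B b := frame B b b (e j.+1).
have tv (j : 'I_m) : h (t j) (vec p) = 0.
  have : ip (e j.+1) (e 0%N) = 0 := one j.+1 0%N (ltn_ord (lift ord0 j)) (ltn0Sn m).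
  rewrite e00 ip0.
  by move=> /eqP; rewrite mulf_eq0 invr_eq0 sqrtr_eq0 leNgt s0 => /eqP.
have tt (j j' : 'I_m) : h (t j) (t j') = (j == j')%:R.
  by have := one j.+1 j'.+1 (ltn_ord (lift ord0 j)) (ltn_ord (lift ord0 j')).
pose F0 (a : 'I_(n + m)) : V * W :=
  match fintype.split a with inl i => hor p (x i) | inr j => ver p (t j) end.
have Fl i : F0 (lshift m i) = hor p (x i) by rewrite /F0 (unsplitK (inl i)).
have Fr j : F0 (rshift n j) = ver p (t j) by rewrite /F0 (unsplitK (inr j)).
have Fev a : G p (eul p) (F0 a) = 0.
  case: (split_ordP a) => [i|j] ->; first by rewrite Fl (G_ver_hor hG).
  by rewrite Fr (G_ver hG) (ipC (hi b)) tv.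
exists F0; split.
- move=> a c; case: (split_ordP a) => [i|j] ->; case: (split_ordP c) => [i'|j'] ->.
  + by rewrite !Fl (G_hor hG) onx // eq_lshift.
  + by rewrite Fl Fr (G_hor_ver hG) eq_lrshift.
  + by rewrite Fl Fr (G_ver_hor hG) eq_rlshift.
  + by rewrite !Fr (G_ver hG) tt eq_rshift.
- move=> w; split=> [Ew|[c ->]]; last first.
    rewrite (ip_sumr (Gi p)) big1 // => a _.
    by rewrite (ipZr (Gi p)) Fev mulr0.
  have [y wE] := tangent_split hB cov p w.
  have hy : h (vec p) y = 0.
    by move: Ew; rewrite wE (G_vertical_split hG).
  exists (fun a => match fintype.split a with
     inl i => g b w.1 (x i) | inr j => h y (t j) end).
  rewrite big_split_ord /= [LHS]wE; congr (_ + _).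
    rewrite {1}[w.1](orthonormal_span (gi b) _ onx).
    rewrite (linear_sum_scale _ _ (horizontal_liftP hB hc p)).
    by apply: eq_bigr => i _; rewrite Fl (unsplitK (inl i)).
  have yE : y = \sum_(j < m) h y (t j) *: t j.
    rewrite -[LHS](coordK hB tb) [coord _ _ _ _](orthonormal_span hip _ one).
    rewrite (linear_sum_scale _ _ (frameP hB tb)) big_ord_recl /= e00 ip0.
    rewrite (coordK hB tb) (ipC (hi b)) hy mulr0 scale0r add0r.
    by apply: eq_bigr => j _; rewrite /ip (coordK hB tb).
  rewrite {1}yE (linear_sum_scale _ _ (vertical_liftP hB (V := V) (q := p))).
  by apply: eq_bigr => j _; rewrite Fr (unsplitK (inr j)).
- by move=> i; exists (x i).
- by move=> j; exists (t j); split=> //; rewrite tt eqxx.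
Qed.

Section Critical.
Variable u : total B -> R.
Hypothesis su : smooth_on_subset TA (unit_sphere_bundle h) u.
Local Notation ru := (radial_ext h u).
Local Notation Y := (radial_graph h u).
Variables (p : total B) (N : total B -> V * W).
Hypotheses (Yp : Y p) (crit : forall w, dif TA (ru : _ -> R^o) p w = 0).
Hypothesis sN : vfield_smooth_near TA N p.
Hypothesis nN : near_point TA p
  (fun q => Y q -> oriented_unit_normal TA G (radial_field h) Y q (N q)).

Lemma shape_hor x : G p (D p (hor p x) N) (hor p x) =
  - bnorm h p * hessian TA (ru : _ -> R^o) p (hor p x).
Proof.
have hTM := tangent_smooth_bundle fV hA.
have tp := tdom_refl hTM (base p).
pose X q := frame (tangent_bundle A) (base p) q x.
have Xp : X (base p) = x by exact: (coord_tangent_id hA).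
have sX : vfield_smooth_near A X (base p) by exact: (frame_section_smooth hTM x tp).
have := shape_horizontal fV fW hA hB hng hh hc hch hG hD su Yp crit sN nN sX.
by rewrite Xp.
Qed.

Lemma shape_ver t : h t (vec p) = 0 -> h t t = 1 ->
  G p (D p (ver p t) N) (ver p t) =
  (bnorm h p)^-1 - bnorm h p * hessian TA (ru : _ -> R^o) p (ver p t).
Proof.
move=> tv tt; have tp := tdom_refl hB (base p).
pose s q := frame B (base p) q (coord B (base p) (base p) t).
have sp : s (base p) = t by exact: (coordK hB tp).
have ss : section_smooth_near A s (base p) by exact: (frame_section_smooth hB _ tp).
have := shape_vertical fV fW hA hB hh hc hch hG hD su Yp crit sN nN ss.
by rewrite sp tt mul1r; apply.
Qed.

(** Each of the [m] vertical vectors of the frame contributes [1 / r]; all vectors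
    of the frame contribute second derivatives. *)
Lemma mean_curvature_critical : exists F0 : 'I_(n + m) -> V * W,
  tangent_frame TA Y p F0 /\
  forall F : 'I_(n + m) -> V * W, tangent_frame TA Y p F ->
    \sum_a \sum_c invmx (\matrix_(a < n + m, c < n + m) G p (F a) (F c)) a c *
       G p (D p (F a) N) (F c) =
    m%:R / bnorm h p -
    bnorm h p * \sum_a hessian TA (ru : _ -> R^o) p (F0 a).
Proof.
have [pp _] := (radial_graphP hh u p).1 Yp.
have s0 := sqnorm_gt0 hh pp.
have [F0 [on sp Fl Fr]] := adapted_frame pp.
have tE w : tangent_vector TA Y p w <-> G p (eul p) w = 0.
  have tD := tangent_defining fV fW hA hB hh su w Yp.
  have E : dif TA (defining h u) p w = - (G p (eul p) w / sqnorm h p).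
    rewrite (dif_defining fV fW hA hB hh su _ pp) crit sub0r.
    by rewrite (dif_log_norm_euler fV fW hA hB hh hch hG _ pp).
  split=> [/tD|e].
    rewrite E => /eqP; rewrite oppr_eq0 mulf_eq0 invr_eq0 (gt_eqF s0) orbF.
    by move=> /eqP.
  by apply/tD; rewrite E e mul0r oppr0.
exists F0; split.
  split=> [w|c c0 a]; first by split=> [/tE/sp|/sp/tE].
  have := congr1 (fun w => G p w (F0 a)) c0.
  rewrite (ip0l (Gi p)) (ip_suml (Gi p)) (bigD1 a) //= (ipZl (Gi p)) on eqxx mulr1.
  rewrite big1 ?addr0 // => i /negPf ia.
  by rewrite (ipZl (Gi p)) on ia mulr0.
move=> F [spF frF].
rewrite (@trace_orthonormal R _ (G p) (Gi p) (fun v w => G p (D p v N) w) _ F F0) //.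
- rewrite big_split_ord /=.
  under eq_bigr => i _.
    have -> : G p (D p (F0 (lshift m i)) N) (F0 (lshift m i)) =
      - bnorm h p * hessian TA (ru : _ -> R^o) p (F0 (lshift m i)).
      by have [x ->] := Fl i; exact: shape_hor.
  over.
  under [X in _ + X]eq_bigr => j _.
    have -> : G p (D p (F0 (rshift n j)) N) (F0 (rshift n j)) =
      (bnorm h p)^-1 - bnorm h p * hessian TA (ru : _ -> R^o) p (F0 (rshift n j)).
      by have [t [-> tv tt]] := Fr j; exact: shape_ver.
  over.
  rewrite /= sumrB sumr_const card_ord -!mulr_sumr big_split_ord /= -mulr_natl.
  ring.
- move=> a v w z; rewrite -(ipPl (Gi p)); congr (G p _ z).
  exact: (covPl Dc).
- by move=> a v w z; rewrite (ipDr (Gi p)) (ipZr (Gi p)).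
- move=> a; apply/sp/tE/spF.
  exists (fun c => (c == a)%:R); rewrite (bigD1 a) //= eqxx scale1r big1 ?addr0 //.
  by move=> i /negPf ->; rewrite scale0r.
Qed.

End Critical.
End Frames.

(** * Extrema *)

Section LocalMaximum.
Variables (R : realType) (V : normedModType R).

Lemma common_smaller (a b : R) : 0 < a -> 0 < b -> exists c, [/\ 0 < c, c < a & c < b].
Proof.
move=> a0 b0; have [ab|ba] := leP a b; [exists (a / 2)|exists (b / 2)]; split; lra.
Qed.

Lemma derive_along_line (F : V -> R^o) z0 w (k : R^o) :
  'D_1 (fun k : R^o => F (k *: w + z0)) k = 'D_w F (k *: w + z0).
Proof.
apply: derive_line_ext => t.
by rewrite [t *: 1]mulr1 scalerDl addrA.
Qed.

(** If the second derivative along [w] were positive, the first one would be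
    positive just after the maximum, which contradicts the mean value theorem. *)
Lemma local_maximum (F : V -> R^o) z0 w : smooth_at F z0 ->
  (\forall z \near z0, F z <= F z0) ->
  'D_w F z0 = 0 /\ 'D_w ('D_w F) z0 <= 0.
Proof.
move=> sF maxF.
pose l (k : R^o) := k *: w + z0.
have l0 : l 0 = z0 by rewrite /l scale0r add0r.
have dl k : differentiable l k.
  apply: smooth_at_diff; apply: smooth_atD; last exact: smooth_at_cst.
  by apply: smooth_atZ; [exact: smooth_at_id|exact: smooth_at_cst].
have cl := differentiable_continuous (dl 0).
rewrite /prop_for /continuous_at l0 in cl.
have n1 : \forall k \near (0 : R^o), smooth_at F (l k) := cl _ (smooth_at_near sF).
have n2 : \forall k \near (0 : R^o), F (l k) <= F z0 := cl _ maxF.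
have n12 : \forall k \near (0 : R^o), smooth_at F (l k) /\ F (l k) <= F z0.
  by apply: filterS2 n1 n2 => k.
move: n12 => /nbhs_ballP[e /= e0 He].
have {}He k : - e < k -> k < e -> smooth_at F (l k) /\ F (l k) <= F z0.
  move=> k1 k2; apply: He; rewrite /ball /= sub0r normrN; by rewrite ltr_norml k1 k2.
pose phi (k : R) : R := F (l k).
have dphi k : - e < k -> k < e -> derivable (phi : R^o -> R^o) k 1.
  move=> k1 k2; apply: diff_derivable; have [s _] := He k k1 k2.
  exact: differentiable_comp (dl k) (smooth_at_diff s).
pose psi (k : R^o) : R^o := 'D_w F (l k).
have phiE k : 'D_1 (phi : R^o -> R^o) k = psi k := derive_along_line F z0 w k.
have psi0 : psi 0 = 0.
  rewrite -phiE; have := @derive1_at_max R phi (- e) e 0.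
  case; [by clear - e0; lra| | | |by move=> _ ->].
  - by move=> t; rewrite in_itv /= => /andP[t1 t2]; exact: dphi.
  - by rewrite in_itv /= oppr_lt0 e0.
  - move=> t; rewrite in_itv /= => /andP[t1 t2].
    by rewrite /phi l0; have [] := He t t1 t2.
split; first by rewrite -l0.
rewrite leNgt; apply/negP => d0.
have dpsi : derivable psi 0 1.
  have dD : differentiable ('D_w F : V -> R^o) (l 0).
    by rewrite l0; exact: smooth_at_diff (smooth_at_derive w sF).
  have dps : differentiable psi (0 : R^o) by exact: (differentiable_comp (dl 0) dD).
  exact: diff_derivable.
have psiE : 'D_1 psi 0 = 'D_w ('D_w F) z0.
  by rewrite -[in RHS]l0; exact: derive_along_line.
have : \forall k \near (0 : R)^', 0 < k^-1 * psi k.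
  have := dpsi; rewrite /derivable => /cvg_ex[/= d hd].
  have dE : 'D_1 psi 0 = d by exact: cvg_lim hd.
  have dpos : 0 < d by rewrite -dE psiE.
  have h1 : \forall k \near (0 : R)^', 0 < k^-1 *: (psi (k *: 1 + 0) - psi 0).
    exact: cvgr_gt hd _ dpos.
  apply: filterS h1 => k.
  by rewrite psi0 subr0 addr0 [k *: 1]mulr1.
rewrite /dnbhs /within /= => /nbhs_ballP[e' /= e'0 He'].
have [k [k0 ke ke']] := common_smaller e0 e'0.
have dk (c : R) : 0 <= c -> c <= k -> derivable (phi : R^o -> R^o) c 1.
  by move=> c0 ck; apply: dphi; clear - e0 c0 ck ke; lra.
have [c||c ck e1] := @MVT R phi psi 0 k k0.
- rewrite in_itv /= => /andP[c0 ck].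
  by rewrite -phiE; apply: derivableP; apply: dk; exact: ltW.
- apply: derivable_within_continuous => c; rewrite in_itv /= => /andP[c0 ck].
  exact: dk.
move: ck; rewrite in_itv /= => /andP[c0 ck].
have pc : 0 < c^-1 * psi c.
  apply: He'; last by rewrite gt_eqF.
  by rewrite /ball /= sub0r normrN (gtr0_norm c0); exact: lt_trans ck ke'.
have {}pc : 0 < psi c by rewrite pmulr_rgt0 ?invr_gt0 in pc.
have [|_] := He k _ ke; first by apply: lt_trans k0; rewrite oppr_lt0.
rewrite -/(phi k) -l0 -/(phi 0) leNgt => /negP; apply.
by rewrite -subr_gt0 e1 subr0 mulr_gt0.
Qed.

End LocalMaximum.

Section Manifolds.
Variables (R : realType) (M : topologicalType) (V W : normedModType R).
Variables (A : atlas M V) (B : bundle M W).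
Hypothesis hA : smooth_manifold A.

Lemma near_unchart p q (P : set M) : dom A p q -> nbhs q P ->
  \forall z \near chart A p q, P (unchart A p z).
Proof.
case: hA => _ _ h1 h2 _ dq nP; have [_ c] := h2 p q dq.
have [_ _ _ K] := h1 p.
by apply: c; rewrite K // inE.
Qed.

Lemma manifold_smooth_atlas : smooth_atlas A.
Proof.
case: hA => _ _ h1 h2 h3.
have K p q : dom A p q -> unchart A p (chart A p q) = q.
  by move=> dq; have [_ _ _ k] := h1 p; rewrite k // inE.
have nd p p' q : dom A p q -> dom A p' q ->
    \forall z \near chart A p q, dom A p' (unchart A p z).
  move=> dq dq'; apply: near_unchart => //.
  by apply: open_nbhs_nbhs; split=> //; case: (h1 p').
have nK p q : dom A p q -> \forall z \near chart A p q,
    (chart A p @` dom A p) z /\ chart A p (unchart A p z) = z.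
  move=> dq; have [_ _ o _] := h1 p.
  have : nbhs (chart A p q) (chart A p @` dom A p).
    by apply: open_nbhs_nbhs; split=> //; exists q.
  by apply: filterS => _ [q' dq' <-]; rewrite K.
split=> //.
- by move=> p; case: (h1 p).
- by move=> p q dq; apply: filterS (nK p q dq) => z [].
- move=> p p' q dq dq'; split; first exact: nd.
  exists (chart A p @` (dom A p `&` dom A p')); last exact: h3.
  split; last by exists q.
  rewrite openE => _ [x [dx dx'] <-]; rewrite /interior.
  apply: filterS2 (nK p x dx) (nd p p' x dx dx') => z [[y dy yz] zK] d.
  by exists y => //; split=> //; rewrite -(K p y dy) yz.
Qed.

Lemma manifold_smooth_bundle : vector_bundle A B -> smooth_bundle A B.
Proof.
case=> t1 t2 t3; split.
- by move=> p; case: (t1 p).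
- move=> p q p' dq tq; apply: near_unchart => //.
  by apply: open_nbhs_nbhs; split=> //; case: (t1 p').
- exact: t2.
- exact: t3.
Qed.

End Manifolds.

Section Maxima.
(* [m] is the rank of the bundle minus one. *)
Variables (R : realType) (M : topologicalType) (n m : nat).
Local Notation V := 'rV[R]_n.
Local Notation W := 'rV[R]_m.+1.
Variables (A : atlas M V) (B : bundle M W).
Hypotheses (hM : smooth_manifold A) (hE : vector_bundle A B).
Hypothesis cM : compact [set: M].

Local Notation TA := (total_atlas A B).
Let fV := finite_dim_rV R n.
Let fW := finite_dim_rV R m.+1.
Let hA := manifold_smooth_atlas hM.
Let hB := manifold_smooth_bundle hM hE.
Let hTA := total_smooth_atlas fV fW hA hB.

Variable f : total B -> R^o.
Hypothesis sf : forall q, punctured q -> smooth_near TA f q.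
Hypothesis hf : forall c q, 0 < c -> punctured q -> f (bscale c q) = f q.

Lemma punctured_coord x (q : total B) : tdom B x (base q) ->
  punctured q <-> coord B x (base q) (vec q) != 0.
Proof.
move=> t; split; apply: contra => /eqP e; apply/eqP.
  by rewrite -[LHS](coordK hB t) e (linear0P (frameP hB t)).
by rewrite e (linear0P (coordP hB t)).
Qed.

(** By homogeneity, the values of [f] over a compact ball of a chart are already
    taken on a compact set, the product of the ball with a sphere of the model
    fibre. *)
Lemma local_max (x0 : M) : exists2 p, punctured p &
  \forall x \near x0, forall q, punctured q -> base q = x -> f q <= f p.
Proof.
have d0 := dom_refl hA x0; have t0 := tdom_refl hB x0.
(* Charts of the total space only depend on the base point of their centre. *)
pose o : total B := existT (fun x => B x) x0 0.
have nC : \forall x \near chart A x0 x0,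
    [/\ dom A x0 (unchart A x0 x), chart A x0 (unchart A x0 x) = x &
        tdom B x0 (unchart A x0 x)].
  by apply: filterS3 (near_dom hA d0 d0) (unchartK hA d0) (near_tdom hB d0 t0) => x.
have [r rC] := (nbhs_closedballP _ _).1 nC.
pose C := closed_ball (chart A x0 x0) r%:num.
pose S := [set y : W | `|y| = 1].
have cC : compact C.
  apply: bounded_closed_compact; last exact: closed_ball_closed.
  exists (`|chart A x0 x0| + r%:num); split; first exact: num_real.
  move=> k kr y; rewrite /C closed_ballE // /closed_ball_ /= => yr.
  apply: le_trans (ltW kr); rewrite -[y in leLHS](subKr (chart A x0 x0)).
  by apply: le_trans (ler_normB _ _) _; rewrite lerD2l.
have cS : compact S.
  apply: bounded_closed_compact.
    exists 1; split; first exact: num_real.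
    by move=> k k1 y; rewrite /S /= => ->; exact: ltW.
  apply: (preimage_closed _ (@closed_eq _ 1)) => y _; exact: norm_continuous.
pose F (z : V * W) : R := f (unchart TA o z).
have CS z : (C `*` S) z -> dom TA o (unchart TA o z) /\ chart TA o (unchart TA o z) = z
    /\ punctured (unchart TA o z).
  move=> [/rC[dz zK tz] Sz]; have tz' : tdom B x0 (base (unchart TA o z)) := tz.
  have zE : chart TA o (unchart TA o z) = z.
    by rewrite [RHS]surjective_pairing; congr pair => //; exact: (frameK hB).
  split; first by split.
  split=> //; apply/(punctured_coord tz').
  have -> : coord B x0 (base (unchart TA o z)) (vec (unchart TA o z)) = z.2.
    exact: (frameK hB).
  by rewrite -normr_gt0 Sz.
have [] := @compact_EVT_max _ R F (C `*` S).
- have y0 : 0 < `|const_mx 1 : W|.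
    rewrite normr_gt0; apply/eqP => /matrixP/(_ 0 0); rewrite !mxE; apply/eqP.
    exact: oner_neq0.
  exists (chart A x0 x0, `|const_mx 1 : W|^-1 *: const_mx 1); split.
    by rewrite /C closed_ballE //= /closed_ball_ /= subrr normr0.
  by rewrite /S /= normrZ normfV normr_id mulVf // gt_eqF.
- exact: compact_setX.
- apply: continuous_in_subspaceT => z; rewrite inE => /CS[dz [zE pz]].
  have := smooth_at_cont (smooth_near_chart (finite_dim_total fV fW) hTA dz (sf pz)).
  by rewrite zE.
move=> c; rewrite inE => /CS[dc [cE pc]] cmax.
exists (unchart TA o c) => //.
have [_ _ h1 h2 _] := hM; have [_ oD _ _] := h1 x0; have [cx _] := h2 x0 x0 d0.
have nC' : nbhs x0 (chart A x0 @^-1` C).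
  by apply: cx; apply/nbhs_closedballP; exists r.
have nD : nbhs x0 (dom A x0) by apply: open_nbhs_nbhs; split.
have [b1 _ _] := hE; have [_ oT] := b1 x0.
have nT : nbhs x0 (tdom B x0) by apply: open_nbhs_nbhs; split.
apply: filterS3 nC' nD nT => x Cx dx tx q pq qx; rewrite -qx in Cx dx tx.
have y0 := (punctured_coord tx).1 pq.
set y := coord B x0 (base q) (vec q) in y0.
have c0 : 0 < `|y|^-1 by rewrite invr_gt0 normr_gt0.
rewrite -(hf c0 pq).
have dq : dom TA o (bscale `|y|^-1 q) by split.
rewrite -(chartK hTA dq); apply: cmax; rewrite inE; split => //.
rewrite (@chart_bscale _ _ _ _ A B hB o q _ tx) /= -/y.
by rewrite /S /= normrZ normfV normr_id mulVf // normr_eq0.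
Qed.

(** The total space has no topology as a type.  Compactness of the base is used
    for the filter generated by the superlevel sets of [f]: near every point of
    the base, all points of a small enough superlevel set bound [f]. *)
Lemma global_max : (exists x : M, True) ->
  exists2 p, punctured p & forall q, punctured q -> f q <= f p.
Proof.
move=> [x1 _].
pose F := filter_from [set q : total B | punctured q]
  (fun q => [set i | punctured i /\ f q <= f i]).
have [p1 pp1 _] := local_max x1.
have FF : Filter F.
  apply: filter_from_filter; first by exists p1.
  move=> i j /= pi pj; have [ij|ji] := leP (f i) (f j).
    by exists j => // k [pk jk]; split; split=> //; exact: le_trans jk.
  by exists i => // k [pk ik]; split; split=> //; exact: le_trans (ltW ji) ik.
have cov := (compact_near_coveringP _).1 cM _ F
  (fun i x => forall q, punctured q -> base q = x -> f q <= f i) FF.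
have [|i pi Hi] := cov.
- move=> x _; have [p pp np] := local_max x.
  exists (([set x | forall q, punctured q -> base q = x -> f q <= f p] : set M),
    [set i | punctured i /\ f p <= f i]).
    by split=> //=; exists p.
  by move=> [x' i] [/= Hx [_ pi]] q pq qx; apply: le_trans (Hx q pq qx) pi.
exists i => // q pq; exact: (Hi i (conj pi (lexx _)) (base q) I q pq erefl).
Qed.

End Maxima.

(** * Existence of the radius and of the graph *)

Lemma local_minimum (R : realType) (V : normedModType R) (F : V -> R^o) z0 w :
  smooth_at F z0 -> (\forall z \near z0, F z0 <= F z) ->
  'D_w F z0 = 0 /\ 0 <= 'D_w ('D_w F) z0.
Proof.
move=> sF minF.
have sN := smooth_atN sF.
have [] := @local_maximum R V (fun z => - F z) z0 w sN.
  by apply: filterS minF => z; rewrite lerN2.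
have dN z : differentiable F z -> 'D_w (fun z => - F z) z = - 'D_w F z.
  by move=> dF; rewrite [LHS]deriveN //; exact: diff_derivable.
rewrite dN; last exact: smooth_at_diff.
move=> /eqP; rewrite oppr_eq0 => /eqP -> d2; split=> //.
have e : \forall z \near z0, 'D_w (fun z => - F z) z = (- ('D_w F : V -> R^o)) z.
  by apply: filterS (smooth_at_near sF) => z /smooth_at_diff; exact: dN.
rewrite -oppr_le0; move: d2; rewrite (near_eq_derive _ e) deriveN //.
exact/diff_derivable/smooth_at_diff/smooth_at_derive.
Qed.

Section Main.
(* [m] is the rank of the bundle minus one. *)
Variables (R : realType) (M : topologicalType) (n m : nat).
Local Notation V := 'rV[R]_n.
Local Notation W := 'rV[R]_m.+1.
Variables (A : atlas M V) (B : bundle M W).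
Hypotheses (hM : smooth_manifold A) (hE : vector_bundle A B).
Hypothesis cM : compact [set: M].
Variables (g : M -> V -> V -> R) (nabla : M -> V -> (M -> V) -> V).
Hypothesis hg : bundle_metric (B := tangent_bundle A) A g.
Hypothesis hng : metric_compatible (B := tangent_bundle A) A g nabla.
Variables (h : forall p, B p -> B p -> R).
Variable cov : forall p, V -> (forall q, B q) -> B p.
Hypotheses (hh : bundle_metric A h) (hc : connection A cov).
Hypothesis hch : metric_compatible A h cov.
Variables (G : total B -> V * W -> V * W -> R)
  (D : total B -> V * W -> (total B -> V * W) -> V * W).
Hypotheses (hG : Sasaki_metric A cov g h G) (hD : Sasaki_connection A cov nabla D).
Variable K : total B -> R.
Hypothesis Kcont : forall xi, punctured xi ->
  {for chart (total_atlas A B) xi xi,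
     continuous (K \o unchart (total_atlas A B) xi)}.
Hypothesis Krad : forall xi eta, punctured xi -> punctured eta ->
  bnorm h xi = bnorm h eta -> K xi = K eta.

Local Notation TA := (total_atlas A B).
Let fV := finite_dim_rV R n.
Let fW := finite_dim_rV R m.+1.
Let hA := manifold_smooth_atlas hM.
Let hB := manifold_smooth_bundle hM hE.
Let hTA := total_smooth_atlas fV fW hA hB.
Let hi q : inner_product (@h q). Proof. exact: (metric_inner hh q). Qed.
Let GM : bundle_metric (B := tangent_bundle TA) TA G. Proof. by case: hG. Qed.
Let Gi p : inner_product (U := tangent_bundle TA p) (G p).
Proof. exact: (metric_inner GM p). Qed.

Lemma bnorm_bscale c xi : 0 < c -> unit_sphere_bundle h xi -> bnorm h (bscale c xi) = c.
Proof.
move=> c0 ux; have px := unit_punctured hh ux.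
rewrite (bnormE hh); last exact: (punctured_bscale hh).
by rewrite (log_norm_bscale hh) // (log_norm_unit hh ux) addr0 lnK.
Qed.

Section Necessary.
Variable u : total B -> R.
Hypothesis su : smooth_on_subset TA (unit_sphere_bundle h) u.
Hypothesis mc : forall p, radial_graph h u p ->
  mean_curvature TA (n + m) G D (radial_field h) (radial_graph h u) p (K p).
Local Notation ru := (radial_ext h u).

Lemma curvature_at_critical p : radial_graph h u p ->
  (forall w, dif TA (ru : _ -> R^o) p w = 0) ->
  exists F0 : 'I_(n + m) -> V * W, K p = m%:R / bnorm h p -
    bnorm h p * \sum_a hessian TA (ru : _ -> R^o) p (F0 a).
Proof.
move=> Yp crit; have [N [sN nN KE]] := mc Yp.
have [F0 [tF /(_ _ tF) E]] :=
  mean_curvature_critical hA hB hg hng hh hc hch hG hD su Yp crit sN nN.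
by exists F0; rewrite -E (KE F0 tF).
Qed.

(** Moves an extremal point of [radial_ext] along its ray onto the graph. *)
Lemma extremum_on_graph (p : total B) : punctured p ->
  [/\ radial_graph h u (retract h u p), ru (retract h u p) = ru p,
      punctured (retract h u p) & bnorm h (retract h u p) = expR (ru p)].
Proof.
move=> pp; have Y := retract_graph hh u pp.
have [pr e] := (radial_graphP hh u _).1 Y.
have E : ru (retract h u p) = ru p by rewrite (radial_ext_bscale hh) ?expR_gt0.
by split=> //; rewrite (bnormE hh pr) e E.
Qed.

(** At the farthest point of the graph the second derivatives are nonpositive. *)
Lemma curvature_at_max : (exists x : M, True) -> exists p,
  [/\ punctured p, forall q, punctured q -> expR (ru q) <= bnorm h p &
      m%:R / bnorm h p <= K p].
Proof.
move=> M0.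
have sr q : punctured q -> smooth_near TA (ru : _ -> R^o) q.
  exact: (radial_ext_smooth fV fW hA hB hh su).
have [p0 pp0 max0] := global_max hM hE cM sr
  (fun c q c0 pq => radial_ext_bscale hh u c0 pq) M0.
have [Yp rE pp bE] := extremum_on_graph pp0; set p := retract h u p0 in Yp rE pp bE.
have loc w := @local_maximum R _ ((ru : _ -> R^o) \o unchart TA p) (chart TA p p) w (sr p pp).
have near_max : \forall z \near chart TA p p,
    ((ru : _ -> R^o) \o unchart TA p) z <= ((ru : _ -> R^o) \o unchart TA p) (chart TA p p).
  have np : \forall z \near chart TA p p, punctured (unchart TA p z).
    exact: (near_punctured fV fW hA hB hh pp).
  apply: filterS np => z pz.
  rewrite [leRHS](congr1 ru (chartK hTA (dom_refl hTA p))) rE; exact: max0.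
have [F0 KE] := curvature_at_critical Yp (fun w => (loc w near_max).1).
exists p; split=> [//|q pq|]; first by rewrite bE ler_expR max0.
rewrite KE lerBrDr gerDl mulr_ge0_le0 //; first by rewrite bE expR_ge0.
by apply: sumr_le0 => a _; have [] := loc (F0 a) near_max.
Qed.

(** At the nearest point of the graph the second derivatives are nonnegative. *)
Lemma curvature_at_min : (exists x : M, True) -> exists p,
  [/\ punctured p, forall q, punctured q -> bnorm h p <= expR (ru q) &
      K p <= m%:R / bnorm h p].
Proof.
move=> M0.
have sr q : punctured q -> smooth_near TA (ru : _ -> R^o) q.
  exact: (radial_ext_smooth fV fW hA hB hh su).
have [p0 pp0 min0] := @global_max _ _ _ _ A B hM hE cM (fun q => - ru q : R^o)
  (fun q pq => smooth_atN (sr q pq))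
  (fun c q c0 pq => congr1 -%R (radial_ext_bscale hh u c0 pq)) M0.
have [Yp rE pp bE] := extremum_on_graph pp0; set p := retract h u p0 in Yp rE pp bE.
have loc w := @local_minimum R _ ((ru : _ -> R^o) \o unchart TA p) (chart TA p p) w (sr p pp).
have near_min : \forall z \near chart TA p p,
    ((ru : _ -> R^o) \o unchart TA p) (chart TA p p) <= ((ru : _ -> R^o) \o unchart TA p) z.
  have np : \forall z \near chart TA p p, punctured (unchart TA p z).
    exact: (near_punctured fV fW hA hB hh pp).
  apply: filterS np => z pz.
  rewrite [leLHS](congr1 ru (chartK hTA (dom_refl hTA p))) rE.
  by have := min0 _ pz; rewrite lerN2.
have [F0 KE] := curvature_at_critical Yp (fun w => (loc w near_min).1).
exists p; split=> [//|q pq|]; first by rewrite bE ler_expR -lerN2 min0.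
rewrite KE lerBlDr lerDl mulr_ge0 //; first by rewrite bE expR_ge0.
by apply: sumr_ge0 => a _; have [] := loc (F0 a) near_min.
Qed.

(** Since [K] depends on the radius only, the bounds for the curvature at the
    extreme points of the graph are values of one continuous function of the
    radius, to which the intermediate value theorem applies. *)
Lemma graph_radius : exists r : R, 0 < r /\
  forall xi, unit_sphere_bundle h xi -> K (bscale r xi) = m%:R * r^-1.
Proof.
have [M0|M0] := pselect (exists x : M, True); last first.
  by exists 1; split=> // -[b y] _; case: M0; exists b.
have [p1 [pp1 max1 K1]] := curvature_at_max M0.
have [p2 [pp2 min2 K2]] := curvature_at_min M0.
set r1 := bnorm h p1 in max1 K1; set r2 := bnorm h p2 in min2 K2.
have r20 : 0 < r2 by rewrite /r2 (bnormE hh pp2) expR_gt0.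
have r21 : r2 <= r1 := le_trans (min2 p1 pp1) (max1 p1 pp1).
have r10 : 0 < r1 := lt_le_trans r20 r21.
pose xi := normalize h p1.
have uxi : unit_sphere_bundle h xi := normalize_unit hh pp1.
have pxi := unit_punctured hh uxi.
have Kr q : punctured q -> K (bscale (bnorm h q) xi) = K q.
  move=> pq; have q0 : 0 < bnorm h q by rewrite (bnormE hh pq) expR_gt0.
  by apply: Krad => //; [exact: (punctured_bscale hh)|rewrite bnorm_bscale].
pose psi (t : R) : R := t * K (bscale t xi).
have cK t : 0 < t -> {for t, continuous psi}.
  move=> t0; apply: (@continuousM _ _ id (fun t => K (bscale t xi))); first exact: cvg_id.
  pose ray (t : R) : V * W := ((chart TA xi xi).1, t *: (chart TA xi xi).2).
  have tx := tdom_refl hB (base xi).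
  have -> : (fun t => K (bscale t xi)) = (K \o unchart TA xi) \o ray.
    apply/funext => s /=; congr K; rewrite -[in LHS](chartK hTA (dom_refl hTA xi)).
    by rewrite (bscale_unchart hB) //= (chartK hA (dom_refl hA _)).
  have cr : {for t, continuous (ray : R^o -> V * W)}.
    apply: smooth_at_cont; apply: smooth_at_pair; first exact: smooth_at_cst.
    by apply: smooth_atZ; [exact: smooth_at_id|exact: smooth_at_cst].
  apply: (continuous_comp cr).
  have := Kcont (punctured_bscale hh t0 pxi).
  by rewrite [chart _ _ _](chart_bscale hB t (p := xi) tx).
have cpsi : {within `[r2, r1], continuous psi}.
  apply: continuous_in_subspaceT => t; rewrite inE /= in_itv /= => /andP[t2 _].
  by apply: cK; exact: lt_le_trans t2.
have psi2 : psi r2 <= m%:R.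
  by rewrite /psi (Kr _ pp2) mulrC -ler_pdivlMr.
have psi1 : m%:R <= psi r1.
  by rewrite /psi (Kr _ pp1) mulrC -ler_pdivrMr.
have [|c] := @IVT R psi r2 r1 m%:R r21 cpsi.
  by rewrite ge_min psi2 le_max psi1 orbT.
rewrite in_itv /= => /andP[c2 _] cE; have c0 : 0 < c := lt_le_trans r20 c2.
exists c; split=> // eta ueta; have peta := unit_punctured hh ueta.
have -> : K (bscale c eta) = K (bscale c xi).
  apply: Krad; [exact: (punctured_bscale hh)|exact: (punctured_bscale hh)|].
  by rewrite !bnorm_bscale.
by rewrite -cE /psi mulrAC mulfV ?mul1r // gt_eqF.
Qed.

End Necessary.
Lemma constant_smooth (a : R) :
  smooth_on_subset TA (unit_sphere_bundle h) (fun=> a).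
Proof.
move=> q _; exists (fun=> a : R^o); first exact: smooth_at_cst.
have nz := near_dom hTA (dom_refl hTA q) (dom_refl hTA q).
by apply: filterS nz.
Qed.

Section Sufficient.
Variable r : R.
Hypotheses (r0 : 0 < r)
  (Kr : forall xi, unit_sphere_bundle h xi -> K (bscale r xi) = m%:R * r^-1).
Let u : total B -> R := fun=> ln r.
Local Notation Y := (radial_graph h u).

Lemma radial_field_smooth p : punctured p -> vfield_smooth_near TA (radial_field h) p.
Proof.
move=> pp.
have sl : smooth_near TA (fun q => expR (- log_norm h q) : R^o) p.
  apply: (@smooth_at_comp _ _ _ _ ((fun q => - log_norm h q : R^o) \o unchart TA p)
    (expR : R^o -> R^o)).
  - exact: finite_dim_R.
  - exact: smooth_atN (log_norm_smooth fV fW hA hB hh pp).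
  - exact: smooth_at_expR.
apply: smooth_at_eq (scaled_euler_smooth fV fW hA hB sl).
have np : \forall z \near chart TA p p, punctured (unchart TA p z).
  exact: (near_punctured fV fW hA hB hh pp).
apply: filterS np => z pz.
by rewrite /= /radial_field (bnormE hh pz) expRN.
Qed.

(** For constant [u], the norm is constant on the graph, and its gradient is
    radial. *)
Lemma radial_field_normal q : Y q ->
  oriented_unit_normal TA G (radial_field h) Y q (radial_field h q).
Proof.
move=> Yq; have [pq e] := (radial_graphP hh u q).1 Yq.
have q0 : 0 < bnorm h q by rewrite (bnormE hh pq) expR_gt0.
have s0 := sqnorm_gt0 hh pq.
have unit : G q (radial_field h q) (radial_field h q) = 1.
  rewrite (G_ver hG) (ipZl (hi _)) (ipZr (hi _)) -/(sqnorm h q).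
  rewrite -(expR_log_norm hh pq) -(bnormE hh pq).
  by rewrite mulrA -expr2 exprVn mulVf // expf_neq0 // gt_eqF.
split; [|exact: unit|by rewrite unit].
move=> w tw.
have nz := near_dom hTA (dom_refl hTA q) (dom_refl hTA q).
pose F (x : total B) : R^o := log_norm h x - ln r.
have sF : smooth_near TA F q.
  by apply: smooth_atB; [exact: (log_norm_smooth fV fW hA hB hh pq)|exact: smooth_at_cst].
have F0 : near_point TA q (fun x => Y x -> F x = 0).
  apply: filterS nz => z _ /(radial_graphP hh u)[_ ez].
  by rewrite /F ez subrr.
have := tangent_dif fV fW hA hB sF F0 tw.
have sc : smooth_near TA (fun=> ln r : R^o) q by exact: smooth_at_cst.
rewrite /F (difB _ (log_norm_smooth fV fW hA hB hh pq) sc) dif_cst subr0.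
rewrite (dif_log_norm_euler fV fW hA hB hh hch hG _ pq) => /eqP.
rewrite mulf_eq0 invr_eq0 (gt_eqF s0) orbF => /eqP Ew.
rewrite /radial_field (linearZP _ _ (vertical_liftP hB (V := V) (q := q))).
by rewrite [LHS](ipZl (Gi q)) [G q _ w]Ew mulr0.
Qed.

(** The extension of a constant is constant: all points are critical, with zero
    Hessian. *)
Lemma sphere_curvature p : Y p ->
  mean_curvature TA (n + m) G D (radial_field h) Y p (K p).
Proof.
move=> Yp; have [pp e] := (radial_graphP hh u p).1 Yp.
have sN := radial_field_smooth pp.
have nN : near_point TA p (fun q => Y q ->
    oriented_unit_normal TA G (radial_field h) Y q (radial_field h q)).
  have nz := near_dom hTA (dom_refl hTA p) (dom_refl hTA p).
  by apply: filterS nz => z _; exact: radial_field_normal.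
have crit w : dif TA (radial_ext h u : _ -> R^o) p w = 0 by exact: dif_cst.
have [F0 [tF0 E]] :=
  mean_curvature_critical hA hB hg hng hh hc hch hG hD (constant_smooth (ln r))
    Yp crit sN nN.
exists (radial_field h); split=> // F tF.
rewrite /= (E F tF).
have -> : \sum_a hessian TA (radial_ext h u : _ -> R^o) p (F0 a) = 0.
  apply: big1 => a _; rewrite /hessian.
  rewrite (_ : 'D_(F0 a) _ = cst 0) ?derive_cst //.
  by apply/funext => z; exact: derive_cst.
have [xi uxi pE] := Yp.
have bp : bnorm h p = r by rewrite -pE bnorm_bscale ?expR_gt0 // /u lnK.
by rewrite mulr0 subr0 bp -pE /u lnK // Kr.
Qed.

End Sufficient.
End Main.

Theorem mainTheorem1 (R : realType) (n m : nat)
  (hn : (1 <= n)%N) (hm : (2 <= m)%N)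
  (M : topologicalType) (A : atlas M 'rV[R]_n)
  (hA : smooth_manifold A) (hM : compact [set: M])
  (g : M -> 'rV[R]_n -> 'rV[R]_n -> R)
  (hg : bundle_metric (B := tangent_bundle A) A g)
  (nabla : M -> 'rV[R]_n -> (M -> 'rV[R]_n) -> 'rV[R]_n)
  (hnabla : Levi_Civita A g nabla)
  (E : bundle M 'rV[R]_m) (hE : vector_bundle A E)
  (gE : forall p : M, E p -> E p -> R) (hgE : bundle_metric A gE)
  (nablaE : forall p : M, 'rV[R]_n -> (forall q : M, E q) -> E p)
  (hnablaE : connection A nablaE) (hnablaEg : metric_compatible A gE nablaE)
  (G : total E -> 'rV[R]_n * 'rV[R]_m -> 'rV[R]_n * 'rV[R]_m -> R)
  (hG : Sasaki_metric A nablaE g gE G)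
  (D : total E -> 'rV[R]_n * 'rV[R]_m ->
       (total E -> 'rV[R]_n * 'rV[R]_m) -> 'rV[R]_n * 'rV[R]_m)
  (hD : Sasaki_connection A nablaE nabla D)
  (K : total E -> R)
  (hKcont : forall xi, punctured xi ->
     {for chart (total_atlas A E) xi xi,
        continuous (K \o unchart (total_atlas A E) xi)})
  (hKpos : forall xi, punctured xi -> 0 < K xi)
  (hKrad : forall xi eta, punctured xi -> punctured eta ->
     bnorm gE xi = bnorm gE eta -> K xi = K eta) :
  (exists u : total E -> R,
     smooth_on_subset (total_atlas A E) (unit_sphere_bundle gE) u /\
     forall p, radial_graph gE u p ->
       mean_curvature (total_atlas A E) (n + m - 1) G D
         (radial_field gE) (radial_graph gE u) p (K p)) <->
  (exists r : R, 0 < r /\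
     forall xi, unit_sphere_bundle gE xi ->
       K (bscale r xi) = (m%:R - 1) * r^-1).
Proof.
destruct m as [|m]; first by [].
have kE : (n + m.+1 - 1)%N = (n + m)%N by rewrite addnS subn1.
have mE : m.+1%:R - 1 = m%:R :> R by rewrite -natr1 addrK.
have [_ hng _] := hnabla.
rewrite kE mE; split=> [[u [su mc]]|[r [r0 Kr]]].
  exact: (graph_radius hA hE hM hg hng hgE hnablaE hnablaEg hG hD hKcont hKrad su mc).
exists (fun=> ln r); split; first exact: (constant_smooth hA hE).
exact: (sphere_curvature hA hE hg hng hgE hnablaE hnablaEg hG hD r0 Kr).
Qed.
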